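(* Let $p$ be a prime, $q=p^m$, let $r\ge 2$, and let $L\subseteq \mathbf{F}_q$ be an $r$-dimensional $\mathbf{F}_p$-linear subspace. Put $R(x)=\prod_{c\in L}(x-c)\in\mathbf{F}_q[x]$. Let $R=R_1+R_2$ where $$R_1(x)=\sum_{i=s}^{r} b_i x^{p^i}\in\mathbf{F}_q[x],\qquad R_2(x)=\sum_{i=0}^{t} c_i x^{p^i}\in\mathbf{F}_q[x],$$ with $0<s<r$, $0\le t\le s$, $b_sb_r\neq 0$ and $c_0c_t\neq 0$, and assume that the zero sets $L_1$ of $R_1$ and $L_2$ of $R_2$ in $\overline{\mathbf{F}}_q$ are different. Let $C$ be the curve over $\mathbf{F}_q$ defined by $y^{q-1}=-R_1(x)/R_2(x)$. Then the ratio $\#C(\mathbf{F}_q)/g(C)$ satisfies $$\frac{\#C(\mathbf{F}_q)}{g(C)}>\frac{2p^r}{p^{r-s}+p^t},$$ and this bound $2p^r/(p^{r-s}+p^t)$ is optimal for $s=t=[r/2]$. For that choice $s=t=[r/2]$, $$\frac{\#C(\mathbf{F}_q)}{g(C)}>\begin{cases}\sqrt{p^r} & \text{for } r \text{ even},\\[2pt] \dfrac{2\sqrt{p^{r+1}}}{p+1} & \text{for } r\text{ odd}.\end{cases}$$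
   Context: $\mathbf{F}_q$ is the finite field with $q=p^m$ elements and $\overline{\mathbf{F}}_q$ an algebraic closure. The curve ''defined by'' an affine equation $y^{q-1}=f(x)$ means the non-singular complete irreducible curve over $\mathbf{F}_q$ with function field $\mathbf{F}_q(x,y)$, $y^{q-1}=f(x)$; it is a cyclic (Kummer) cover of $\mathbf{P}^1$ of degree $q-1$ via $x$. $\#C(\mathbf{F}_q)$ is the number of $\mathbf{F}_q$-rational points of $C$, $g(C)$ denotes the genus of $C$, and $[\cdot]$ denotes the integer part.
   Formalization: ''Optimal for s=t=[r/2]'' is proved as: among choices s=t=u with 0<u<r, the bound is largest at u=[r/2]. Over all pairs t≤s it is false: for r=2, s=1, t=0 the bound 2p²/(p+1) exceeds the value p at s=t=1; as sharpness it fails too. *)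

(* Defs.v *)
(* MathComp and MathComp-Analysis (classical layer only). *)
From HB Require Import structures.
From mathcomp Require Export all_boot all_order all_algebra all_field finmap.
From mathcomp Require Export boolp classical_sets cardinality.

Set Implicit Arguments.
Unset Strict Implicit.
Unset Printing Implicit Defensive.

Import Order.TTheory GRing.Theory Num.Theory.
Local Open Scope classical_set_scope.
Local Open Scope ring_scope.

(** A smooth complete irreducible curve over [k], given with a nonconstant
    function [x], is represented by its function field: a finite extension [F]
    of k(x) = {fraction {poly k}}.  Its closed points are the places of F/k. *)

Section FunctionField.
Variables (k : fieldType) (F : fieldExtType {fraction {poly k}}).

Definition constant (a : k) : F := (tofrac a%:P)%:A.

(* The normalized discrete valuations of F that are trivial on k.  The value at
   0 (mathematically +oo) is set to 0 so that a place determines the function. *)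
Definition is_place (v : F -> int) : Prop :=
  [/\ v 0 = 0,
      forall z w, z != 0 -> w != 0 -> v (z * w) = v z + v w,
      forall z w, z != 0 -> w != 0 -> z + w != 0 ->
        Num.min (v z) (v w) <= v (z + w),
      forall a : k, v (constant a) = 0
    & exists z, v z = 1].

Record place := Place { val_at :> F -> int; placeP : is_place val_at }.

HB.instance Definition _ := gen_eqMixin place.
HB.instance Definition _ := gen_choiceMixin place.

Definition local_ring (P : place) : set F := [set z | z = 0 \/ 0 <= P z].
Definition maximal_ideal (P : place) : set F := [set z | z = 0 \/ 0 < P z].

(* For k-subspaces W <= U of F: the quotient U / W has a k-basis with n
   elements, namely the classes of the e i. *)
Definition has_dim_quo (U W : set F) (n : nat) : Prop :=
  exists e : 'I_n -> F, (forall i, U (e i)) /\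
    forall u, U u ->
      exists! c : {ffun 'I_n -> k}, W (u - \sum_(i < n) constant (c i) * e i).

(* 0 if the dimension is infinite *)
Definition dim_quo (U W : set F) : nat := xget 0%N [set n | has_dim_quo U W n].

(* the degree over k of the residue field *)
Definition degree (P : place) : nat :=
  dim_quo (local_ring P) (maximal_ideal P).

Definition rational_points : set place := [set P | degree P = 1%N].

(* #C(k); [fset_set] sends an infinite set to the empty one *)
Definition num_rational_points : nat := #|` fset_set rational_points|.

Definition divisor := {fsfun place -> int with 0%R}.

Definition divisor_degree (D : divisor) : int :=
  \sum_(P <- finsupp D) D P * (degree P)%:Z.

Definition Riemann_Roch_space (D : divisor) : set F :=
  [set z | z = 0 \/ forall P : place, - D P <= P z].

Definition ell (D : divisor) : nat := dim_quo (Riemann_Roch_space D) [set 0].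

Definition is_genus (g : nat) : Prop :=
  (forall D : divisor, divisor_degree D - (ell D)%:Z + 1 <= g%:Z) /\
  (exists D : divisor, divisor_degree D - (ell D)%:Z + 1 = g%:Z).

(* Riemann's definition, g = max_D (deg D - l(D) + 1), which is the genus of the
   curve when k is algebraically closed in F *)
Definition genus : nat := xget 0%N [set g | is_genus g].

(* F = k(x, y) with y ^ n = f(x).  No degree [F : k(x)] is imposed: when
   Y ^ n - f is irreducible over k(x) this determines F up to k(x)-isomorphism
   and the degree is n. *)
Definition kummer_function_field (n : nat) (f : {fraction {poly k}}) : Prop :=
  exists2 y : F, y ^+ n = f%:A & <<1; y>>%VS = fullv.

End FunctionField.

(* sum of a_i x^(p^i) over i = m, ..., n *)
Definition p_polynomial (k : fieldType) (p : nat) (a : nat -> k) (m n : nat) :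
    {poly k} :=
  \sum_(m <= i < n.+1) a i *: 'X^(p ^ i).

(* [pPrimeCharType pcharkp] is k itself, seen as a vector space over 'F_p *)
Definition subspace_poly (p : nat) (k : finFieldType)
    (pcharkp : p \in [pchar k]) (L : {vspace pPrimeCharType pcharkp}) :
    {poly k} :=
  \prod_(c : k | (c : pPrimeCharType pcharkp) \in L) ('X - c%:P).

Definition zero_set (k : fieldType) (K : closedFieldType)
    (iota : {rmorphism k -> K}) (f : {poly k}) : set K :=
  [set z | root (map_poly iota f) z].

(* Over all pairs t <= s < r this is largest at s = r - 1, t = 0, but a splitting
   R = R_1 + R_2 with t < s constrains the coefficients of R (R = x^(p^r) - x
   has no such splitting), whereas t = s is compatible with every R: the value
   s = t = [r/2] is optimal among the pairs with s = t. *)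
Definition ratio_bound (A : rcfType) (p r s t : nat) : A :=
  (2 * p ^ r)%:R / (p ^ (r - s) + p ^ t)%:R.

(* Main.v *)
(* The function field F = k(x, y), y ^ n = f with n = q - 1, has the n-th roots
   of unity k^* in its constant field.  Only two estimates are needed.

   Rational points.  At c in L with R_2(c) <> 0 one has f(c) = 1, so x = c has n
   rational places above it, with y = zeta for each zeta in k^*.  The excluded c
   are roots of W = gcd(S, R_2), where R_1 = S ^ (p ^ s).  Hence, with d = deg W,
   #C(k) >= (p ^ r - d) n.

   Genus.  Write S = U W and R_2 = V W.  Multiplying y ^ i by the rational
   function in U, V, W that makes it integral over k[x] with the smallest pole
   at infinity gives n elements z_i, and the x ^ j z_i exhibit a large subspace of
   L(D) for D the zeros of a polynomial plus a multiple of the poles of x; every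
   divisor is below such a D.  Since deg D <= n (deg h + N), Riemann's inequality
   follows with 2 g <= (n - 1) (p ^ (r - s) + p ^ t - d - 1).

   As p ^ (r - s) + p ^ t <= p ^ r, the two estimates give the ratio, provided
   g > 0.  In genus 0 a curve has at most q + 1 rational points, while here
   (p ^ r - d) n >= q + 2. *)

From HB Require Import structures.
Require Import Defs.
From mathcomp Require Import zify ring.

Set Implicit Arguments.
Unset Strict Implicit.
Unset Printing Implicit Defensive.

Import Order.TTheory GRing.Theory Num.Theory.
Local Open Scope classical_set_scope.
Local Open Scope ring_scope.

(** * Linear algebra over the constant field *)

Section FunctionFieldBasics.
Variables (k : fieldType) (F : fieldExtType {fraction {poly k}}).

(** Most of the work rests on one count. After clearing denominators, multiplication by w in F
    raises degrees in x by at most a constant C, so w behaves as if [F : k(w)] were at most n C: any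
    more than n C elements are dependent over k[w]. From this follow the bound n C for the total
    degree of the zeros of w, the finiteness of residue degrees, and the termination of the search
    for a uniformizer in a valuation ring. For w = h(x) one may take C = deg h, and for w = 1 / x
    one may take C = 1; these sharp constants enter the genus bound. Places have to be produced as
    well: rational ones, from an explicit local ring, and poles of functions with a zero, from
    Zorn's lemma. The equality [F : k(x)] = n is where L_1 <> L_2 enters. A point of the algebraic
    closure in exactly one of them is a simple zero of R_2 or a zero of order p ^ s of R_1, and both
    orders are prime to n. That L(0) contains only constants comes from the existence of a rational
    place. Genus 0 has to be excluded because the ratio would then be a division by 0, whose value
    is 0. *)

Definition of_poly (h : {poly k}) : F := (tofrac h)%:A.

Lemma of_poly_is_zmod_morphism : zmod_morphism of_poly.
Proof. by move=> a b; rewrite /of_poly rmorphB scalerBl. Qed.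

Lemma of_poly_is_monoid_morphism : monoid_morphism of_poly.
Proof.
split=> [|a b]; first by rewrite /of_poly rmorph1 scale1r.
by rewrite /of_poly rmorphM -scalerAl mul1r scalerA.
Qed.

HB.instance Definition _ :=
  GRing.isZmodMorphism.Build {poly k} F of_poly of_poly_is_zmod_morphism.
HB.instance Definition _ :=
  GRing.isMonoidMorphism.Build {poly k} F of_poly of_poly_is_monoid_morphism.

Lemma of_poly_eq0 h : (of_poly h == 0) = (h == 0).
Proof. by rewrite /of_poly scaler_eq0 oner_eq0 orbF tofrac_eq0. Qed.

Lemma of_poly_scale h (z : F) : of_poly h * z = tofrac h *: z.
Proof. by rewrite /of_poly -scalerAl mul1r. Qed.

Lemma constant_is_zmod_morphism : zmod_morphism (@constant k F).
Proof. by move=> a b; rewrite /constant !rmorphB scalerBl. Qed.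

Lemma constant_is_monoid_morphism : monoid_morphism (@constant k F).
Proof.
split=> [|a b]; first by rewrite /constant !rmorph1 scale1r.
by rewrite /constant !rmorphM -scalerAl mul1r scalerA.
Qed.

HB.instance Definition _ :=
  GRing.isZmodMorphism.Build k F (@constant k F) constant_is_zmod_morphism.
HB.instance Definition _ :=
  GRing.isMonoidMorphism.Build k F (@constant k F) constant_is_monoid_morphism.

Notation cst := (@constant k F).

Lemma of_polyC a : of_poly a%:P = cst a.
Proof. by []. Qed.

Definition subspace (U : set F) : Prop :=
  U 0 /\ forall a u v, U u -> U v -> U (cst a * u + v).

Section Subspace.
Variables (U : set F) (hU : subspace U).

Lemma subspaceD u v : U u -> U v -> U (u + v).
Proof. by move=> Uu Uv; rewrite -[u]mul1r -(rmorph1 cst); apply: hU.2. Qed.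

Lemma subspaceZ a u : U u -> U (cst a * u).
Proof. by move=> Uu; rewrite -[_ * _]addr0; apply: hU.2 => //; apply: hU.1. Qed.

Lemma subspaceN u : U u -> U (- u).
Proof. by move=> Uu; rewrite -mulN1r -(rmorphN1 cst); apply: subspaceZ. Qed.

Lemma subspaceB u v : U u -> U v -> U (u - v).
Proof. by move=> Uu Uv; apply: subspaceD => //; apply: subspaceN. Qed.

Lemma subspace_sum (I : Type) (r : seq I) (P : pred I) (G : I -> F) :
  (forall i, P i -> U (G i)) -> U (\sum_(i <- r | P i) G i).
Proof. by move=> h; elim/big_ind: _ => //; [apply: hU.1 | apply: subspaceD]. Qed.

Lemma subspace_comb (I : Type) (r : seq I) (P : pred I) (a : I -> k) (G : I -> F) :
  (forall i, P i -> U (G i)) -> U (\sum_(i <- r | P i) cst (a i) * G i).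
Proof. by move=> h; apply: subspace_sum => i /h; apply: subspaceZ. Qed.

End Subspace.

Definition independent (W : set F) (I : finType) (e : I -> F) : Prop :=
  forall c : I -> k, W (\sum_i cst (c i) * e i) -> forall i, c i = 0.

Definition spanning (U W : set F) (I : finType) (g : I -> F) : Prop :=
  forall u, U u -> exists c : I -> k, W (u - \sum_i cst (c i) * g i).

(** Stated through independent families, so that it makes sense before the dimension is known to be
    finite; [dim_leP] converts it into a statement about [dim_quo]. *)
Definition dim_le (U W : set F) (B : nat) : Prop :=
  forall N (e : 'I_N -> F), (forall i, U (e i)) -> independent W e -> (N <= B)%N.

Lemma sum_enum_val (V : nmodType) (I : finType) (G : I -> V) :
  \sum_i G i = \sum_(j < #|I|) G (enum_val j).
Proof.
by rewrite [RHS](reindex (@enum_rank I)) /=;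
  [apply: eq_bigr => i _; rewrite enum_rankK | apply: onW_bij; apply: enum_rank_bij].
Qed.

Lemma dim_le_card U W B (I : finType) (e : I -> F) :
  dim_le U W B -> (forall i, U (e i)) -> independent W e -> (#|I| <= B)%N.
Proof.
move=> hB Ue ind; apply: (hB _ (fun j : 'I_#|I| => e (enum_val j))) => // c Wc i.
have := ind (fun j => c (enum_rank j)).
rewrite sum_enum_val; under eq_bigr do rewrite enum_valK.
by move=> /(_ Wc (enum_val i)); rewrite enum_valK.
Qed.

(** The coefficient matrix of the [e i] over the [g j] has independent rows: a vector in its left
    kernel would be a relation among the [e i] modulo [W]. *)
Lemma independent_card_le W (I J : finType) (e : I -> F) (g : J -> F) :
  subspace W -> (forall i, exists c : J -> k, W (e i - \sum_j cst (c j) * g j)) ->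
  independent W e -> (#|I| <= #|J|)%N.
Proof.
move=> hW /choice[a ha] ind.
pose A := \matrix_(i < #|I|, j < #|J|) a (enum_val i) (enum_val j).
suff: row_free A by move/eqP <-; apply: rank_leq_col.
apply/inj_row_free => v vA0; apply/rowP => i; rewrite mxE.
have := ind (fun i' => v 0 (enum_rank i')) _ (enum_val i).
rewrite enum_valK; apply.
have -> : \sum_i0 cst (v 0 (enum_rank i0)) * e i0 =
  \sum_i0 cst (v 0 (enum_rank i0)) * (e i0 - \sum_j cst (a i0 j) * g j).
  apply/eqP; rewrite -subr_eq0 -sumrB.
  under eq_bigr => i0 _ do rewrite -mulrBr opprB addrC subrK mulr_sumr.
  rewrite exchange_big big1 //= => j _.
  under eq_bigr => i0 _ do rewrite mulrA -rmorphM.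
  rewrite -mulr_suml -rmorph_sum /= sum_enum_val.
  have := congr1 (fun w : 'rV_#|J| => w 0 (enum_rank j)) vA0; rewrite !mxE => h.
  rewrite (_ : \sum_(_ < _) _ = 0) ?rmorph0 ?mul0r // -[RHS]h.
  by apply: eq_bigr => i0 _; rewrite mxE enum_valK enum_rankK.
exact: subspace_comb.
Qed.

Lemma spanning_dim_le U W (J : finType) (g : J -> F) :
  subspace W -> spanning U W g -> dim_le U W #|J|.
Proof.
move=> hW sp N e Ue ind; rewrite -[N]card_ord.
by apply: (independent_card_le hW _ ind) => i; apply: sp.
Qed.

Lemma has_dim_quo_spanning U W n :
  has_dim_quo U W n -> exists e : 'I_n -> F, (forall i, U (e i)) /\ spanning U W e.
Proof.
move=> [e [Ue he]]; exists e; split=> // u /he[c [Wc _]].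
by exists c.
Qed.

Lemma has_dim_quo_independent U W n : subspace U -> subspace W ->
  has_dim_quo U W n -> exists e : 'I_n -> F, (forall i, U (e i)) /\ independent W e.
Proof.
move=> hU hW [e [Ue he]]; exists e; split=> // c Wc i.
have [c0 [W0 uniq0]] := he 0 hU.1.
have e1 : c0 = [ffun=> 0].
  apply: uniq0; rewrite big1 ?subr0; first exact: hW.1.
  by move=> j _; rewrite ffunE rmorph0 mul0r.
have : c0 = [ffun j => - c j].
  apply: uniq0; rewrite sub0r -sumrN.
  by under eq_bigr => j _ do rewrite ffunE rmorphN mulNr opprK.
rewrite e1 => /ffunP/(_ i); rewrite !ffunE => /eqP.
by rewrite eq_sym oppr_eq0 => /eqP.
Qed.

Lemma independent_spanning_has_dim U W n (e : 'I_n -> F) : subspace W ->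
  (forall i, U (e i)) -> independent W e -> spanning U W e -> has_dim_quo U W n.
Proof.
move=> hW Ue ind sp; exists e; split=> // u /sp[c Wc].
exists [ffun i => c i]; split.
  by under eq_bigr => j _ do rewrite ffunE.
move=> c' Wc'; apply/ffunP => i; rewrite ffunE; apply/eqP.
rewrite -subr_eq0; apply/eqP; apply: (ind (fun i => c i - c' i)) => {i}.
have -> : \sum_i cst (c i - c' i) * e i = (u - \sum_i cst (c' i) * e i) -
   (u - \sum_i cst (c i) * e i).
  rewrite opprB addrC addrA subrK -sumrB.
  by apply: eq_bigr => i _; rewrite rmorphB mulrBl.
exact: subspaceB.
Qed.

Lemma dim_le_has_dim U W B : subspace W -> dim_le U W B ->
  exists2 n, (n <= B)%N & has_dim_quo U W n.
Proof.
move=> hW hB.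
pose Q n := `[< exists e : 'I_n -> F, (forall i, U (e i)) /\ independent W e >].
have Q0 : exists n, Q n.
  by exists 0%N; apply/asboolP; exists (fun=> 0); split=> [[]|c _ []].
have QB n : Q n -> (n <= B)%N by move=> /asboolP[e [Ue ind]]; apply: hB Ue ind.
have [n /asboolP[e [Ue ind]] nmax] := ex_maxnP Q0 QB.
exists n; first exact: (hB _ e).
apply: (independent_spanning_has_dim (e := e)) => // u Uu.
apply: contrapT => nsp.
(* An element u outside the span, put in front of the independent family of maximal size, would give
   a longer one. *)
have : Q n.+1.
  apply/asboolP; exists (fun i => if unlift ord0 i is Some j then e j else u).
  split=> [i|c]; first by case: unlift.
  rewrite big_ord_recl unlift_none; under eq_bigr => i _ do rewrite liftK.
  move=> Wc; have [c00|c0n] := eqVneq (c ord0) 0.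
    move: Wc; rewrite c00 rmorph0 mul0r add0r => /ind h i.
    by case: (unliftP ord0 i) => [j|] -> //; apply: h.
  case: nsp; exists (fun i => - (c ord0)^-1 * c (lift ord0 i)).
  have := subspaceZ hW (c ord0)^-1 Wc.
  rewrite mulrDr mulrA -rmorphM mulVf // rmorph1 mul1r mulr_sumr -sumrN.
  congr (W (_ + _)); apply: eq_bigr => i _.
  by rewrite mulrA -rmorphM mulNr rmorphN mulNr opprK.
by move=> /nmax; rewrite ltnn.
Qed.

Lemma has_dim_dim_le U W n : subspace W -> has_dim_quo U W n -> dim_le U W n.
Proof.
move=> hW /has_dim_quo_spanning[e [_ sp]]; rewrite -[n]card_ord.
exact: spanning_dim_le sp.
Qed.

Lemma has_dim_quo_uniq U W n n' : subspace U -> subspace W ->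
  has_dim_quo U W n -> has_dim_quo U W n' -> n = n'.
Proof.
move=> hU hW hn hn'; apply/eqP; rewrite eqn_leq; apply/andP; split.
  have [e [Ue ind]] := has_dim_quo_independent hU hW hn.
  exact: (has_dim_dim_le hW hn') Ue ind.
have [e [Ue ind]] := has_dim_quo_independent hU hW hn'.
exact: (has_dim_dim_le hW hn) Ue ind.
Qed.

Lemma dim_quoE U W n : subspace U -> subspace W ->
  has_dim_quo U W n -> dim_quo U W = n.
Proof.
move=> hU hW hn; rewrite /dim_quo; case: xgetP => [d _ /= hd|/(_ n)] //.
exact: has_dim_quo_uniq hd hn.
Qed.

Lemma dim_leP U W B : subspace U -> subspace W -> dim_le U W B ->
  has_dim_quo U W (dim_quo U W) /\ (dim_quo U W <= B)%N.
Proof.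
move=> hU hW /(dim_le_has_dim hW)[n nB hn].
by rewrite (dim_quoE hU hW hn).
Qed.

Lemma dim_le_trans U V W a b : subspace V -> subspace W ->
  (forall u, V u -> U u) ->
  dim_le U V a -> dim_le V W b -> dim_le U W (a + b).
Proof.
move=> hV hW VU /(dim_le_has_dim hV)[a' aa' ha] /(dim_le_has_dim hW)[b' bb' hb].
have [e [Ue spe]] := has_dim_quo_spanning ha.
have [g [Vg spg]] := has_dim_quo_spanning hb.
have sp : spanning U W (fun i : 'I_a' + 'I_b' => match i with inl i => e i | inr i => g i end).
  move=> u /spe[c /spg[c' Wc]].
  exists (fun i => match i with inl i => c i | inr i => c' i end).
  by rewrite big_sumType /= opprD addrA.
move=> N f Uf ind; have := spanning_dim_le hW sp Uf ind.
rewrite card_sum !card_ord => h; apply: (leq_trans h); exact: leq_add.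
Qed.

(** Used with multiplication by a power of a uniformizer or of an element of L(D); the condition on
    [Y] is the injectivity of the induced map of quotients. *)
Lemma dim_le_map (phi : F -> F) U W X Y B :
  (forall a u v, phi (cst a * u + v) = cst a * phi u + phi v) ->
  (forall u, U u -> X (phi u)) -> (forall u, U u -> Y (phi u) -> W u) ->
  subspace U -> dim_le X Y B -> dim_le U W B.
Proof.
move=> lin UX YW hU hB N e Ue ind; apply: (hB _ (fun i => phi (e i))).
  by move=> i; apply: UX.
have phi0 : phi 0 = 0.
  by have := lin (-1) 0 0; rewrite rmorphN1 mulr0 add0r mulN1r addNr.
have phiS c : phi (\sum_i cst (c i) * e i) = \sum_i cst (c i) * phi (e i).
  elim/big_rec2: _ => // i x y _ <-; exact: lin.
move=> c Yc; apply: ind; apply: YW; last by rewrite phiS.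
exact: subspace_comb.
Qed.

Lemma dim_leW U W B B' : (B <= B')%N -> dim_le U W B -> dim_le U W B'.
Proof. by move=> BB h N e Ue ind; apply: leq_trans BB; apply: h Ue ind. Qed.

End FunctionFieldBasics.

(** * Valuations *)

Section Places.
Variables (k : fieldType) (F : fieldExtType {fraction {poly k}}).
Notation cst := (@constant k F).
Implicit Types (P Q : place F) (z w : F).

Lemma placeM P z w : z != 0 -> w != 0 -> P (z * w) = P z + P w.
Proof. by case: P => v [v0 vM vD vc v1] /=; apply: vM. Qed.

Lemma place0 P : P 0 = 0. Proof. by case: P => v []. Qed.

Lemma place_cst P a : P (cst a) = 0.
Proof. by case: P => v []. Qed.

Lemma place_uniformizer P : exists2 t, t != 0 & P t = 1.
Proof.
case: P => v [v0 vM vD vc [t vt]] /=; exists t => //.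
by apply: contra_eq_neq vt => ->; rewrite v0.
Qed.

Lemma place1 P : P 1 = 0. Proof. by rewrite -(rmorph1 cst) place_cst. Qed.

Lemma placeN P z : P (- z) = P z.
Proof.
have [->|z0] := eqVneq z 0; first by rewrite oppr0.
rewrite -mulN1r placeM ?oppr_eq0 ?oner_eq0 //.
by rewrite -(rmorphN1 cst) place_cst add0r.
Qed.

Lemma placeX P z n : P (z ^+ n) = P z *+ n.
Proof.
have [->|z0] := eqVneq z 0.
  by rewrite expr0n place0; case: n => [|n] /=; rewrite ?place1 ?place0 ?mul0rn.
elim: n => [|n IH]; first by rewrite place1.
by rewrite exprS mulrS placeM ?expf_neq0 // IH.
Qed.

Lemma placeV P z : P z^-1 = - P z.
Proof.
have [->|z0] := eqVneq z 0; first by rewrite invr0 place0 oppr0.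
by apply/eqP; rewrite -addr_eq0 -placeM ?invr_eq0 // mulVf // place1.
Qed.

Lemma placeD P z w : z != 0 -> w != 0 -> z + w != 0 ->
  Num.min (P z) (P w) <= P (z + w).
Proof. by case: P => v [v0 vM vD vc v1] /=; apply: vD. Qed.

Lemma place_eqP P Q : (forall z, z != 0 -> P z = Q z) -> P = Q.
Proof.
case: P Q => v hv [v' hv'] /= h; have e : v = v'.
  apply/funext => z; have [->|/h//] := eqVneq z 0.
  by case: hv hv' => -> _ _ _ _ [->].
by rewrite -e in hv' *; rewrite (Prop_irrelevance hv hv').
Qed.

(* [P z >= j], with the convention [P 0 = +oo]. *)
Definition vge P (j : int) z : bool := (z == 0) || (j <= P z).

Lemma vge0 P j : vge P j 0. Proof. by rewrite /vge eqxx. Qed.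

Lemma vgeE P j z : z != 0 -> vge P j z = (j <= P z).
Proof. by rewrite /vge => /negPf->. Qed.

Lemma vgeD P j z w : vge P j z -> vge P j w -> vge P j (z + w).
Proof.
have [->|z0] := eqVneq z 0; first by rewrite add0r.
have [->|w0] := eqVneq w 0; first by rewrite addr0.
have [->|zw0] := eqVneq (z + w) 0; first by rewrite vge0.
rewrite !vgeE // => jz jw; apply: le_trans (placeD P z0 w0 zw0).
by rewrite le_min jz.
Qed.

Lemma vgeN P j z : vge P j (- z) = vge P j z.
Proof. by rewrite /vge oppr_eq0 placeN. Qed.

Lemma vgeB P j z w : vge P j z -> vge P j w -> vge P j (z - w).
Proof. by move=> hz hw; apply: vgeD => //; rewrite vgeN. Qed.

Lemma vgeM P i j z w : vge P i z -> vge P j w -> vge P (i + j) (z * w).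
Proof.
have [->|z0] := eqVneq z 0; first by move=> *; rewrite mul0r vge0.
have [->|w0] := eqVneq w 0; first by move=> *; rewrite mulr0 vge0.
by rewrite !vgeE ?mulf_neq0 // placeM //; apply: lerD.
Qed.

Lemma vge_cst P a : vge P 0 (cst a).
Proof. by rewrite /vge place_cst lexx orbT. Qed.

Lemma vge1 P : vge P 0 1. Proof. by rewrite -(rmorph1 cst) vge_cst. Qed.

Lemma vgeZ P j a z : vge P j z -> vge P j (cst a * z).
Proof. by move=> h; rewrite -[j]add0r; apply: vgeM => //; apply: vge_cst. Qed.

Lemma vgeW P i j z : i <= j -> vge P j z -> vge P i z.
Proof. by rewrite /vge => ij /orP[->//|/(le_trans ij)->]; rewrite orbT. Qed.

Lemma vge_sum P j (I : Type) (r : seq I) (p : pred I) (G : I -> F) :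
  (forall i, p i -> vge P j (G i)) -> vge P j (\sum_(i <- r | p i) G i).
Proof.
by move=> h; elim/big_ind: _ => //; [apply: vge0 | move=> *; apply: vgeD].
Qed.

Lemma vgeX P j z n : vge P j z -> vge P (j *+ n) (z ^+ n).
Proof.
by move=> hz; elim: n => [|n IH]; rewrite ?vge1 // exprS mulrS; apply: vgeM.
Qed.

Lemma vgeX0 P z n : vge P 0 z -> vge P 0 (z ^+ n).
Proof. by move/(vgeX n); rewrite mul0rn. Qed.

Lemma vgeM0 P z w : vge P 0 z -> vge P 0 w -> vge P 0 (z * w).
Proof. by move=> hz hw; rewrite -[0]addr0; apply: vgeM. Qed.

Lemma vge1_cst P a : vge P 1 (cst a) -> a = 0.
Proof.
by rewrite /vge place_cst ler10 orbF fmorph_eq0 => /eqP.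
Qed.

Lemma vge_subspace P j : subspace [set z | vge P j z].
Proof. by split=> [|a u v /=]; [apply: vge0 | move=> *; apply: vgeD => //; apply: vgeZ]. Qed.

Lemma vge_mulr P i j z w : w != 0 -> P w = j -> vge P (i + j) (z * w) = vge P i z.
Proof.
move=> w0 <-; have [->|z0] := eqVneq z 0; first by rewrite mul0r !vge0.
by rewrite !vgeE ?mulf_neq0 // placeM // lerD2r.
Qed.

Lemma vge_neq0 P j z w : vge P j z -> ~~ vge P j w -> z + w != 0.
Proof.
move=> hz; apply: contraNneq => /eqP; rewrite addrC addr_eq0 => /eqP->.
by rewrite vgeN.
Qed.

Lemma placeD_lt P z w : z != 0 -> w != 0 -> P z < P w ->
  z + w != 0 /\ P (z + w) = P z.
Proof.
move=> z0 w0 zw.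
have hw : vge P (P z + 1) w by rewrite vgeE //; lia.
have hz : ~~ vge P (P z + 1) z by rewrite vgeE //; lia.
have zw0 : z + w != 0 by rewrite addrC; apply: vge_neq0 hw hz.
split=> //; apply/eqP; rewrite eq_le; apply/andP; split; last first.
  by rewrite -vgeE //; apply: vgeD; rewrite vgeE //; lia.
rewrite leNgt; apply: contra hz => h.
by rewrite -{2}[z](addrK w); apply: vgeB => //; rewrite vgeE ?lezD1.
Qed.

Lemma local_ringE P : local_ring P = [set z | vge P 0 z].
Proof.
apply/seteqP; split=> z /=; first by case=> [->|h]; rewrite /vge ?eqxx // h orbT.
by case/orP=> [/eqP|] h; [left|right].
Qed.

Lemma maximal_idealE P : maximal_ideal P = [set z | vge P 1 z].
Proof.
apply/seteqP; split=> z /=; first by rewrite /vge => -[->|h]; rewrite ?eqxx // -gtz0_ge1 h orbT.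
by case/orP=> [/eqP|] h; [left|right; rewrite ?gtz0_ge1].
Qed.

Lemma Riemann_Roch_spaceE (D : divisor F) :
  Riemann_Roch_space D = [set z | forall P, vge P (- D P) z].
Proof.
apply/seteqP; split=> z /=.
  by case=> [->|h] P; rewrite /vge ?eqxx // h orbT.
have [->|z0] := eqVneq z 0; first by left.
by move=> h; right=> P; have := h P; rewrite vgeE.
Qed.

Lemma Riemann_Roch_subspace (D : divisor F) : subspace (Riemann_Roch_space D).
Proof.
rewrite Riemann_Roch_spaceE; split=> [P|a u v hu hv P]; first exact: vge0.
by apply: vgeD => //; apply: vgeZ.
Qed.

Lemma zero_subspace : subspace (F := F) [set 0].
Proof. by split=> // a u v /= -> ->; rewrite mulr0 addr0. Qed.

Definition evc (phi : {poly k}) z : F := (map_poly cst phi).[z].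

Lemma vge_evc P phi z : vge P 0 z -> vge P 0 (evc phi z).
Proof.
move=> hz; rewrite /evc horner_coef; apply: vge_sum => i _.
by apply: vgeM0; [rewrite coef_map vge_cst | apply: vgeX0].
Qed.

Lemma evc_X (phi : {poly k}) z : evc (phi * 'X) z = evc phi z * z.
Proof. by rewrite /evc rmorphM /= map_polyX hornerMX. Qed.

Lemma evc_split (phi : {poly k}) z :
  exists psi : {poly k}, evc phi z = cst phi`_0 + z * evc psi z.
Proof.
elim/poly_ind: phi => [|phi a _].
  by exists 0; rewrite /evc coef0 !rmorph0 horner0 mulr0 addr0.
exists phi; rewrite /evc rmorphD /= hornerD -/(evc _ _) evc_X map_polyC hornerC.
by rewrite coefD coefMX coefC !eqxx add0r addrC mulrC.
Qed.

Lemma poly_divX (phi : {poly k}) : phi != 0 ->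
  exists m, exists2 psi : {poly k}, psi`_0 != 0 & phi = psi * 'X^m.
Proof.
move=> phi0; have [m [psi h e]] := multiplicity_XsubC phi 0.
exists m; exists psi; last by rewrite e subr0.
by move: h; rewrite phi0 /root horner_coef0.
Qed.

(** A function with a zero is transcendental over k: once a power of z is factored out, phi(z) has a
    nonzero constant as residue. *)
Lemma evc_neq0 P phi z : z != 0 -> vge P 1 z -> phi != 0 -> evc phi z != 0.
Proof.
move=> z0 hz /poly_divX[m [psi psi0 ->]].
have -> : evc (psi * 'X^m) z = evc psi z * z ^+ m.
  by rewrite /evc rmorphM /= map_polyXn hornerM hornerXn.
rewrite mulf_neq0 ?expf_neq0 //.
have [g ->] := evc_split psi z.
rewrite addrC; apply: (@vge_neq0 P 1).
  by rewrite -[1]addr0; apply: vgeM => //; apply/vge_evc/vgeW/hz.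
by apply/negP => /vge1_cst /eqP; apply/negP.
Qed.

End Places.

(** * Relations over k[w] *)

Lemma frac_ratio (R : idomainType) (g : {fraction R}) :
  exists a b : R, b != 0 /\ tofrac b * g = tofrac a.
Proof.
elim/quotW: g => x; exists (\n_x), (\d_x); split; first exact: denom_ratioP.
rewrite -[LHS]/(FracField.mul _ _) !piE; apply/eqmodP.
rewrite /= FracField.equivfE /FracField.mulf.
by rewrite !numden_Ratio ?mul1r ?mulr1 ?oner_eq0 ?denom_ratioP.
Qed.

Lemma common_denominator (R : idomainType) (I : finType) (g : I -> {fraction R}) :
  exists2 d : R, d != 0 & exists h : I -> R, forall i, tofrac d * g i = tofrac (h i).
Proof.
have /choice[ab h] i : exists ab : R * R, ab.2 != 0 /\ tofrac ab.2 * g i = tofrac ab.1.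
  by have [a [b h]] := frac_ratio (g i); exists (a, b).
exists (\prod_i (ab i).2); first by apply/prodf_neq0 => i _; apply: (h i).1.
exists (fun i => (\prod_(j | j != i) (ab j).2) * (ab i).1) => i.
by rewrite (bigD1 i) //= rmorphM mulrAC (h i).2 -rmorphM mulrC.
Qed.

(** As long as all constant coefficients vanish, the whole family is divided by 'X; the size of
    [phi i0] bounds the number of divisions. *)
Lemma poly_family_divX (k : fieldType) (I : finType) (phi : I -> {poly k}) i0 :
  phi i0 != 0 -> exists m, exists2 psi : I -> {poly k},
    (exists i, (psi i)`_0 != 0) & forall i, phi i = psi i * 'X^m.
Proof.
move: {2}(size _) (leqnn (size (phi i0))) => N; elim: N phi => [|N IH] phi.
  by rewrite leqn0 size_poly_eq0 => ->.
move=> hN phi0; have [[i h]|nex] := pselect (exists i, (phi i)`_0 != 0).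
  by exists 0%N, phi => [|j]; [exists i | rewrite expr0 mulr1].
have phiX i : phi i = (phi i %/ 'X) * 'X.
  apply/esym/divpK; rewrite -['X]subr0 -(rmorph0 polyC) dvdp_XsubCl /root.
  by rewrite horner_coef0; apply: contrapT => /negP h; apply: nex; exists i.
have e0 : phi i0 %/ 'X != 0 by apply: contraNneq phi0 => h; rewrite phiX h mul0r.
have [|m [psi h e]] := IH (fun i => phi i %/ 'X) _ e0.
  by move: hN; rewrite {1}phiX size_mulX.
by exists m.+1, psi => // i; rewrite phiX e exprSr mulrA.
Qed.

Section Growth.
Variables (k : fieldType) (F : fieldExtType {fraction {poly k}}).
Notation cst := (@constant k F).
Notation of_poly := (@of_poly k F).
Let n := \dim {:F}.
Let X := vbasis {:F}.
Implicit Types (z w : F).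

(** A filtration of F by k-spaces spanned by n T elements, relative to the fixed basis [X] of F over
    k(x); all dimension counts below take place in it. *)
Definition deg_lt (T : nat) z : Prop :=
  exists2 h : 'I_n -> {poly k}, (forall i, (size (h i) <= T)%N) &
    z = \sum_i of_poly (h i) * X`_i.

Lemma deg_ltW T T' z : (T <= T')%N -> deg_lt T z -> deg_lt T' z.
Proof. by move=> TT [h hT ->]; exists h => // i; apply: leq_trans TT. Qed.

Lemma deg_lt0 T : deg_lt T 0.
Proof.
exists (fun=> 0) => [i|]; first by rewrite size_poly0.
by rewrite big1 // => i _; rewrite rmorph0 mul0r.
Qed.

Lemma deg_ltD T z w : deg_lt T z -> deg_lt T w -> deg_lt T (z + w).
Proof.
move=> [h hT ->] [g gT ->]; exists (fun i => h i + g i) => [i|].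
  by rewrite (leq_trans (size_polyD _ _)) // geq_max hT gT.
by rewrite -big_split; apply: eq_bigr => i _; rewrite rmorphD mulrDl.
Qed.

Lemma deg_lt_sum T (I : Type) (r : seq I) (P : pred I) (G : I -> F) :
  (forall i, P i -> deg_lt T (G i)) -> deg_lt T (\sum_(i <- r | P i) G i).
Proof.
by move=> h; elim/big_ind: _ => //; [apply: deg_lt0 | move=> *; apply: deg_ltD].
Qed.

Lemma deg_lt_mul T (a : {poly k}) z : deg_lt T z -> deg_lt (T + (size a).-1) (of_poly a * z).
Proof.
move=> [h hT ->]; exists (fun i => a * h i) => [i|].
  by have := hT i; have := size_polyMleq a (h i); lia.
by rewrite mulr_sumr; apply: eq_bigr => i _; rewrite rmorphM mulrA.
Qed.

Lemma coord_basis z : z = \sum_i coord X i z *: X`_i.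
Proof. by apply: coord_vbasis; rewrite memvf. Qed.

Lemma deg_lt_denominator (I : finType) (u : I -> F) :
  exists2 d : {poly k}, d != 0 & exists T, forall i, deg_lt T (of_poly d * u i).
Proof.
have [d d0 [h hd]] := common_denominator (fun i : I * 'I_n => coord X i.2 (u i.1)).
exists d => //; exists (\max_i size (h i)) => i.
exists (fun j => h (i, j)) => [j|]; first exact: (@leq_bigmax _ (fun i => size (h i))).
rewrite {1}(coord_basis (u i)) mulr_sumr; apply: eq_bigr => j _.
by rewrite of_poly_scale scalerA (hd (i, j)) -of_poly_scale.
Qed.

(** The growth of the filtration under w, up to a denominator d. Multiplication by d alone is
    bounded too, so that d ^ B can serve as a common denominator for all powers w ^ j with j <=
    B. *)
Definition degree_bound (w : F) (C : nat) : Prop :=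
  exists2 d : {poly k}, d != 0 & forall T z, deg_lt T z ->
    deg_lt (T + C) (of_poly d * z) /\ deg_lt (T + C) (of_poly d * (w * z)).

Lemma degree_bound_exists w : exists C, degree_bound w C.
Proof.
have [d d0 [T hT]] := deg_lt_denominator (fun i : 'I_n => w * X`_i).
exists (maxn (size d) T), d => // T' z zT'; split.
  by apply: deg_ltW (deg_lt_mul d zT'); lia.
case: zT' => h hT' ->; rewrite !mulr_sumr; apply: deg_lt_sum => i _.
have -> : of_poly d * (w * (of_poly (h i) * X`_i)) =
  of_poly (h i) * (of_poly d * (w * X`_i)) by ring.
by apply: deg_ltW (deg_lt_mul (h i) (hT i)); have := hT' i; lia.
Qed.

(** With d = 1 the growth is deg h; this yields total degree at most n deg h for the zeros of h. *)
Lemma degree_bound_poly (h : {poly k}) : degree_bound (of_poly h) (size h).-1.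
Proof.
exists 1 => [|T z hz]; first exact: oner_neq0.
rewrite rmorph1 !mul1r; split; first by apply: deg_ltW hz; rewrite leq_addr.
exact: deg_lt_mul.
Qed.

(** With d = 'X the growth is 1; this yields total degree at most n for the poles of x. *)
Lemma degree_bound_invX : degree_bound (of_poly 'X)^-1 1.
Proof.
exists 'X => [|T z hz]; first by rewrite polyX_eq0.
rewrite mulrA divff ?mul1r ?of_poly_eq0 ?polyX_eq0 //; split.
  by have := deg_lt_mul 'X hz; rewrite size_polyX.
by apply: deg_ltW hz; rewrite leq_addr.
Qed.

Lemma deg_lt_span T z : deg_lt T z -> exists c : 'I_n * 'I_T -> k,
  z = \sum_i cst (c i) * (of_poly 'X^(i.2) * X`_(i.1)).
Proof.
move=> [h hT ->]; exists (fun i : 'I_n * 'I_T => (h i.1)`_(i.2)).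
rewrite -(pair_bigA _ (fun i (j : 'I_T) => cst (h i)`_j * (of_poly 'X^j * X`_i))) /=.
apply: eq_bigr => i _.
under eq_bigr do rewrite mulrA -of_polyC -rmorphM mul_polyC.
rewrite -mulr_suml -rmorph_sum; congr (of_poly _ * _).
rewrite -poly_def; apply/polyP => j; rewrite coef_poly.
by case: ltnP => // /(leq_trans (hT i)) /leq_sizeP ->.
Qed.

Section LinearDependence.
Variables (w : F) (C : nat) (hw : degree_bound w C).

Lemma deg_lt_power : exists2 d : {poly k}, d != 0 & forall B j T z, (j <= B)%N ->
  deg_lt T z -> deg_lt (T + C * B) (of_poly d ^+ B * (w ^+ j * z)).
Proof.
have [d d0 hd] := hw; exists d => //; elim=> [|B IH] j T z jB hz.
  by move: jB; rewrite leqn0 => /eqP->; rewrite !expr0 !mul1r muln0 addn0.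
rewrite mulnS (addnC C) addnA; case: j jB => [_|j jB].
  rewrite exprS -mulrA; apply: (hd _ _ _).1.
  exact: IH.
have -> : of_poly d ^+ B.+1 * (w ^+ j.+1 * z) =
  of_poly d * (w * (of_poly d ^+ B * (w ^+ j * z))) by rewrite !exprS; ring.
by apply: (hd _ _ _).2; apply: IH.
Qed.

(* Counting dimensions: the w ^ j u_i with j <= B span a space of dimension at
   most n C B + O(1). *)
Lemma dependent_over_polynomials (I : finType) (u : I -> F) : (n * C < #|I|)%N ->
  exists phi : I -> {poly k}, (exists i, phi i != 0) /\
    \sum_i evc (phi i) w * u i = 0.
Proof.
move=> ltI; have [d d0 hd] := deg_lt_power.
have [e e0 [T hT]] := deg_lt_denominator u.
(* As #|I| >= n C + 1, the #|I| (B + 1) products outnumber the n (T + C B) generators as soon as B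
   >= n T. *)
pose B := (n * T)%N; apply: contrapT => nex.
suff : (#|{: I * 'I_B.+1}| <= #|{: 'I_n * 'I_(T + C * B)}|)%N.
  by rewrite !card_prod !card_ord /B; nia.
apply: (independent_card_le
  (e := fun i : I * 'I_B.+1 => of_poly d ^+ B * (w ^+ i.2 * (of_poly e * u i.1)))
  (g := fun i : 'I_n * 'I_(T + C * B) => of_poly 'X^(i.2) * X`_(i.1)) (zero_subspace F)).
  move=> [i j]; have [|c ->] := deg_lt_span (hd B j T (of_poly e * u i) _ (hT i)).
    by rewrite -ltnS.
  by exists c; rewrite subrr.
move=> c /= c0; apply: contrapT => /existsNP[[i0 j0] /eqP cij].
apply: nex; exists (fun i => \poly_(j < B.+1) c (i, inord j)); split.
  exists i0; apply/eqP => /polyP/(_ j0); rewrite coef_poly coef0 ltn_ord inord_val.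
  exact/eqP.
have de0 : of_poly d ^+ B * of_poly e != 0.
  by rewrite mulf_neq0 ?expf_neq0 // of_poly_eq0.
apply: (mulfI de0); rewrite mulr0 -[RHS]c0.
transitivity (\sum_i \sum_(j < B.+1)
  cst (c (i, j)) * (of_poly d ^+ B * (w ^+ j * (of_poly e * u i)))); last first.
  by rewrite pair_bigA; apply: eq_bigr => -[i j].
rewrite mulr_sumr; apply: eq_bigr => i _.
rewrite /evc (@horner_coef_wide _ B.+1) ?mulr_suml ?mulr_sumr; last first.
  by rewrite (leq_trans (size_poly _ _)) // size_poly.
apply: eq_bigr => j _; rewrite coef_map coef_poly ltn_ord inord_val /=.
rewrite -!mulrA [RHS]mulrCA; congr (_ * _).
by rewrite mulrCA; congr (_ * _); apply: mulrCA.
Qed.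

(** Dividing a relation over k[w] by the largest common power of w leaves one that stays nontrivial
    modulo w. *)
Lemma dependent_mod (I : finType) (u : I -> F) : (n * C < #|I|)%N -> w != 0 ->
  exists a : I -> k, exists psi : I -> {poly k}, (exists i, a i != 0) /\
    \sum_i (cst (a i) + w * evc (psi i) w) * u i = 0.
Proof.
move=> /(dependent_over_polynomials u)[phi [[i0 phi0] h]] w0.
have [m [psi [i1 psi1] e]] := poly_family_divX phi0.
have /choice[psi' hpsi] i := evc_split (psi i) w.
exists (fun i => (psi i)`_0), psi'; split; first by exists i1.
have wm0 : w ^+ m != 0 by rewrite expf_neq0.
apply: (mulfI wm0); rewrite mulr0 -[RHS]h mulr_sumr; apply: eq_bigr => i _.
by rewrite -hpsi e /evc rmorphM /= map_polyXn hornerM hornerXn mulrA [w ^+ m * _]mulrC.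
Qed.

End LinearDependence.
End Growth.

(** * Weak approximation and the degree of the divisor of zeros *)

Section Approximation.
Variables (k : fieldType) (F : fieldExtType {fraction {poly k}}).
Notation cst := (@constant k F).
Implicit Types (P Q : place F) (z w : F).

Lemma place_zunit P t : t != 0 -> P t = 1 -> forall j : int, P (t ^ j) = j.
Proof.
move=> t0 Pt [j|j]; first by rewrite -exprnP placeX Pt -mulr_natr mul1r natz.
by rewrite NegzE -exprnN placeV placeX Pt -mulr_natr mul1r natz.
Qed.

(** Units at P are units at Q, so Q is the multiple Q(t) P for t a uniformizer of P; since both
    valuations take the value 1, the factor is 1. *)
Lemma local_ring_incl_eq P Q :
  (forall z, vge P 0 z -> vge Q 0 z) -> P = Q.
Proof.
move=> PQ; have unit z : P z = 0 -> Q z = 0.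
  have [->|z0] := eqVneq z 0; first by rewrite !place0.
  move=> Pz; apply/eqP; rewrite eq_le.
  have := PQ z; rewrite !vgeE // Pz => ->//; rewrite andbT.
  have := PQ z^-1; rewrite !vgeE ?invr_eq0 // !placeV Pz oppr0 oppr_ge0.
  by apply.
have [t t0 Pt] := place_uniformizer P.
have key z : z != 0 -> Q z = Q t * P z.
  move=> z0; have tz : t ^ P z != 0 by rewrite expfz_neq0.
  have /unit : P (z / t ^ P z) = 0.
    by rewrite placeM ?invr_eq0 // placeV place_zunit // subrr.
  rewrite placeM ?invr_eq0 // placeV => /eqP; rewrite subr_eq0 => /eqP->.
  case: (P z) => j; first by rewrite -exprnP placeX -mulr_natr natz.
  by rewrite NegzE -exprnN placeV placeX -mulr_natr natz mulrN.
have [s s0 Qs] := place_uniformizer Q.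
have Qt : 0 <= Q t by have := PQ t; rewrite !vgeE // Pt; apply.
have Qt1 : Q t = 1.
  have := key s s0; rewrite Qs => e.
  have Ps0 : 0 < P s by rewrite ltNge; apply/negP => h; have := mulr_ge0_le0 Qt h; lia.
  have Qt0 : 0 < Q t by rewrite lt_def Qt andbT; apply: contra_eq_neq e => ->; rewrite mul0r.
  have : Q t <= 1 by rewrite e -[leLHS]mulr1 ler_pM2l // -gtz0_ge1.
  by lia.
by apply: place_eqP => z /key->; rewrite Qt1 mul1r.
Qed.

(** Neither local ring contains the other; the quotient of two witnesses has both signs strict. *)
Lemma separating_pair P Q : P <> Q -> exists z, [/\ z != 0, 0 < P z & Q z < 0].
Proof.
have half P' Q' : P' <> Q' -> exists z, [/\ z != 0, 0 <= P' z & Q' z < 0].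
  move=> neq; apply: contrapT => nex; apply: neq; apply: local_ring_incl_eq => z.
  have [->|z0] := eqVneq z 0; first by rewrite !vge0.
  rewrite !vgeE // leNgt => h; rewrite leNgt; apply/negP => h'; apply: nex.
  by exists z; rewrite leNgt h.
move=> neq; have [a [a0 Pa Qa]] := half P Q neq.
have [|b [b0 Qb Pb]] := half Q P; first by apply: nesym.
exists (a / b); split; first by rewrite mulf_neq0 ?invr_eq0.
  by rewrite placeM ?invr_eq0 // placeV; lia.
by rewrite placeM ?invr_eq0 // placeV; lia.
Qed.

Lemma separating_seq P (s : seq (place F)) : P \notin s ->
  exists z, [/\ z != 0, 0 < P z & forall Q, Q \in s -> Q z < 0].
Proof.
elim: s => [_|Q s IH]; first by have [t t0 Pt] := place_uniformizer P; exists t; rewrite Pt.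
rewrite inE negb_or => /andP[/eqP PQ Ps]; have [z [z0 Pz sz]] := IH Ps.
have [Qz|Qz] := ltP (Q z) 0.
  by exists z; split=> // Q'; rewrite inE => /orP[/eqP->|/sz].
have [y [y0 Py Qy]] := separating_pair PQ.
(* At each Q' in s the value of z is nonzero and smaller than r in absolute value, hence never equal
   to the multiple r Q'(y). So z + y ^ r takes there the smaller of the two values, which is
   negative. *)
pose r := (\max_(Q' <- s) `|Q' z|).+1%N.
have yr0 : y ^+ r != 0 by rewrite expf_neq0.
have Qyr Q' : Q' (y ^+ r) = Q' y * r%:Z by rewrite placeX -mulr_natr natz.
have hr Q' : Q' \in s -> (`|Q' z| < r)%N.
  by move=> Q's; rewrite ltnS (big_rem _ Q's) /= leq_maxl.
have Py1 : 0 < P (z + y ^+ r) /\ z + y ^+ r != 0.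
  have vz : vge P 1 (z + y ^+ r).
    by apply: vgeD; rewrite vgeE // ?Qyr; nia.
  have [] : z + y ^+ r != 0 /\ Q (z + y ^+ r) = Q (y ^+ r).
    by rewrite addrC; apply: placeD_lt => //; rewrite Qyr; nia.
  by move=> h _; split=> //; move: vz; rewrite vgeE //; lia.
exists (z + y ^+ r); split=> [||Q']; [exact: Py1.2 | exact: Py1.1 |].
rewrite inE => /orP[/eqP->|Q's].
  have [_] : y ^+ r + z != 0 /\ Q (y ^+ r + z) = Q (y ^+ r).
    by apply: placeD_lt => //; rewrite Qyr; nia.
  by rewrite addrC Qyr => ->; nia.
have := hr _ Q's; have := sz _ Q's => Q'z Q'r.
have [lt|ge] := ltP (Q' z) (Q' (y ^+ r)).
  by have [_ ->] := placeD_lt z0 yr0 lt.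
have lt : Q' (y ^+ r) < Q' z.
  rewrite lt_neqAle ge andbT Qyr; apply/eqP => e.
  have := abszM (Q' y) r; rewrite e absz_nat.
  case: `|Q' y|%N => [|u] h; first by lia.
  by have := leq_pmull r (ltn0Sn u); lia.
have [_] := placeD_lt yr0 z0 lt; rewrite addrC => ->.
exact: lt_trans lt Q'z.
Qed.

(** The function 1 / (1 + z ^ (B + 1)) is close to 1 where z has a zero and close to 0 where z has a
    pole. The exponent is positive even for B = 0. *)
Lemma approximate_one P (s : seq (place F)) (B : nat) : P \notin s ->
  exists e, vge P B (e - 1) /\ forall Q, Q \in s -> vge Q B e.
Proof.
move=> Ps; have [z [z0 Pz sz]] := separating_seq Ps.
have zB0 : z ^+ B.+1 != 0 by rewrite expf_neq0.
have PzB Q : Q (z ^+ B.+1) = Q z * B.+1%:Z by rewrite placeX -mulr_natr natz.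
have [d0 Pd] : 1 + z ^+ B.+1 != 0 /\ P (1 + z ^+ B.+1) = P 1.
  by apply: placeD_lt; rewrite ?oner_eq0 // place1 PzB; nia.
exists (1 + z ^+ B.+1)^-1; split.
  have -> : (1 + z ^+ B.+1)^-1 - 1 = - z ^+ B.+1 * (1 + z ^+ B.+1)^-1 by field.
  rewrite vgeE ?mulf_neq0 ?oppr_eq0 ?invr_eq0 //.
  by rewrite placeM ?oppr_eq0 ?invr_eq0 // placeV placeN Pd place1 PzB; nia.
move=> Q Qs; rewrite vgeE ?invr_eq0 // placeV.
have [_] : z ^+ B.+1 + 1 != 0 /\ Q (z ^+ B.+1 + 1) = Q (z ^+ B.+1).
  apply: placeD_lt; rewrite ?oner_eq0 // place1 PzB.
  by have := sz _ Qs; nia.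
by rewrite addrC PzB => ->; have := sz _ Qs; nia.
Qed.

(** Uniqueness of t-adic expansions: reduction modulo t kills the lowest digit, and division by t
    shifts the others. *)
Lemma independent_adic P (J : finType) (z : J -> F) t :
  t != 0 -> P t = 1 -> (forall j, vge P 0 (z j)) ->
  independent [set x | vge P 1 x] z -> forall (m : nat) (c : nat -> J -> k),
  vge P m (\sum_(l < m) \sum_j cst (c l j) * (t ^+ l * z j)) ->
  forall l j, (l < m)%N -> c l j = 0.
Proof.
move=> t0 Pt Oz ind; elim=> // m IH c; rewrite big_ord_recl /=.
have -> : \sum_(i < m) \sum_j cst (c (bump 0 i) j) * (t ^+ bump 0 i * z j) =
    (\sum_(i < m) \sum_j cst (c i.+1 j) * (t ^+ i * z j)) * t.
  rewrite mulr_suml; apply: eq_bigr => i _; rewrite mulr_suml; apply: eq_bigr => j _.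
  by rewrite exprSr -!mulrA; congr (_ * (_ * _)); apply: mulrC.
set S := \sum_(i < m) _ => h.
have OS : vge P 0 S.
  apply: vge_sum => i _; apply: vge_sum => j _; apply: vgeZ; apply: vgeM0 => //.
  by apply: vgeX0; rewrite vgeE // Pt.
have St : vge P 1 (S * t) by rewrite -[1]add0r vge_mulr.
have c0 : forall j, c 0%N j = 0.
  apply: ind => /=; under eq_bigr => j _ do rewrite -[z j]mul1r -(expr0 t).
  by rewrite -[X in vge P 1 X](addrK (S * t)); apply: vgeB St; apply: vgeW h; lia.
have hS : vge P m S.
  move: h; rewrite big1 ?add0r => [|j _]; last by rewrite c0 rmorph0 mul0r.
  by rewrite (_ : m.+1%:Z = m%:Z + 1) ?vge_mulr //; lia.
by move=> [|l] j lm; [apply: c0 | apply: (IH (fun l => c l.+1) hS)].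
Qed.

Notation n := (\dim {:F}).

(** If the elements t_i ^ l z_(i,j) with l < Ps i w numbered more than n C, then, localized at their
    places by weak approximation, they would satisfy a relation nontrivial modulo w. At one of the
    places this contradicts [independent_adic]. Independent families stand in for degrees because
    the finiteness of [degree] is deduced from this theorem. *)
Theorem sum_zeros_degree_le (I : finType) (Ps : I -> place F) (w : F) (C : nat)
    (N : I -> nat) (z : forall i, 'I_(N i) -> F) :
  injective Ps -> w != 0 -> degree_bound w C -> (forall i, 0 < Ps i w) ->
  (forall i j, vge (Ps i) 0 (z i j)) ->
  (forall i, independent [set x | vge (Ps i) 1 x] (z i)) ->
  (\sum_i `|Ps i w| * N i <= n * C)%N.
Proof.
move=> injP w0 hw Pw Oz ind.
pose m i := `|Ps i w|%N.
pose T := {i : I & ('I_(m i) * 'I_(N i))%type}.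
have -> : (\sum_i `|Ps i w| * N i)%N = #|{: T}|.
  rewrite card_tagged sumnE big_map big_enum /=.
  by apply: eq_bigr => i _; rewrite card_prod !card_ord.
rewrite leqNgt; apply/negP => lt.
have /choice[t ht] i : exists t, t != 0 /\ Ps i t = 1.
  by have [t t0 Pt] := place_uniformizer (Ps i); exists t.
pose e (x : T) : F := t (tag x) ^+ (tagged x).1 * z (tag x) (tagged x).2.
have Oe x : vge (Ps (tag x)) 0 (e x).
  by apply: vgeM0 => //; apply: vgeX0; rewrite vgeE ?(ht _).1 // (ht _).2.
(* An error of order [B] at [Ps i] still vanishes to order [m i] there after multiplication by any
   [e x], even if [e x] has a pole. *)
pose B := (\max_(y : T * I) (m y.2 + `|Ps y.2 (e y.1)|))%N.
have hB x i : (m i + `|Ps i (e x)| <= B)%N.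
  exact: (@leq_bigmax _ (fun y : T * I => (m y.2 + `|Ps y.2 (e y.1)|)%N) (x, i)).
have /choice[eps heps] i : exists eps, vge (Ps i) B (eps - 1) /\
    forall j, j != i -> vge (Ps j) B eps.
  have [|eps [h1 h2]] := @approximate_one (Ps i) [seq Ps j | j <- enum I & j != i] B.
    apply/mapP => -[j]; rewrite mem_filter => /andP[/eqP ji _] /injP e0.
    by apply: ji.
  exists eps; split=> // j ji; apply: h2; apply: map_f.
  by rewrite mem_filter ji mem_enum.
have [a [psi [[x0 a0] h]]] := dependent_mod hw (fun x => eps (tag x) * e x) lt w0.
pose i0 := tag x0.
have Ow i : vge (Ps i) (m i) w by rewrite vgeE // /m; have := Pw i; lia.
have Ow0 i : vge (Ps i) 0 w by apply: vgeW (Ow i); lia.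
have big_e x i : vge (Ps i) ((m i)%:Z - B%:Z) (e x).
  by have := hB x i; rewrite /vge; have [//|_ /=] := eqVneq (e x) 0; lia.
have Oeps : vge (Ps i0) 0 (eps i0).
  rewrite -[eps i0](subrK 1); apply: vgeD; last exact: vge1.
  by apply: vgeW (heps i0).1; lia.
(* At [Ps i0], to order [m i0], w is 0 and [eps (tag x)] is 1 or 0 according to whether x belongs to
   i0. Only the terms of i0 survive, with their constant coefficients. *)
have small x : vge (Ps i0) (m i0) ((cst (a x) + w * evc (psi x) w) * (eps (tag x) * e x)
   - (if tag x == i0 then cst (a x) * e x else 0)).
  have Og : vge (Ps i0) 0 (evc (psi x) w) by apply: vge_evc.
  have [ei|ni] := eqVneq (tag x) i0.
    have Oe' : vge (Ps i0) 0 (e x) by rewrite -ei.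
    rewrite ei.
    have -> : (cst (a x) + w * evc (psi x) w) * (eps i0 * e x) - cst (a x) * e x =
       cst (a x) * ((eps i0 - 1) * e x) + w * (evc (psi x) w * (eps i0 * e x)).
      by rewrite mulrDl -!mulrA [RHS]addrC [LHS]addrAC [LHS]addrC mulrBl mul1r mulrBr.
    apply: vgeD.
      apply: vgeZ; rewrite (_ : (m i0)%:Z = B%:Z + ((m i0)%:Z - B%:Z)); last by lia.
      by apply: vgeM => //; apply: (heps i0).1.
    by rewrite -[(m i0)%:Z]addr0; apply: vgeM => //; do 2?apply: vgeM0.
  rewrite subr0 -[(m i0)%:Z]add0r; apply: vgeM.
    by apply: vgeD; [apply: vge_cst | apply: vgeM0].
  rewrite (_ : (m i0)%:Z = B%:Z + ((m i0)%:Z - B%:Z)); last by lia.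
  by apply: vgeM => //; apply: (heps _).2; rewrite eq_sym.
have : vge (Ps i0) (m i0) (\sum_(x : T)
    ((cst (a x) + w * evc (psi x) w) * (eps (tag x) * e x)
     - (if tag x == i0 then cst (a x) * e x else 0))).
  by apply: vge_sum => x _; apply: small.
rewrite sumrB h sub0r vgeN -big_mkcond /=.
pose tg i (y : 'I_(m i) * 'I_(N i)) : T := Tagged _ y.
have -> : \sum_(x : T | tag x == i0) cst (a x) * e x =
    \sum_y cst (a (tg i0 y)) * e (tg i0 y).
  transitivity (\sum_(i | i == i0) \sum_y cst (a (tg i y)) * e (tg i y)).
    by rewrite sig_big_dep; apply: eq_big => [[i y]|[i y] _] //=; rewrite andbT.
  by rewrite big_pred1_eq.
pose c l j := if insub l is Some l' then a (tg i0 (l', j)) else 0.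
have cE (l : 'I_(m i0)) j : c l j = a (tg i0 (l, j)) by rewrite /c valK.
have -> : \sum_y cst (a (tg i0 y)) * e (tg i0 y) =
    \sum_(l < m i0) \sum_j cst (c l j) * (t i0 ^+ l * z i0 j).
  by rewrite pair_bigA; apply: eq_bigr => -[l j] _; rewrite cE.
move=> /(independent_adic (ht i0).1 (ht i0).2 (Oz i0) (ind i0)) c0.
case/eqP: a0.
have tgK (x : T) : tg (tag x) ((tagged x).1, (tagged x).2) = x by case: x => i [].
by rewrite -[in LHS](tgK x0) -cE; apply: c0.
Qed.


End Approximation.

Local Open Scope fset_scope.
Local Open Scope ring_scope.

(** * Residue degrees, finiteness of zeros and of rational points *)

Section Degrees.
Variables (k : fieldType) (F : fieldExtType {fraction {poly k}}).
Notation cst := (@constant k F).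
Notation of_poly := (@of_poly k F).
Notation n := (\dim {:F}).
Implicit Types (P Q : place F) (z w : F).

Lemma local_ring_subspace P : subspace (local_ring P).
Proof. by rewrite local_ringE; apply: vge_subspace. Qed.

Lemma maximal_ideal_subspace P : subspace (maximal_ideal P).
Proof. by rewrite maximal_idealE; apply: vge_subspace. Qed.

(** The counting theorem, applied to P alone and a uniformizer, bounds every independent family of
    residues. *)
Lemma degree_dim P : has_dim_quo (local_ring P) (maximal_ideal P) (degree P).
Proof.
have [t t0 Pt] := place_uniformizer P; have [C hC] := degree_bound_exists t.
have hB : dim_le (local_ring P) (maximal_ideal P) (n * C).
  move=> N e; rewrite local_ringE maximal_idealE => Oe ind.
  have := @sum_zeros_degree_le _ _ unit (fun=> P) t C (fun=> N) (fun=> e).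
  rewrite big_const card_unit iter_addn_0 muln1 Pt mul1n; apply=> //.
  by move=> [] [].
by have [] := dim_leP (local_ring_subspace P) (maximal_ideal_subspace P) hB.
Qed.

Lemma degree_gt0 P : (0 < degree P)%N.
Proof.
rewrite lt0n; apply/eqP => d0; have := degree_dim P; rewrite d0 => -[e [_ h]].
have [|c [+ _]] := h 1; first by rewrite local_ringE /= vge1.
rewrite big_ord0 subr0 maximal_idealE /= -(rmorph1 cst) => /vge1_cst /eqP.
by rewrite oner_eq0.
Qed.

Theorem zeros_degree_le (S : {fset place F}) w C : w != 0 -> degree_bound w C ->
  (forall P, P \in S -> 0 < P w) -> (\sum_(P <- S) `|P w| * degree P <= n * C)%N.
Proof.
move=> w0 hw hS.
have /fin_all_exists[e he] (i : S) : exists e : 'I_(degree (val i)) -> F,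
    (forall j, local_ring (val i) (e j)) /\ independent (maximal_ideal (val i)) e.
  exact: has_dim_quo_independent (local_ring_subspace _) (maximal_ideal_subspace _) (degree_dim _).
rewrite big_seq_fsetE /=; apply: (sum_zeros_degree_le (z := e) val_inj w0 hw).
- by move=> i; apply: hS; apply: valP.
- by move=> i j; have := (he i).1 j; rewrite local_ringE.
- by move=> i; have := (he i).2; rewrite maximal_idealE.
Qed.

(** Each zero contributes at least 1 to a sum bounded by n C. *)
Lemma finite_zeros w : w != 0 -> finite_set [set P : place F | 0 < P w].
Proof.
move=> w0; apply: contrapT => /infinite_set_fset inf.
have [C hw] := degree_bound_exists w.
have [S SZ] := inf (n * C).+1; rewrite ltnNge => /negP; apply.
apply: leq_trans (zeros_degree_le w0 hw SZ).
rewrite card_fset_sum1 big_seq [leqRHS]big_seq; apply: leq_sum => P /SZ /= Pw.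
by rewrite muln_gt0 degree_gt0 andbT absz_gt0; lia.
Qed.

Lemma evc_of_poly (h g : {poly k}) : evc h (of_poly g) = of_poly (h \Po g).
Proof.
rewrite /evc horner_coef size_map_poly comp_polyE rmorph_sum /=.
by apply: eq_bigr => i _; rewrite -mul_polyC rmorphM rmorphXn coef_map.
Qed.

(** Otherwise all nonzero polynomials are units at P, and in a relation over k[x] among the n + 1
    powers 1, t, ..., t ^ n of a uniformizer the nonzero terms have distinct valuations. *)
Lemma finite_place_polynomial P : vge P 0 (of_poly 'X) ->
  exists2 h : {poly k}, h != 0 & 0 < P (of_poly h).
Proof.
move=> Px; apply: contrapT => nex.
have [t t0 Pt] := place_uniformizer P.
have Ph (h : {poly k}) : h != 0 -> P (of_poly h) = 0.
  move=> h0; apply/eqP; rewrite eq_le; apply/andP; split.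
    by rewrite leNgt; apply/negP => hP; apply: nex; exists h.
  by rewrite -vgeE ?of_poly_eq0 // -[h]comp_polyXr -evc_of_poly vge_evc.
have [phi [exphi h]] := @dependent_over_polynomials _ _ _ _
  (degree_bound_poly F 'X) 'I_n.+1 (fun i => t ^+ i)
  ltac:(by rewrite size_polyX muln1 card_ord).
pose Q j := (j < n.+1)%N && (phi (inord j) != 0).
have exQ : exists j, Q j.
  by case: exphi => i hi; exists i; rewrite /Q ltn_ord inord_val.
have [j /andP[jn phij] jmin] := ex_minnP exQ.
move: h; rewrite (bigD1 (Ordinal jn)) //= => /eqP; rewrite addr_eq0 => /eqP.
have -> : evc (phi (Ordinal jn)) (of_poly 'X) = of_poly (phi (inord j)).
  rewrite evc_of_poly comp_polyXr; congr (of_poly (phi _)).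
  by apply: val_inj; rewrite /= inordK.
move=> e; have : vge P j.+1 (of_poly (phi (inord j)) * t ^+ j).
  rewrite e vgeN; apply: vge_sum => i ij.
  have [->|phii] := eqVneq (phi i) 0.
    by rewrite /evc rmorph0 horner0 mul0r vge0.
  rewrite evc_of_poly comp_polyXr vgeE ?mulf_neq0 ?expf_neq0 ?of_poly_eq0 //.
  rewrite placeM ?expf_neq0 ?of_poly_eq0 // Ph // placeX Pt add0r -mulr_natr mul1r natz.
  rewrite lez_nat ltn_neqAle eq_sym -(inj_eq val_inj) in ij *.
  by rewrite ij jmin // /Q ltn_ord inord_val.
rewrite vgeE ?mulf_neq0 ?expf_neq0 ?of_poly_eq0 // placeM ?expf_neq0 ?of_poly_eq0 //.
by rewrite Ph // placeX Pt add0r -mulr_natr mul1r natz; lia.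
Qed.

Lemma rational_residue P z : degree P = 1%N -> vge P 0 z ->
  exists a, vge P 1 (z - cst a).
Proof.
move=> Prat Oz; have := degree_dim P; rewrite Prat => -[e [Oe h]].
have [|c1 [+ _]] := h 1; first by rewrite local_ringE /= vge1.
have [|cz [+ _]] := h z; first by rewrite local_ringE.
rewrite !big_ord_recl !big_ord0 !addr0 maximal_idealE /= => hz h1.
have c10 : c1 ord0 != 0.
  apply/eqP => c0; move: h1; rewrite c0 rmorph0 mul0r subr0.
  by rewrite -(rmorph1 cst) => /vge1_cst /eqP; rewrite oner_eq0.
(* The given basis of the residue field need not be the class of 1, hence the division by the
   coordinate of 1. *)
exists (cz ord0 / c1 ord0).
have -> : z - cst (cz ord0 / c1 ord0) = (z - cst (cz ord0) * e ord0)
    - cst (cz ord0 / c1 ord0) * (1 - cst (c1 ord0) * e ord0).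
  rewrite mulrBr mulr1 mulrA -rmorphM divfK //.
  by rewrite opprB addrA subrK.
by apply: vgeB => //; apply: vgeZ.
Qed.

End Degrees.

(** A rational point is a pole of x or a zero of some x - c with c in k. Without finiteness
    [num_rational_points] would count nothing, since [fset_set] of an infinite set is empty. *)
Lemma finite_rational_points (k : finFieldType) (F : fieldExtType {fraction {poly k}}) :
  finite_set (@rational_points k F).
Proof.
pose x : F := @of_poly k F 'X.
pose Z w := [set P : place F | 0 < P w].
have x0 : x != 0 by rewrite of_poly_eq0 polyX_eq0.
apply: (@sub_finite_set _ _ (Z x^-1 `|` \bigcup_(c in [set: k]) Z (x - @constant k F c))).
  move=> P /= Prat; have [Px|Px] := boolP (vge P 0 x); last first.
    by left; rewrite /Z /= placeV; move: Px; rewrite vgeE //; lia.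
  have [c hc] := rational_residue Prat Px; right; exists c => //; rewrite /Z /=.
  move: hc; rewrite vgeE; first by rewrite -gtz0_ge1.
  by rewrite /x -of_polyC -rmorphB of_poly_eq0 polyXsubC_eq0.
rewrite finite_setU; split; first by apply: finite_zeros; rewrite invr_eq0.
apply: bigcup_finite; first exact: finite_finset.
by move=> c _; apply: finite_zeros; rewrite -of_polyC -rmorphB of_poly_eq0 polyXsubC_eq0.
Qed.

(** * Riemann-Roch spaces *)

Section Divisors.
Variables (k : fieldType) (F : fieldExtType {fraction {poly k}}).
Notation cst := (@constant k F).
Implicit Types (P Q : place F) (z w : F) (D : divisor F) (S : {fset place F}).

Lemma divisor_of S (f : place F -> int) : (forall P, P \notin S -> f P = 0) ->
  exists D, forall P, D P = f P.
Proof.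
move=> h; exists [fsfun P in S => f P | 0] => P.
by rewrite fsfunE; case: ifPn => // /h.
Qed.

Lemma divisor_degreeE S D : (forall P, P \notin S -> D P = 0) ->
  divisor_degree D = \sum_(P <- S) D P * (degree P)%:Z.
Proof.
move=> h; apply: big_fset_incl.
  apply/fsubsetP => P; rewrite mem_finsupp; apply: contraR => /h->.
  by rewrite eqxx.
by move=> P _ /fsfun_dflt->; rewrite mul0r.
Qed.

(** Multiplication by t ^ (D' P), with t a uniformizer at P, embeds the quotient into the residue
    field of P. *)
Lemma Riemann_Roch_step D D' P : D' P = D P + 1 -> (forall Q, Q != P -> D' Q = D Q) ->
  dim_le (Riemann_Roch_space D') (Riemann_Roch_space D) (degree P).
Proof.
move=> DP DQ; have [t t0 Pt] := place_uniformizer P.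
have tD0 : t ^ D' P != 0 by rewrite expfz_neq0.
have PtD : P (t ^ D' P) = D' P by rewrite place_zunit.
apply: (@dim_le_map _ _ (fun u => u * t ^ D' P) _ _ (local_ring P) (maximal_ideal P)).
- by move=> a u v; rewrite mulrDl mulrA.
- move=> u; rewrite Riemann_Roch_spaceE local_ringE /= => /(_ P).
  by rewrite -(vge_mulr _ _ tD0 PtD) addNr.
- move=> u; rewrite !Riemann_Roch_spaceE maximal_idealE /= => hu huP Q.
  have [->|/DQ<-//] := eqVneq Q P.
  have e : - D P + D' P = 1 by rewrite DP addrA addNr add0r.
  by rewrite -(vge_mulr _ _ tD0 PtD) e.
- exact: Riemann_Roch_subspace.
- exact: has_dim_dim_le (maximal_ideal_subspace P) (degree_dim P).
Qed.

Lemma Riemann_Roch_incl D D' z : (forall P, D P <= D' P) ->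
  Riemann_Roch_space D z -> Riemann_Roch_space D' z.
Proof.
rewrite !Riemann_Roch_spaceE => h hz P; apply: vgeW (hz P).
by rewrite lerN2.
Qed.

Lemma dim_le_refl (U : set F) : dim_le U U 0.
Proof.
move=> N e Ue ind; case: N e Ue ind => // N e Ue ind.
have := ind (fun i => if i == ord0 then 1 else 0) _ ord0; rewrite eqxx.
rewrite (bigD1 ord0) //= big1 => [|i /negPf->]; last by rewrite rmorph0 mul0r.
by rewrite rmorph1 mul1r addr0 => /(_ (Ue _))/eqP; rewrite oner_eq0.
Qed.

(** Induction on the total difference: D' is lowered by one point at a time, each time at a cost of
    at most its degree. *)
Lemma Riemann_Roch_dim_le S D D' : (forall P, D P <= D' P) ->
  (forall P, P \notin S -> D P = D' P) ->
  dim_le (Riemann_Roch_space D') (Riemann_Roch_space D)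
    (\sum_(P <- S) `|D' P - D P| * degree P)%N.
Proof.
move: {2}(\sum_(P <- S) `|D' P - D P|)%N (leqnn (\sum_(P <- S) `|D' P - D P|)%N) => m.
elim: m D' => [|m IH] D' hm le eqS.
  suff -> : D' = D by apply: dim_leW (@dim_le_refl _).
  apply/fsfunP => P; have [PS|/eqS//] := boolP (P \in S).
  by move: hm; rewrite (big_fsetD1 P) //= leqn0 addn_eq0 => /andP[]; lia.
have [[P [PS lt]]|nlt] := pselect (exists P, P \in S /\ D P < D' P); last first.
  apply: IH => //; rewrite big_seq big1 // => P PS.
  apply/eqP; rewrite absz_eq0 subr_eq0 eq_le le andbT leNgt.
  by apply/negP => h; apply: nlt; exists P.
have [D'' hD''] : exists D'', forall Q, D'' Q = D' Q - (Q == P)%:R.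
  apply: (divisor_of (S := finsupp D' `|` [fset P])) => Q.
  by rewrite !inE negb_or => /andP[/fsfun_dflt-> /negPf->]; rewrite subr0.
have D''P : D'' P = D' P - 1 by rewrite hD'' eqxx.
have D''Q Q : Q != P -> D'' Q = D' Q by move=> /negPf QP; rewrite hD'' QP subr0.
have le'' Q : D Q <= D'' Q.
  by have [->|/D''Q->//] := eqVneq Q P; rewrite D''P; lia.
have eS (f : place F -> nat) : (\sum_(Q <- S) `|D' Q - D Q| * f Q =
    f P + \sum_(Q <- S) `|D'' Q - D Q| * f Q)%N.
  rewrite (big_fsetD1 P PS) [in RHS](big_fsetD1 P PS) /= addnA; congr addn; last first.
    rewrite big_seq [RHS]big_seq; apply: eq_bigr => Q; rewrite !inE => /andP[QP _].
    by rewrite D''Q.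
  have -> : `|D' P - D P|%N = `|D'' P - D P|.+1 by rewrite D''P; lia.
  by rewrite mulSn.
rewrite eS; apply: dim_le_trans.
- exact: (Riemann_Roch_subspace D'').
- exact: Riemann_Roch_subspace.
- by move=> u; apply: Riemann_Roch_incl => Q; rewrite hD''; lia.
- by apply: Riemann_Roch_step => [|Q /D''Q//]; rewrite D''P subrK.
- apply: IH => //.
    have := eS (fun=> 1%N); under eq_bigr do rewrite muln1.
    by under [in RHS]eq_bigr do rewrite muln1; move=> e1; move: hm; rewrite e1.
  by move=> Q QS; rewrite D''Q ?eqS //; apply: contraNneq QS => ->.
Qed.

Lemma divisor_degreeB S D D' : (forall P, D P <= D' P) ->
  (forall P, P \notin S -> D P = 0) -> (forall P, P \notin S -> D' P = 0) ->
  (\sum_(P <- S) `|D' P - D P| * degree P)%N%:Z = divisor_degree D' - divisor_degree D.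
Proof.
move=> le hD hD'; rewrite (divisor_degreeE hD) (divisor_degreeE hD') -sumrB.
rewrite -natz raddf_sum /=; apply: eq_bigr => P _.
by rewrite -mulrBl natz PoszM gez0_abs // subr_ge0.
Qed.

Theorem Riemann_Roch_monotone D D' : (forall P, D P <= D' P) ->
  exists2 B : nat, B%:Z = divisor_degree D' - divisor_degree D &
    dim_le (Riemann_Roch_space D') (Riemann_Roch_space D) B.
Proof.
move=> le; pose S := finsupp D `|` finsupp D'.
have hD P : P \notin S -> D P = 0.
  by rewrite inE negb_or => /andP[/fsfun_dflt->].
have hD' P : P \notin S -> D' P = 0.
  by rewrite inE negb_or => /andP[_ /fsfun_dflt->].
exists (\sum_(P <- S) `|D' P - D P| * degree P)%N; first exact: divisor_degreeB.
by apply: Riemann_Roch_dim_le => // P PS; rewrite hD ?hD'.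
Qed.

End Divisors.

Local Close Scope fset_scope.

(** * Existence of places *)

Section ExistenceOfPlaces.
Variables (k : fieldType) (F : fieldExtType {fraction {poly k}}).
Notation cst := (@constant k F).
Notation n := (\dim {:F}).
Implicit Types (P Q : place F) (z w t : F) (O : set F).

Definition subalgebra O : Prop :=
  [/\ forall a, O (cst a), forall z w, O z -> O w -> O (z + w) &
      forall z w, O z -> O w -> O (z * w)].

Section Subalgebra.
Variables (O : set F) (hO : subalgebra O).

Lemma subalg_cst a : O (cst a). Proof. by case: hO. Qed.
Lemma subalgD z w : O z -> O w -> O (z + w). Proof. by case: hO => _ + _; apply. Qed.
Lemma subalgM z w : O z -> O w -> O (z * w). Proof. by case: hO => _ _; apply. Qed.
Lemma subalg0 : O 0. Proof. by rewrite -(rmorph0 cst); apply: subalg_cst. Qed.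
Lemma subalg1 : O 1. Proof. by rewrite -(rmorph1 cst); apply: subalg_cst. Qed.

Lemma subalgN z : O z -> O (- z).
Proof.
by move=> Oz; rewrite -mulN1r -(rmorphN1 cst); apply: subalgM => //; apply: subalg_cst.
Qed.

Lemma subalgB z w : O z -> O w -> O (z - w).
Proof. by move=> Oz /subalgN; apply: subalgD. Qed.

Lemma subalgX z i : O z -> O (z ^+ i).
Proof.
by move=> Oz; elim: i => [|i IH]; [apply: subalg1 | rewrite exprS; apply: subalgM].
Qed.

Lemma subalg_sum (I : Type) (r : seq I) (p : pred I) (G : I -> F) :
  (forall i, p i -> O (G i)) -> O (\sum_(i <- r | p i) G i).
Proof. by move=> h; elim/big_ind: _ => //; [apply: subalg0 | apply: subalgD]. Qed.

Lemma subalg_evc (phi : {poly k}) z : O z -> O (evc phi z).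
Proof.
move=> Oz; rewrite /evc horner_coef; apply: subalg_sum => i _.
by apply: subalgM; [rewrite coef_map; apply: subalg_cst | apply: subalgX].
Qed.

(** The value of z is the exponent j for which z / t ^ j is a unit of O, unique because t is not a
    unit. It serves both the valuation rings found by Zorn's lemma and the explicit local rings of
    rational points. *)
Lemma place_of_uniformizer t : t != 0 -> O t -> ~ O t^-1 ->
  (forall z, z != 0 -> exists j : int, O (z / t ^ j) /\ O (z / t ^ j)^-1) ->
  exists P, P t = 1 /\ forall z, vge P 0 z <-> O z.
Proof.
move=> t0 Ot nOt ex.
have tz0 (j : int) : t ^ j != 0 by rewrite expfz_neq0.
have tzB z i j : z != 0 -> t ^ (i - j) = z / t ^ j * (z / t ^ i)^-1.
  by move=> z0; rewrite expfzDr // invfM invrK mulrACA divff // mul1r mulrC invr_expz.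
have Otz (j : int) : O (t ^ j) <-> 0 <= j.
  case: j => j; first by split=> // _; apply: subalgX.
  split=> //; rewrite NegzE => h; case: nOt.
  have -> : t^-1 = t ^ (- j.+1%:Z) * t ^+ j; last by apply: subalgM => //; apply: subalgX.
  by rewrite -exprnN exprSr invfM mulrAC mulVf ?mul1r ?expf_neq0.
have /choice[v hv] z : exists j : int, z != 0 -> O (z / t ^ j) /\ O (z / t ^ j)^-1.
  by have [->|/ex[j hj]] := eqVneq z 0; [exists 0 | exists j].
have Ov z (i : int) : z != 0 -> O (z / t ^ i) <-> i <= v z.
  move=> z0; have [h1 h2] := hv z z0; rewrite -subr_ge0 -Otz.
  have -> : t ^ (v z - i) = z / t ^ i * (z / t ^ v z)^-1.
    exact: tzB.
  split=> h; first exact: subalgM.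
  have -> : z / t ^ i = (z / t ^ i * (z / t ^ v z)^-1) * (z / t ^ v z); last exact: subalgM.
  by rewrite -mulrA mulVf ?mulr1 // mulf_neq0 ?invr_eq0.
have vU z (i : int) : z != 0 -> O (z / t ^ i) -> O (z / t ^ i)^-1 -> v z = i.
  move=> z0 h1 h2; apply/eqP; rewrite eq_le; apply/andP; split; last exact/Ov.
  have [h3 _] := hv z z0; rewrite -subr_ge0 -Otz.
  have -> : t ^ (i - v z) = z / t ^ v z * (z / t ^ i)^-1; last exact: subalgM.
  exact: tzB.
(* The chosen [v] is arbitrary at 0, where a place has the value 0. *)
pose V z := if z == 0 then 0 else v z.
have VE z : z != 0 -> V z = v z by rewrite /V => /negPf->.
have hV : is_place V.
  split.
  - by rewrite /V eqxx.
  - move=> z w z0 w0; rewrite !VE ?mulf_neq0 //.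
    have [h1 h2] := hv z z0; have [h3 h4] := hv w w0.
    have e : z * w / t ^ (v z + v w) = (z / t ^ v z) * (w / t ^ v w).
      by rewrite expfzDr // invfM mulrACA.
    apply: vU; rewrite ?mulf_neq0 // e; first exact: subalgM.
    by rewrite invfM; apply: subalgM.
  - move=> z w z0 w0 zw0; rewrite !VE // -Ov // mulrDl.
    by apply: subalgD; apply/Ov; rewrite // ge_min lexx ?orbT.
  - move=> a; have [->|a0] := eqVneq a 0; first by rewrite rmorph0 /V eqxx.
    have ca0 : cst a != 0 by rewrite fmorph_eq0.
    rewrite VE //; apply: vU => //; rewrite expr0z divr1 -?fmorphV; exact: subalg_cst.
  - exists t; rewrite VE //; apply: vU => //; rewrite expr1z divff ?invr1 //; exact: subalg1.
exists (Place hV); split=> [|z] /=.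
  rewrite VE //; apply: vU => //; rewrite expr1z divff ?invr1 //; exact: subalg1.
have [->|z0] := eqVneq z 0; first by rewrite vge0; split=> // _; apply: subalg0.
by rewrite vgeE //= VE // -Ov // expr0z divr1.
Qed.

End Subalgebra.

Section ValuationRing.
Variables (O : set F) (hO : subalgebra O).
Hypothesis valO : forall z, z != 0 -> O z \/ O z^-1.

(** The maximal ideal of O. The clause for 0 is needed because the inverse of 0 is 0, which lies in
    O. *)
Definition nonunits z : Prop := z = 0 \/ ~ O z^-1.
Notation M := nonunits.

Lemma nonunits_sub z : M z -> O z.
Proof.
have [->|z0] := eqVneq z 0; first by move=> _; apply: subalg0.
by case=> [/eqP|]; [rewrite (negPf z0) | case: (valO z0)].
Qed.

Lemma nonunitsMl z w : O z -> M w -> M (z * w).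
Proof.
move=> Oz; have [->|z0] := eqVneq z 0; first by rewrite mul0r; left.
have [->|w0] := eqVneq w 0; first by rewrite mulr0; left.
case=> [/eqP|nw]; first by rewrite (negPf w0).
right=> h; apply: nw; have -> : w^-1 = z * (z * w)^-1 by rewrite invfM mulVKf.
exact: subalgM.
Qed.

Lemma nonunitsD z w : M z -> M w -> M (z + w).
Proof.
have [->|z0] := eqVneq z 0; first by rewrite add0r.
have [->|w0] := eqVneq w 0; first by rewrite addr0.
move=> Mz Mw; have [] := valO (z := z / w); first by rewrite mulf_neq0 ?invr_eq0.
  move=> h; have -> : z + w = (z / w + 1) * w by rewrite mulrDl mul1r divfK.
  by apply: nonunitsMl => //; apply: subalgD => //; apply: subalg1.
rewrite invfM invrK mulrC => h.
have -> : z + w = (w / z + 1) * z by rewrite mulrDl mul1r divfK // addrC.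
by apply: nonunitsMl => //; apply: subalgD => //; apply: subalg1.
Qed.

Lemma nonunitsN z : M z -> M (- z).
Proof.
move=> Mz; rewrite -mulN1r -(rmorphN1 cst).
by apply: nonunitsMl => //; apply: subalg_cst.
Qed.

Lemma nonunits_sum (I : Type) (r : seq I) (p : pred I) (G : I -> F) :
  (forall i, p i -> M (G i)) -> M (\sum_(i <- r | p i) G i).
Proof. by move=> h; elim/big_ind: _ => //; [left | apply: nonunitsD]. Qed.

Lemma nonunits_cst a : M (cst a) -> a = 0.
Proof.
case=> [/eqP|[]]; first by rewrite fmorph_eq0 => /eqP.
by rewrite -fmorphV; apply: subalg_cst.
Qed.

(** A strictly ascending chain of principal ideals of O inside the maximal ideal, all containing w.
    The bound on its length plays the part of the Noetherian property. *)
Definition divisor_chain (w : F) (r : nat) (x : nat -> F) : Prop :=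
  (forall i, (i < r)%N -> [/\ x i != 0, M (x i) & O (w / x i)]) /\
  (forall i j, (i < j)%N -> (j < r)%N -> M (x i / x j)).

(* The terms of the chain are linearly independent over k(w): in a relation
   with coefficients in k[w], not all divisible by w, divide by the last term
   whose coefficient is not divisible by w. *)
Lemma divisor_chain_bound w C r x : w != 0 -> M w -> degree_bound w C ->
  divisor_chain w r x -> (r <= n * C)%N.
Proof.
move=> w0 Mw hw [hx hxx]; rewrite leqNgt; apply/negP => lt.
have [|a [psi [[i0 a0] h]]] := dependent_mod (I := 'I_r) hw (fun i => x i) _ w0.
  by rewrite card_ord.
case: (arg_maxnP (P := fun i : 'I_r => a i != 0) val a0) => j aj jmax.
have [xj0 Mxj Oxj] := hx j (ltn_ord j).
case/eqP: aj; apply: nonunits_cst.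
have Og i : O (evc (psi i) w) by apply: (subalg_evc hO); apply: nonunits_sub.
have e : \sum_i (cst (a i) + w * evc (psi i) w) * x i / x j = 0.
  by rewrite -mulr_suml h mul0r.
rewrite (bigD1 j) //= mulfK // in e.
have -> : cst (a j) = - (w * evc (psi j) w +
    \sum_(i | i != j) (cst (a i) + w * evc (psi i) w) * x i / x j).
  by apply/eqP; rewrite -addr_eq0 addrA e.
apply: nonunitsN; apply: nonunitsD; first by rewrite mulrC; apply: nonunitsMl.
apply: nonunits_sum => i ij; have [xi0 Mxi _] := hx i (ltn_ord i).
rewrite mulrDl mulrDl; apply: nonunitsD.
  have [lt_ij|le_ji] := ltnP i j.
    by rewrite -mulrA; apply: nonunitsMl; [apply: subalg_cst | apply: hxx].
  have [->|ai] := eqVneq (a i) 0; first by rewrite rmorph0 !mul0r; left.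
  by case/eqP: ij; apply: val_inj; apply/eqP; rewrite eqn_leq le_ji andbT; apply: jmax.
have -> : w * evc (psi i) w * x i / x j = (w / x j) * (evc (psi i) w * x i).
  by rewrite -!mulrA; congr (_ * _); rewrite mulrA mulrC.
by apply: nonunitsMl => //; apply: nonunitsMl.
Qed.

(** The last term of a longest chain generates the maximal ideal: an element of the ideal that it
    does not divide would extend the chain. *)
Lemma uniformizer_exists w : w != 0 -> M w ->
  exists t, [/\ t != 0, M t & forall z, M z -> O (z / t)].
Proof.
move=> w0 Mw; have [C hw] := degree_bound_exists w.
pose Q r := `[< exists x, divisor_chain w r.+1 x >].
have Q0 : exists r, Q r.
  exists 0%N; apply/asboolP; exists (fun=> w); split=> [i _|i j]; last by lia.
  by rewrite divff //; split=> //; apply: subalg1.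
have QB r : Q r -> (r <= n * C)%N.
  by move=> /asboolP[x /(divisor_chain_bound w0 Mw hw)]; apply: ltnW.
have [r /asboolP[x [hx hxx]] rmax] := ex_maxnP Q0 QB.
have [t0 Mt Owt] := hx r (ltnSn r).
exists (x r); split=> // z Mz; have [->|z0] := eqVneq z 0.
  by rewrite mul0r; apply: subalg0.
apply: contrapT => nO; have Mtz : M (x r / z) by right; rewrite invfM invrK mulrC.
suff /rmax : Q r.+1 by rewrite ltnn.
apply/asboolP; exists (fun i => if (i < r.+1)%N then x i else z); split=> [i ir|i j ij jr].
  case: ifP => [/hx//|_]; split=> //.
  have -> : w / z = (w / x r) * (x r / z) by rewrite mulrA divfK.
  by apply: subalgM => //; apply: nonunits_sub.
have ir : (i < r.+1)%N by lia.
rewrite ir; case: ifP => jr'; first exact: hxx.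
have -> : x i / z = (x i / x r) * (x r / z) by rewrite mulrA divfK.
apply: nonunitsMl => //.
have [->|ir'] := eqVneq i r; first by rewrite divff //; apply: subalg1.
by apply: nonunits_sub; apply: hxx => //; lia.
Qed.

Lemma valuation_ring_place w : w != 0 -> ~ O w^-1 -> exists P, 0 < P w.
Proof.
move=> w0 nOw; have Mw : M w by right.
have [t [t0 Mt ht]] := uniformizer_exists w0 Mw.
have Ot := nonunits_sub Mt.
have nOt : ~ O t^-1 by case: Mt => [/eqP|//]; rewrite (negPf t0).
have powers z : z != 0 -> O z -> exists j : nat, O (z / t ^+ j) /\ O (z / t ^+ j)^-1.
  move=> z0 Oz; have [C hz] := degree_bound_exists z.
  have bound j : O (z / t ^+ j) -> (j <= n * C)%N.
    have [->//|j0] := posnP j; move=> Oj.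
    have Mz : M z.
      have -> : z = (z / t ^+ j) * t ^+ j.-1 * t.
        by rewrite -mulrA -exprSr prednK // divfK // expf_neq0.
      by apply: nonunitsMl => //; apply: subalgM => //; apply: subalgX.
    (* If t ^ j divides z, then t ^ j, ..., t ^ 2, t is a chain of length j for z. Hence there is a
       largest such j, and for it the quotient is a unit. *)
    apply: (@divisor_chain_bound z C j (fun i => t ^+ (j - i))) => //; split.
      move=> i ij; rewrite expf_neq0 //; split=> //.
        have -> : (j - i = (j - i.+1).+1)%N by lia.
        by rewrite exprSr; apply: nonunitsMl => //; apply: subalgX.
      have -> : z / t ^+ (j - i) = (z / t ^+ j) * t ^+ i.
        rewrite -{2}(subnK (ltnW ij)) exprD invfM -!mulrA.
        by rewrite mulVf ?mulr1 // expf_neq0.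
      by apply: subalgM => //; apply: subalgX.
    move=> i i' ii' i'j; have -> : (j - i = (i' - i).-1 + 1 + (j - i'))%N by lia.
    rewrite exprD mulfK ?expf_neq0 // exprD.
    by apply: nonunitsMl => //; apply: subalgX.
  pose Q j := `[< O (z / t ^+ j) >].
  have Q0 : exists j, Q j by exists 0%N; apply/asboolP; rewrite expr0 divr1.
  have QB j : Q j -> (j <= n * C)%N by move=> /asboolP; apply: bound.
  have [j /asboolP Oj jmax] := ex_maxnP Q0 QB.
  exists j; split=> //; apply: contrapT => nO.
  have /ht h : M (z / t ^+ j) by right.
  suff /jmax : Q j.+1 by rewrite ltnn.
  by apply/asboolP; rewrite exprSr invfM mulrA.
have [z z0|P [Pt hP]] := place_of_uniformizer hO t0 Ot nOt.
  have [/(powers z z0)[j hj]|] := valO z0; first by exists j.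
  move=> /(powers z^-1); rewrite invr_eq0 => /(_ z0)[j [h1 h2]]; exists (- j%:Z).
  rewrite -exprnN invrK; split; last by rewrite invfM.
  by move: h2; rewrite invfM !invrK.
exists P; rewrite ltNge; apply/negP => h; apply: nOw; apply/hP.
by rewrite vgeE ?invr_eq0 // placeV; lia.
Qed.

End ValuationRing.
End ExistenceOfPlaces.

(** * Existence of poles and finiteness of the dimensions l(D) *)

Section Poles.
Variables (k : fieldType) (F : fieldExtType {fraction {poly k}}).
Notation cst := (@constant k F).
Notation n := (\dim {:F}).
Implicit Types (P Q : place F) (z w t : F) (O S : set F).

Definition adjoin S z : set F :=
  [set u | exists2 p : {poly F}, (forall i, S p`_i) & u = p.[z]].

Lemma adjoin_subalgebra S z : subalgebra S -> subalgebra (adjoin S z).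
Proof.
move=> hS; split=> [a|u v|u v].
- exists (cst a)%:P; last by rewrite hornerC.
  by move=> i; rewrite coefC; case: eqP => _; [apply: subalg_cst | apply: subalg0].
- move=> [p Sp ->] [q Sq ->]; exists (p + q); last by rewrite hornerD.
  by move=> i; rewrite coefD; apply: subalgD.
- move=> [p Sp ->] [q Sq ->]; exists (p * q); last by rewrite hornerM.
  by move=> i; rewrite coefM; apply: subalg_sum => // j _; apply: subalgM.
Qed.

Lemma sub_adjoin S z u : subalgebra S -> S u -> adjoin S z u.
Proof.
move=> hS Su; exists u%:P; last by rewrite hornerC.
by move=> i; rewrite coefC; case: eqP => _ //; apply: subalg0.
Qed.

Lemma adjoin_gen S z : subalgebra S -> adjoin S z z.
Proof.
move=> hS; exists 'X; last by rewrite hornerX.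
by move=> i; rewrite coefX; case: eqP => _; [apply: subalg1 | apply: subalg0].
Qed.

Lemma horner_reverse (b : {poly F}) z m : z != 0 -> (size b <= m.+1)%N ->
  (\poly_(i < m.+1) b`_(m - i)).[z] = z ^+ m * b.[z^-1].
Proof.
move=> z0 sb; rewrite horner_poly (horner_coef_wide _ sb) mulr_sumr.
rewrite (reindex_inj rev_ord_inj); apply: eq_bigr => i _ /=.
rewrite subSS subKn; last by rewrite -ltnS.
rewrite exprVn mulrCA; congr (_ * _).
have zi0 : z ^+ i != 0 by rewrite expf_neq0.
by apply: (mulIf zi0); rewrite -exprD subnK ?divfK // -ltnS.
Qed.

(* If 1/w lies in both S[z] and S[1/z] then it lies in S: the relation of lower
   degree is used to eliminate the leading term of the other. *)
Lemma adjoin_exchange S z w : subalgebra S -> z != 0 -> S w ->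
  adjoin S z w^-1 -> adjoin S z^-1 w^-1 -> S w^-1.
Proof.
move=> hS z0 Sw [a Sa ha] [b Sb hb].
have [->|w0] := eqVneq w 0; first by rewrite invr0; apply: subalg0.
move: {2}(size a + size b)%N (leqnn (size a + size b)) => N.
elim: N z a b z0 Sa Sb ha hb => [|N IH] z a b z0 Sa Sb ha hb.
  rewrite leqn0 addn_eq0 size_poly_eq0 => /andP[/eqP a0 _].
  by move/eqP: ha; rewrite a0 horner0 invr_eq0 (negPf w0).
wlog le_ba : z a b z0 Sa Sb ha hb / (size b <= size a)%N.
  move=> H; have [|/ltnW le] := leqP (size b) (size a); first exact: (H z).
  by rewrite addnC; apply: (H z^-1) => //; rewrite ?invr_eq0 ?invrK.
have [sb|sb] := leqP (size b) 1.
  by rewrite hb (size1_polyC sb) hornerC.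
have [m sa] : exists m, size a = m.+2 by exists (size a).-2; lia.
rewrite sa => hN.
(* The value at z is still 1 / w, because the reversal of b makes the last bracket vanish there. The
   coefficients of degree m + 1 cancel, since the reversed b has b_0 in that degree. *)
pose a' := (1 - w * b`_0)%:P * a + (b`_0)%:P
   + a`_m.+1 *: (w *: (\poly_(i < m.+2) b`_(m.+1 - i)) - 'X^(m.+1)).
have S1 : S (1 - w * b`_0).
  by apply: (subalgB hS); [apply: subalg1 | apply: subalgM].
apply: (IH z a' b) => //.
- move=> i; rewrite !coefD coefCM coefC coefZ coefB coefZ coef_poly coefXn.
  apply: (subalgD hS); [apply: (subalgD hS)|]; [exact: subalgM | |].
    by case: ifP => _ //; apply: subalg0.
  apply: (subalgM hS) => //; apply: (subalgB hS).
    by apply: (subalgM hS) => //; case: ifP => _ //; apply: subalg0.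
  by case: eqP => _; [apply: subalg1 | apply: subalg0].
- rewrite /a' !hornerE horner_reverse ?sa // -?sa // -ha -hb.
  have -> : (w * (z ^+ m.+1 / w)) = z ^+ m.+1 by rewrite mulrCA divff // mulr1.
  by rewrite subrr mulr0 addr0; field.
- have : (size a' <= m.+1)%N; last first.
    by move=> sa'; rewrite -ltnS (leq_trans _ hN) // ltn_add2r ltnS.
  apply/leq_sizeP => j hj; rewrite !coefD coefCM coefC coefZ coefB coefZ coef_poly coefXn.
  have -> : (j == 0%N) = false by case: j hj.
  have [->|jm] := eqVneq j m.+1; first by rewrite ltnSn subnn /=; ring.
  have mj : (m.+1 < j)%N by rewrite ltn_neqAle eq_sym jm.
  by rewrite ltnS leqNgt mj /= (@nth_default _ _ a) ?sa //; ring.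
Qed.

(** A subalgebra that contains k[w], omits 1 / w and is maximal for this is a valuation ring: if it
    missed both u and 1 / u, adjoining either would give 1 / w, against [adjoin_exchange]. *)
Lemma place_with_zero w : w != 0 -> ~ (exists phi : {poly k}, w^-1 = evc phi w) ->
  exists P, 0 < P w.
Proof.
move=> w0 nw; pose A0 : set F := [set u | exists phi : {poly k}, u = evc phi w].
have hA0 : subalgebra A0.
  split=> [a|u v [p ->] [q ->]|u v [p ->] [q ->]].
  - by exists a%:P; rewrite /evc map_polyC hornerC.
  - by exists (p + q); rewrite /evc rmorphD hornerD.
  - by exists (p * q); rewrite /evc rmorphM hornerM.
have A0w : A0 w by exists 'X; rewrite /evc map_polyX hornerX.
(* The union with [A0] makes the empty chain, whose union is empty, satisfy the condition too. *)
pose good X := subalgebra (A0 `|` X) /\ ~ (A0 `|` X) w^-1.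
have [Fs Fgood Ftot|X [[hS nSw] Xmax]] := @Zorn_bigcup F good.
  have key u v : (A0 `|` \bigcup_(X in Fs) X) u -> (A0 `|` \bigcup_(X in Fs) X) v ->
    (A0 u /\ A0 v) \/ exists2 X, Fs X & (A0 `|` X) u /\ (A0 `|` X) v.
    move=> [Au|[X FX Xu]] [Av|[Y FY Yv]]; first by left.
    - by right; exists Y => //; split; [left|right].
    - by right; exists X => //; split; [right|left].
    by case: (Ftot X Y FX FY) => XY; right; [exists Y | exists X] => //;
      split; right => //; apply: XY.
  split.
    split=> [a|u v hu hv|u v hu hv]; first by left; apply: subalg_cst.
      have [[Au Av]|[X FX [Xu Xv]]] := key u v hu hv; first by left; apply: subalgD.
      have [hX _] := Fgood X FX.
      by case: (subalgD hX Xu Xv) => h; [left|right; exists X].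
    have [[Au Av]|[X FX [Xu Xv]]] := key u v hu hv; first by left; apply: subalgM.
    have [hX _] := Fgood X FX.
    by case: (subalgM hX Xu Xv) => h; [left|right; exists X].
  move=> [//|[X FX Xw]]; have [_] := Fgood X FX; apply.
  by right.
have val u : u != 0 -> ~ (A0 `|` X) u -> adjoin (A0 `|` X) u w^-1.
  move=> u0 nSu; apply: contrapT => nad; apply: (Xmax (adjoin (A0 `|` X) u)).
    split; first by move=> v Xv; apply: sub_adjoin => //; right.
    by move=> sub; apply: nSu; right; apply: sub; apply: adjoin_gen.
  have e : A0 `|` adjoin (A0 `|` X) u = adjoin (A0 `|` X) u.
    apply/seteqP; split=> v; last by right.
    by case=> // Av; apply: sub_adjoin => //; left.
  by rewrite /good e; split=> //; apply: adjoin_subalgebra.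
apply: (valuation_ring_place hS _ w0 nSw) => u u0.
apply: contrapT => /not_orP[nu nu']; apply: nSw.
apply: (adjoin_exchange hS u0); first by left.
  exact: val.
by apply: val; rewrite ?invr_eq0.
Qed.

(** A zero of 1 / z is wanted. The only obstruction is z = phi(1 / z), which multiplied by a power
    of z is an algebraic equation of z over k, against [evc_neq0]. *)
Theorem pole_exists P z : z != 0 -> 0 < P z -> exists Q, Q z < 0.
Proof.
move=> z0 Pz; have zi0 : z^-1 != 0 by rewrite invr_eq0.
have [[phi]|nex] := pselect (exists phi : {poly k}, z^-1^-1 = evc phi z^-1); last first.
  have [Q hQ] := place_with_zero zi0 nex.
  by exists Q; move: hQ; rewrite placeV oppr_gt0.
rewrite invrK => e; pose N := size phi.
pose psi : {poly k} := 'X^(N.+1) - \poly_(i < N.+1) phi`_(N - i).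
have psi0 : psi != 0.
  apply/eqP => /polyP/(_ N.+1); rewrite coefB coefXn eqxx coef_poly ltnn coef0 subr0.
  by move/eqP; rewrite oner_eq0.
have /eqP[] : evc psi z != 0 by apply: (@evc_neq0 _ _ P) => //; rewrite vgeE // -gtz0_ge1.
rewrite /evc rmorphB /= map_polyXn hornerD hornerN hornerXn.
have -> : map_poly cst (\poly_(i < N.+1) phi`_(N - i)) =
    \poly_(i < N.+1) (map_poly cst phi)`_(N - i).
  apply/polyP => i; rewrite coef_map coef_poly [RHS]coef_poly.
  by case: ifP => _; rewrite ?coef_map ?raddf0.
rewrite horner_reverse //; last by rewrite size_map_poly leqnSn.
by rewrite -/(evc _ _) -e exprSr subrr.
Qed.

(** A nonzero element would have a zero at P and no pole. *)
Lemma Riemann_Roch_eq0 (D : divisor F) P : (forall Q, D Q <= 0) -> D P < 0 ->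
  Riemann_Roch_space D = [set 0].
Proof.
move=> D0 DP; apply/seteqP; split=> z; last by move->; apply: (Riemann_Roch_subspace D).1.
rewrite Riemann_Roch_spaceE /= => hz; apply: contrapT => /eqP z0.
have [|Q Qz] := @pole_exists P z z0; first by have := hz P; rewrite vgeE //; lia.
by have := hz Q; rewrite vgeE //; have := D0 Q; lia.
Qed.

Lemma divisor_degreeD (D E D' : divisor F) : (forall P, D' P = D P + E P) ->
  divisor_degree D' = divisor_degree D + divisor_degree E.
Proof.
move=> h; pose S := (finsupp D `|` finsupp E)%fset.
have hD P : P \notin S -> D P = 0.
  by rewrite inE negb_or => /andP[/fsfun_dflt->].
have hE P : P \notin S -> E P = 0.
  by rewrite inE negb_or => /andP[_ /fsfun_dflt->].
rewrite (divisor_degreeE hD) (divisor_degreeE hE) (@divisor_degreeE _ _ S) => [|P PS].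
  by rewrite -big_split; apply: eq_bigr => P _ /=; rewrite h mulrDl.
by rewrite h hD ?hE.
Qed.

Lemma point_divisor P (j : int) : exists2 D : divisor F,
  forall Q, D Q = if Q == P then j else 0 & divisor_degree D = j * (degree P)%:Z.
Proof.
have [D hD] := @divisor_of _ _ [fset P]%fset (fun Q => if Q == P then j else 0)
  ltac:(by move=> Q; rewrite inE => /negPf->).
exists D => //; rewrite (@divisor_degreeE _ _ [fset P]%fset) => [|Q].
  by rewrite big_seq_fset1 hD eqxx.
by rewrite inE hD => /negPf->.
Qed.

Variable P0 : place F.

(** D is compared with a divisor below it that is nowhere positive and is negative at P0, so that
    its space is 0. As [ell] is 0 by default in infinite dimension, this must precede every estimate
    of it. *)
Theorem ell_finite (D : divisor F) : has_dim_quo (Riemann_Roch_space D) [set 0] (ell D).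
Proof.
have [D' hD'] : exists D' : divisor F, forall P, D' P = Num.min (D P) 0 - (P == P0)%:R.
  apply: (divisor_of (S := finsupp D `|` [fset P0])%fset) => Q.
  by rewrite !inE negb_or => /andP[/fsfun_dflt-> /negPf->]; rewrite minxx subr0.
have [|B _] := @Riemann_Roch_monotone _ _ D' D.
  by move=> P; rewrite hD'; case: eqP => _ /=; lia.
rewrite (@Riemann_Roch_eq0 D' P0); last first.
- by rewrite hD' eqxx; lia.
- by move=> Q; rewrite hD'; case: eqP => _ /=; lia.
by move=> /(dim_leP (Riemann_Roch_subspace D) (zero_subspace F))[].
Qed.

Theorem ell_monotone (D D' : divisor F) : (forall P, D P <= D' P) ->
  (ell D')%:Z <= (ell D)%:Z + (divisor_degree D' - divisor_degree D).
Proof.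
move=> le; have [B <- hB] := Riemann_Roch_monotone le.
have hD := has_dim_dim_le (zero_subspace F) (ell_finite D).
have h : dim_le (Riemann_Roch_space D') [set 0] (B + ell D).
  by apply: dim_le_trans hB hD;
    [apply: Riemann_Roch_subspace | apply: zero_subspace | move=> u; apply: Riemann_Roch_incl].
have [_] := dim_leP (Riemann_Roch_subspace D') (zero_subspace F) h.
by rewrite -/(ell D'); lia.
Qed.

Lemma ell_ge (D : divisor F) (I : finType) (e : I -> F) :
  (forall i, Riemann_Roch_space D (e i)) -> independent [set 0] e -> (#|I| <= ell D)%N.
Proof. exact: dim_le_card (has_dim_dim_le (zero_subspace F) (ell_finite D)). Qed.

End Poles.

(** * Riemann inequality *)

Lemma mulrn_int (a : int) m : a *+ m = a * m%:Z.
Proof. by rewrite -mulr_natr natz. Qed.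

Section RiemannInequality.
Variables (k : fieldType) (F : fieldExtType {fraction {poly k}}).
Notation cst := (@constant k F).
Notation of_poly := (@of_poly k F).
Notation n := (\dim {:F}).
Notation x := (of_poly 'X).
Implicit Types (P Q : place F) (z w t : F).

(** At a pole of x the leading term has strictly the smallest value. *)
Lemma place_infinite P (h : {poly k}) : P x < 0 -> h != 0 ->
  P (of_poly h) = P x *+ (size h).-1.
Proof.
move=> Px h0; have x0 : x != 0 by rewrite of_poly_eq0 polyX_eq0.
have eh : of_poly h = \sum_(i < size h) cst h`_i * x ^+ i.
  rewrite -{1}[h]comp_polyXr -evc_of_poly /evc horner_coef size_map_poly.
  by apply: eq_bigr => i _; rewrite coef_map.
have [m sm] : exists m, size h = m.+1.
  by exists (size h).-1; rewrite prednK // lt0n size_poly_eq0.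
have lc0 : cst h`_m != 0.
  by rewrite fmorph_eq0; move: h0; rewrite -lead_coef_eq0 lead_coefE sm.
rewrite eh sm big_ord_recr /= addrC; set s := \sum_(i < m) _.
have lead : P (cst h`_m * x ^+ m) = P x *+ m.
  by rewrite placeM ?expf_neq0 // place_cst add0r placeX.
have [s0|s0] := eqVneq s 0; first by rewrite s0 addr0.
have hs : vge P (P x *+ m - P x) s.
  apply: vge_sum => i _; apply: vgeZ; rewrite vgeE ?expf_neq0 // placeX.
  rewrite !mulrn_int -[X in _ - X]mulr1 -mulrBr.
  by apply: (ler_wnM2l (ltW Px)); have := ltn_ord i; lia.
rewrite -lead; apply: (placeD_lt _ s0 _).2; first by rewrite mulf_neq0 ?expf_neq0.
by rewrite lead; move: hs; rewrite vgeE //; lia.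
Qed.

Lemma vge_of_poly P (h : {poly k}) : vge P 0 x -> vge P 0 (of_poly h).
Proof. by move=> hx; rewrite -[h]comp_polyXr -evc_of_poly; apply: vge_evc. Qed.

Lemma finite_or_infinite P : vge P 0 x \/ P x < 0.
Proof.
have [h|h] := leP 0 (P x); last by right.
by left; rewrite /vge h orbT.
Qed.

Lemma polynomial_divisor (h : {poly k}) (N : nat) : h != 0 ->
  exists D : divisor F, [/\ forall P, vge P 0 x -> D P = P (of_poly h),
    forall P, P x < 0 -> D P = - (N%:Z * P x) &
    divisor_degree D <= (n * ((size h).-1 + N))%N%:Z].
Proof.
move=> h0; have x0 : x != 0 by rewrite of_poly_eq0 polyX_eq0.
have hF0 : of_poly h != 0 by rewrite of_poly_eq0.
have xi0 : x^-1 != 0 by rewrite invr_eq0.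
pose S1 := fset_set [set P : place F | 0 < P (of_poly h)].
pose S2 := fset_set [set P : place F | 0 < P x^-1].
have inS1 P : (P \in S1) = (0 < P (of_poly h)).
  by rewrite in_fset_set; [apply/idP/idP; rewrite inE | apply: finite_zeros].
have inS2 P : (P \in S2) = (P x < 0).
  rewrite in_fset_set; last exact: finite_zeros.
  by apply/idP/idP; rewrite inE /= placeV oppr_gt0.
have notS1 P : P x < 0 -> P \notin S1.
  move=> Px; rewrite inS1 -leNgt place_infinite // mulrn_int; nia.
have [D1 hD1] : exists D : divisor F, forall P, D P = if P \in S1 then P (of_poly h) else 0.
  by apply: (divisor_of (S := S1)) => P /negPf->.
have [D2 hD2] : exists D : divisor F, forall P, D P = if P \in S2 then - (N%:Z * P x) else 0.
  by apply: (divisor_of (S := S2)) => P /negPf->.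
have [D hD] : exists D : divisor F, forall P, D P = D1 P + D2 P.
  apply: (divisor_of (S := (S1 `|` S2)%fset)) => P.
  by rewrite inE negb_or hD1 hD2 => /andP[/negPf-> /negPf->].
exists D; split.
- move=> P hx; rewrite hD hD1 hD2 inS1 inS2.
  have := vge_of_poly h hx; rewrite !vgeE // in hx * => hh.
  by rewrite [P x < 0]ltNge hx addr0; case: ltP => //; lia.
- by move=> P Px; rewrite hD hD1 hD2 (negPf (notS1 P Px)) inS2 Px add0r.
have -> : divisor_degree D = divisor_degree D1 + divisor_degree D2.
  exact: divisor_degreeD.
have d1 : divisor_degree D1 = (\sum_(P <- S1) `|P (of_poly h)| * degree P)%N%:Z.
  rewrite (@divisor_degreeE _ _ S1) => [|P]; last by rewrite hD1 => /negPf->.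
  rewrite -natz raddf_sum /= big_seq [RHS]big_seq; apply: eq_bigr => P PS.
  by rewrite hD1 PS natz PoszM gez0_abs // ltW // -inS1.
have d2 : divisor_degree D2 = (N * \sum_(P <- S2) `|P x^-1| * degree P)%N%:Z.
  rewrite (@divisor_degreeE _ _ S2) => [|P]; last by rewrite hD2 => /negPf->.
  rewrite PoszM -[X in _ = _ * X]natz raddf_sum /= mulr_sumr big_seq [RHS]big_seq.
  apply: eq_bigr => P PS; rewrite hD2 PS natz PoszM placeV.
  rewrite inS2 in PS; rewrite gez0_abs; last by rewrite oppr_ge0 ltW.
  by rewrite mulrA mulrN.
have e1 : (\sum_(P <- S1) `|P (of_poly h)| * degree P <= n * (size h).-1)%N.
  by apply: zeros_degree_le (degree_bound_poly F h) _ => // P; rewrite inS1.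
have e2 : (\sum_(P <- S2) `|P x^-1| * degree P <= n * 1)%N.
  apply: zeros_degree_le (degree_bound_invX F) _ => // P; rewrite inS2 placeV.
  by rewrite oppr_gt0.
rewrite d1 d2 -PoszD lez_nat mulnDr leq_add // mulnC.
by rewrite leq_mul2r -[n]muln1 e2 orbT.
Qed.

(** Each finite place in the support is a zero of some polynomial; h is the product of these, raised
    to the powers |D P|. *)
Lemma divisor_le_polynomial (D : divisor F) : exists2 h : {poly k}, h != 0 &
  exists N0 : nat, (forall P, vge P 0 x -> D P <= P (of_poly h)) /\
   (forall N P, (N0 <= N)%N -> P x < 0 -> D P <= - (N%:Z * P x)).
Proof.
have /choice[g hg] P : exists g : {poly k}, g != 0 /\
    (vge P 0 x -> 0 < P (of_poly g)).
  have [Px|nPx] := boolP (vge P 0 x); last by exists 1; rewrite oner_neq0.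
  by have [g g0 Pg] := finite_place_polynomial Px; exists g.
pose h := \prod_(P <- finsupp D) g P ^+ `|D P|.
have h0 : h != 0.
  by rewrite prodf_seq_neq0; apply/allP => P _; rewrite /= expf_neq0 // (hg P).1.
exists h => //.
exists (\sum_(P <- finsupp D) `|D P|)%N; split=> [P Px|N P N0 Px]; last first.
  have [PD|/fsfun_dflt->] := boolP (P \in finsupp D); last by nia.
  by move: N0; rewrite (big_fsetD1 P PD) /=; nia.
have [PD|/fsfun_dflt->] := boolP (P \in finsupp D); last first.
  by have := vge_of_poly h Px; rewrite vgeE // of_poly_eq0.
have g0 Q i : of_poly (g Q ^+ i) != 0.
  by rewrite of_poly_eq0 expf_neq0 // (hg Q).1.
have prod0 (A : {fset place F}) : \prod_(Q <- A) of_poly (g Q ^+ `|D Q|) != 0.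
  by rewrite prodf_seq_neq0; apply/allP => Q _ /=.
have prodO (A : {fset place F}) : 0 <= P (\prod_(Q <- A) of_poly (g Q ^+ `|D Q|)).
  rewrite -vgeE; last exact: prod0.
  elim/big_ind: _ => [|u v|Q _]; first exact: vge1.
    exact: vgeM0.
  exact: vge_of_poly.
rewrite /h rmorph_prod (big_fsetD1 P PD) /= placeM // rmorphXn placeX /= mulrn_int.
have := prodO (finsupp D `\ P)%fset; have := (hg P).2 Px.
move: (P (of_poly (g P))) (P (\prod_(_ <- _) _)) => a b' a0 b0.
have := @ler_peMl _ a `|D P|%N%:Z isT; rewrite -gtz0_ge1 => /(_ a0); lia.
Qed.

Variables (P0 : place F) (I : finType) (z : I -> F) (c : I -> nat).
Hypothesis card_I : #|I| = n.
Hypothesis z_finite : forall i P, vge P 0 x -> vge P 0 (z i).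
Hypothesis z_infinite : forall i P, P x < 0 -> vge P ((c i)%:Z * P x) (z i).
Hypothesis z_free : forall h : I -> {poly k},
  \sum_i of_poly (h i) * z i = 0 -> forall i, h i = 0.

(* The elements x ^ j z_i / h with j <= N + deg h - c_i lie in the
   Riemann-Roch space of the divisor of zeros of h plus N times the divisor of
   poles of x, whose degree is at most n (deg h + N). *)
Theorem Riemann_inequality (D : divisor F) :
  divisor_degree D - (ell D)%:Z + 1 <= 1 - n%:Z + (\sum_i c i)%N%:Z.
Proof.
have [h h0 [N0 [hfin hinf]]] := divisor_le_polynomial D.
pose N := (N0 + \max_i c i)%N.
have [D' [D'fin D'inf degD']] := polynomial_divisor N h0.
have DD' P : D P <= D' P.
  have [Px|Px] := finite_or_infinite P; first by rewrite D'fin // hfin.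
  by rewrite D'inf // hinf // leq_addr.
have hF0 : of_poly h != 0 by rewrite of_poly_eq0.
have hFi0 : (of_poly h)^-1 != 0 by rewrite invr_eq0.
have x0 : x != 0 by rewrite of_poly_eq0 polyX_eq0.
(* The number of j with j <= N + deg h - c i; [N] was taken above every c i so that the truncated
   subtraction is exact. *)
pose m i := (N + (size h).-1 + 1 - c i)%N.
have hc i : (c i <= N)%N.
  by apply: leq_trans (leq_addl _ _); apply: leq_bigmax.
pose e (a : {i : I & 'I_(m i)}) := x ^+ tagged a * (z (tag a) / of_poly h).
have ellD' : (\sum_i m i <= ell D')%N.
  have -> : (\sum_i m i)%N = #|{: {i : I & 'I_(m i)}}|.
    rewrite card_tagged sumnE big_map big_enum /=.
    by apply: eq_bigr => i _; rewrite card_ord.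
  apply: (ell_ge P0 (e := e)).
    move=> [i j]; rewrite Riemann_Roch_spaceE => P; rewrite /e /=.
    have [Px|Px] := finite_or_infinite P.
      rewrite D'fin //; have -> : - P (of_poly h) = 0 + (0 + - P (of_poly h)) by rewrite !add0r.
      apply: vgeM; first exact: vgeX0.
      by apply: vgeM; [apply: z_finite | rewrite vgeE // placeV].
    rewrite D'inf // opprK.
    have hz : vge P (P x *+ j + ((c i)%:Z * P x + - (P x *+ (size h).-1)))
        (x ^+ j * (z i / of_poly h)).
      apply: vgeM; first by rewrite vgeE ?expf_neq0 // placeX.
      apply: vgeM; first exact: z_infinite.
      by rewrite vgeE // placeV (place_infinite Px h0).
    apply: vgeW hz; rewrite !mulrn_int.
    have := ltn_ord j; rewrite /m; have := hc i; move: (nat_of_ord j) => l; nia.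
  move=> a /= ea0 y; pose g i := \poly_(j < m i)
    (if insub j is Some l then a (Tagged (fun i => 'I_(m i)) (l : 'I_(m i))) else 0).
  have eg : \sum_i of_poly (g i) * z i = 0.
    apply: (mulIf hFi0); rewrite mul0r -[RHS]ea0.
    pose G i (j : 'I_(m i)) :=
      cst (a (Tagged (fun i => 'I_(m i)) j)) * e (Tagged (fun i => 'I_(m i)) j).
    transitivity (\sum_i \sum_(j < m i) G i j); last first.
      by rewrite sig_big_dep; apply: eq_bigr => -[i j].
    rewrite mulr_suml; apply: eq_bigr => i _; rewrite -mulrA.
    rewrite /g poly_def rmorph_sum mulr_suml; apply: eq_bigr => j _.
    by rewrite valK /G /e /= -mul_polyC rmorphM rmorphXn /= -mulrA.
  have := z_free eg (tag y) => /polyP/(_ (tagged y)).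
  by rewrite coef_poly ltn_ord valK coef0; case: y.
have := ell_monotone P0 DD'.
have e1 : (\sum_i m i)%N%:Z = n%:Z * (N + (size h).-1 + 1)%N%:Z - (\sum_i c i)%N%:Z.
  have : (\sum_i m i + \sum_i c i = n * (N + (size h).-1 + 1))%N.
    rewrite -big_split -card_I -sum_nat_const; apply: eq_bigr => i _ /=.
    by rewrite /m subnK //; have := hc i; lia.
  by move/(congr1 Posz); rewrite PoszD PoszM => <-; rewrite addrK.
have := ellD'; rewrite -lez_nat e1.
move: degD'; rewrite PoszM.
have -> : (N + (size h).-1 + 1)%N%:Z = ((size h).-1 + N)%N%:Z + 1 by lia.
move: (n%:Z) ((size h).-1 + N)%N%:Z => n' M; rewrite mulrDr mulr1.
move: (n' * M) => nM; lia.
Qed.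

End RiemannInequality.

(** * The genus *)

Section Genus.
Variables (k : fieldType) (F : fieldExtType {fraction {poly k}}).
Notation cst := (@constant k F).
Notation n := (\dim {:F}).
Implicit Types (P Q : place F) (z w t : F) (D : divisor F).

Lemma multiple_divisor D (j : int) : exists2 D' : divisor F,
  forall P, D' P = j * D P & divisor_degree D' = j * divisor_degree D.
Proof.
have [D' hD'] : exists D' : divisor F, forall P, D' P = j * D P.
  by apply: (divisor_of (S := finsupp D)) => P /fsfun_dflt->; rewrite mulr0.
exists D' => //; rewrite (@divisor_degreeE _ _ (finsupp D)) => [|P /fsfun_dflt e].
  by rewrite mulr_sumr; apply: eq_bigr => P _; rewrite hD' mulrA.
by rewrite hD' e mulr0.
Qed.

Variables (P0 : place F) (P0_rational : degree P0 = 1%N).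

(** L(- P0) is 0, and passing from - P0 to 0 adds at most deg P0 = 1. This is how the rational place
    forces L(0) to be k. *)
Lemma ell0_le1 D : (forall P, D P = 0) -> (ell D <= 1)%N.
Proof.
move=> D0; have [D' hD' dD'] := point_divisor P0 (-1).
have le P : D' P <= D P by rewrite hD' D0; case: eqP.
have := ell_monotone P0 le.
have -> : divisor_degree D = 0.
  by rewrite (@divisor_degreeE _ _ fset0) ?big_seq_fset0.
have -> : ell D' = 0%N.
  rewrite /ell (@Riemann_Roch_eq0 _ _ _ P0) => [|Q|]; last by rewrite hD' eqxx.
    apply: dim_quoE; try exact: zero_subspace.
    apply: (independent_spanning_has_dim (e := fun=> 0) (zero_subspace F)) => //.
      by move=> c _ [].
    by move=> u /= ->; exists (fun=> 0); rewrite big_ord0 subr0.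
  by rewrite hD'; case: eqP.
by rewrite dD' P0_rational; lia.
Qed.

Lemma is_genus_uniq g g' : is_genus F g -> is_genus F g' -> g = g'.
Proof.
move=> [h [D hD]] [h' [D' hD']]; apply/eqP; rewrite eqn_leq.
by apply/andP; split; rewrite -lez_nat; [rewrite -hD | rewrite -hD'].
Qed.

(** A bounded family of integers attains its maximum, and the divisor 0 gives a nonnegative value.
    Hence the maximum is a natural number and [genus] is not the default value of [xget]. *)
Lemma genus_le (G : int) :
  (forall D, divisor_degree D - (ell D)%:Z + 1 <= G) ->
  is_genus F (genus F) /\ (genus F)%:Z <= G.
Proof.
move=> hG; pose v D := divisor_degree D - (ell D)%:Z + 1.
pose Q m := `[< exists D, v D = m%:Z >].
have [D0 hD0] : exists D0 : divisor F, forall P, D0 P = 0.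
  exact: (divisor_of (S := fset0)).
have vD0 : 0 <= v D0.
  rewrite /v (@divisor_degreeE _ _ fset0) ?big_seq_fset0 //.
  by have := ell0_le1 hD0; lia.
have exQ : exists m, Q m by exists `|v D0|%N; apply/asboolP; exists D0; lia.
have bQ m : Q m -> (m <= `|G|)%N.
  by move=> /asboolP[D vD]; have := hG D; rewrite -/(v D) vD; lia.
have [g /asboolP[D vD] gmax] := ex_maxnP exQ bQ.
have hg : is_genus F g.
  split; last by exists D.
  move=> D'; rewrite -/(v D'); have [lt|ge] := ltP (v D') 0; first by lia.
  suff : (`|v D'| <= g)%N by lia.
  by apply: gmax; apply/asboolP; exists D'; lia.
have -> : genus F = g.
  rewrite /genus; case: xgetP => [g' _ /= hg'|/(_ g)] //.
  exact: is_genus_uniq hg' hg.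
by split=> //; rewrite -vD; apply: hG.
Qed.

(* If u <> 0 lies in L(D) with deg D < 0, multiplication by u ^ j embeds
   L(- j D), whose dimension grows with j, into L(0). *)
Lemma negative_degree g D u : is_genus F g -> divisor_degree D < 0 ->
  Riemann_Roch_space D u -> u = 0.
Proof.
move=> [hg _] Dneg hu; apply: contrapT => /eqP u0.
have [D0 hD0] : exists D0 : divisor F, forall P, D0 P = 0.
  exact: (divisor_of (S := fset0)).
(* Then L(- j D) has dimension at least deg(- j D) + 1 - g >= 2, while L(0) has dimension at most
   1. *)
pose j := g.+1.
have [D' hD' dD'] := multiple_divisor D (- j%:Z).
have := hg D'; rewrite dD'.
have : dim_le (Riemann_Roch_space D') [set 0] (ell D0).
  apply: (@dim_le_map _ _ (fun w => w * u ^+ j) _ _ (Riemann_Roch_space D0) [set 0]).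
  - by move=> a z w; rewrite mulrDl mulrA.
  - move=> w; rewrite !Riemann_Roch_spaceE /= => hw P.
    have -> : - D0 P = - D' P + (- D P) *+ j by rewrite hD0 hD' mulrn_int mulNr opprK; ring.
    apply: vgeM; first exact: hw.
    by apply: vgeX; move: hu; rewrite Riemann_Roch_spaceE; apply.
  - move=> w _ /= /eqP; rewrite mulf_eq0 expf_eq0 (negPf u0) andbF orbF.
    by move/eqP.
  - exact: Riemann_Roch_subspace.
  - exact: has_dim_dim_le (zero_subspace F) (ell_finite P0 D0).
move=> /(dim_leP (Riemann_Roch_subspace D') (zero_subspace F))[_].
rewrite -/(ell D') /j; have := ell0_le1 hD0.
move: (ell D') (ell D0) (divisor_degree D) Dneg => l l0 d d0 h1 h2 h3.
have : g.+1%:Z <= - g.+1%:Z * d by nia.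
lia.
Qed.

End Genus.

(* In genus 0 there would be z in L(P) not constant, and two further rational
   points Q1, Q2 with z(Q1) = z(Q2) = a; but then z - a lies in L(P - Q1 - Q2). *)
Lemma genus_gt0 (k : finFieldType) (F : fieldExtType {fraction {poly k}}) :
  is_genus F (genus F) -> (#|k| + 2 <= num_rational_points F)%N -> (0 < genus F)%N.
Proof.
move=> hg; rewrite /num_rational_points; set S := fset_set _ => hS.
have inS P : (P \in S) = `[< degree P = 1%N >].
  rewrite in_fset_set; last exact: finite_rational_points.
  by apply/idP/asboolP; rewrite inE.
have [P PS] : exists P, P \in S by apply/fset0Pn; rewrite -cardfs_gt0; lia.
have rat Q : Q \in S -> degree Q = 1%N by rewrite inS => /asboolP.
rewrite lt0n; apply/eqP => g0.
have [D hD dD] := point_divisor P 1.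
have := hg.1 D; rewrite g0 dD rat // => ellD.
have [z Dz zn] : exists2 z, Riemann_Roch_space D z & forall a, z <> @constant k F a.
  apply: contrapT => nex.
  suff : dim_le (Riemann_Roch_space D) [set 0] #|{: unit}|.
    move=> /(dim_leP (Riemann_Roch_subspace D) (zero_subspace F))[_].
    by rewrite card_unit -/(ell D); lia.
  apply: (spanning_dim_le (g := fun=> 1) (zero_subspace F)) => u Du.
  have [a ->] : exists a, u = @constant k F a.
    by apply: contrapT => h; apply: nex; exists u => // a e; apply: h; exists a.
  by exists (fun=> a); rewrite big_const card_unit /= mulr1 addr0 subrr.
have Oz Q : Q != P -> vge Q 0 z.
  by move=> /negPf QP; move: Dz; rewrite Riemann_Roch_spaceE => /(_ Q); rewrite hD QP.
have /choice[a ha] Q : exists a, Q \in (S `\ P)%fset -> vge Q 1 (z - @constant k F a).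
  have [|nQ] := boolP (Q \in (S `\ P)%fset); last by exists 0.
  rewrite !inE => /andP[QP QS].
  by have [b hb] := rational_residue (rat _ QS) (Oz _ QP); exists b.
have [Q1 [Q2 [Q1S Q2S neq eqa]]] : exists Q1, exists Q2,
    [/\ Q1 \in (S `\ P)%fset, Q2 \in (S `\ P)%fset, Q1 != Q2 & a Q1 = a Q2].
  apply: contrapT => nex.
  (* Pigeonhole: at least q + 1 points other than P share q possible values of z. *)
  have inj : injective (fun Q : (S `\ P)%fset => a (val Q)).
    move=> Q Q' e; apply: val_inj; apply: contrapT => /eqP neq; apply: nex.
    by exists (val Q), (val Q'); split=> //; apply: valP.
  have := leq_card _ inj; rewrite -cardfE.
  by have := cardfsD1 P S; rewrite PS add1n => e1 e2; move: hS; rewrite e1 addn2 ltnS ltnNge e2.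
have [E1 hE1 dE1] := point_divisor Q1 (-1).
have [E2 hE2 dE2] := point_divisor Q2 (-1).
have sum_divisor (A B : divisor F) : exists A' : divisor F, forall Q, A' Q = A Q + B Q.
  apply: (divisor_of (S := (finsupp A `|` finsupp B)%fset)) => Q.
  by rewrite inE negb_or => /andP[/fsfun_dflt-> /fsfun_dflt->].
have [E12 hE12] := sum_divisor E1 E2.
have [E hE] := sum_divisor D E12.
have dE : divisor_degree E < 0.
  rewrite (divisor_degreeD hE) (divisor_degreeD hE12) dD dE1 dE2.
  by move: PS Q1S Q2S; rewrite !inE => /rat-> /andP[_ /rat->] /andP[_ /rat->].
have e : z - @constant k F (a Q1) = 0.
  apply: (negative_degree (P0 := P) (rat _ PS) hg dE).
  rewrite Riemann_Roch_spaceE => Q; rewrite hE hE12 hD hE1 hE2.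
  have Dza : vge Q (- D Q) (z - @constant k F (a Q1)).
    apply: vgeB; first by move: Dz; rewrite Riemann_Roch_spaceE; apply.
    apply: vgeW (vge_cst _ _); rewrite hD; case: eqP => //.
  have Q1P : (Q1 == P) = false by move: Q1S; rewrite !inE => /andP[/negPf].
  have Q2P : (Q2 == P) = false by move: Q2S; rewrite !inE => /andP[/negPf].
  have [->|nQ1] := eqVneq Q Q1; first by rewrite Q1P (negPf neq); apply: ha.
  have [->|nQ2] := eqVneq Q Q2; first by rewrite Q2P eqa; apply: ha.
  by move: Dza; rewrite hD !addr0.
by apply: (zn (a Q1)); apply/eqP; rewrite -subr_eq0 e.
Qed.

(** * Kummer extensions *)

Lemma card_pred_gt0 (k : finFieldType) : (0 < #|k|.-1)%N.
Proof. by case: #|k| (finNzRing_gt1 k) => [|[]]. Qed.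

Lemma expf_card_pred (k : finFieldType) (a : k) : a != 0 -> a ^+ #|k|.-1 = 1.
Proof.
move=> a0; apply: (mulIf a0); rewrite mul1r -exprSr.
by rewrite prednK ?expf_card // (ltn_trans _ (finNzRing_gt1 k)).
Qed.

Section KummerDegree.
Variables (k : finFieldType) (F : fieldExtType {fraction {poly k}}).
Notation cst := (@constant k F).
Notation of_poly := (@of_poly k F).
Notation K := {fraction {poly k}}.
Notation N := #|k|.-1.
Variables (R1 R2 : {poly k}) (y : F).
Hypotheses (R1_neq0 : R1 != 0) (R2_neq0 : R2 != 0).
Hypothesis y_def : y ^+ N = (- (tofrac R1 / tofrac R2))%:A.
Hypothesis y_gen : <<1; y>>%VS = fullv.

Lemma kummer_eq : of_poly R2 * y ^+ N = - of_poly R1.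
Proof.
rewrite y_def of_poly_scale scalerA mulrN mulrC divfK ?tofrac_eq0 //.
by rewrite scaleNr.
Qed.

Lemma kummer_neq0 : y != 0.
Proof.
apply/eqP => y0; have := kummer_eq; rewrite y0 expr0n.
have := card_pred_gt0 k; rewrite lt0n => /negPf->.
by rewrite mulr0 => /esym/eqP; rewrite oppr_eq0 of_poly_eq0 (negPf R1_neq0).
Qed.

(* A monic factor of Y ^ N - y ^ N = prod (Y - a y), a in k^*, has constant
   term a constant times a power of y. *)
Lemma kummer_power d (p : {poly F}) : p \is a polyOver 1%VS ->
  p %| 'X^N - (y ^+ N)%:P -> size p = d.+1 -> p \is monic -> y ^+ d \in 1%VS.
Proof.
move=> p1 pdvd sp pmon; have N0 := card_pred_gt0 k.
pose s := enum (predC1 (0 : k)).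
have defX : 'X^N - (y ^+ N)%:P = \prod_(a <- s) ('X - (cst a * y)%:P).
  have := @all_roots_prod_XsubC _ ('X^N - (y ^+ N)%:P) [seq cst a * y | a <- s].
  rewrite lead_coefXnsubC // scale1r big_map; apply.
  - by rewrite size_XnsubC // size_map -cardE cardC1.
  - apply/allP => x /mapP[a]; rewrite mem_enum inE => a0 ->.
    by rewrite rootE !hornerE exprMn -rmorphXn expf_card_pred // rmorph1 mul1r subrr.
  - rewrite uniq_rootsE map_inj_uniq ?enum_uniq // => a b.
    by move=> /(mulIf kummer_neq0); apply: fmorph_inj.
move: pdvd; rewrite defX => /dvdp_prod_XsubC[m].
rewrite eqp_monic ?monic_prod_XsubC // => /eqP pE.
have sm : size (mask m s) = d by move: sp; rewrite pE size_prod_XsubC => -[].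
have p0 : p`_0 = cst (\prod_(a <- mask m s) - a) * y ^+ d.
  rewrite -horner_coef0 pE horner_prod -sm rmorph_prod.
  elim: (mask m s) => [|a l IH]; first by rewrite !big_nil mul1r.
  by rewrite !big_cons {}IH hornerD hornerX hornerN hornerC sub0r rmorphN exprS -mulNr mulrACA.
have u0 : cst (\prod_(a <- mask m s) - a) != 0.
  rewrite fmorph_eq0 prodf_seq_neq0; apply/allP => a /mem_mask.
  by rewrite mem_enum inE oppr_eq0.
rewrite -[y ^+ d](mulKf u0) -p0 -fmorphV.
apply: memvM; last exact: (polyOverP p1).
by rewrite rpredZ // mem1v.
Qed.

(** With denominators cleared: if (- R1 / R2) ^ d is an N-th power (a / b) ^ N in k(x), then N
    divides d. *)
Hypothesis ramified : forall d (a b : {poly k}), b != 0 ->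
  a ^+ N * R2 ^+ d = (- R1) ^+ d * b ^+ N -> (N %| d)%N.

(** The minimal polynomial of y divides Y ^ N - y ^ N, so y ^ d lies in k(x) for its degree d by
    [kummer_power]. Raising to the N-th power makes (- R1 / R2) ^ d an N-th power, hence N divides
    d. *)
Lemma kummer_adjoin_degree : adjoin_degree 1 y = N.
Proof.
have N0 := card_pred_gt0 k.
have yN1 : y ^+ N \in 1%VS by rewrite y_def rpredZ // mem1v.
have pX : 'X^N - (y ^+ N)%:P \is a polyOver 1%VS.
  by rewrite rpredB // ?rpredX ?polyOverX // polyOverC.
have pdvd : minPoly 1 y %| 'X^N - (y ^+ N)%:P.
  by apply: minPoly_dvdp => //; rewrite rootE !hornerE subrr.
have yd := kummer_power (minPolyOver 1 y) pdvd (size_minPoly 1 y) (monic_minPoly 1 y).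
have {yd}[g yg] : exists g : K, y ^+ adjoin_degree 1 y = g%:A by apply/vlineP.
have [a [b [b0 bg]]] := frac_ratio g.
have Nd : (N %| adjoin_degree 1 y)%N.
  apply: (ramified (a := a) b0); apply/eqP; rewrite -tofrac_eq; apply/eqP.
  rewrite !rmorphM !rmorphXn /= rmorphN -bg exprMn mulrAC -mulrA mulrC.
  have Kinj : injective (fun g : K => g%:A : F) by apply: fmorph_inj (in_alg F).
  have e : g ^+ N = (- (tofrac R1 / tofrac R2)) ^+ adjoin_degree 1 y.
    apply: Kinj; rewrite -[1 in LHS](expr1n F N) -exprZn -yg -exprM mulnC exprM.
    by rewrite y_def exprZn expr1n.
  congr (_ * _); rewrite e -exprMn mulrN mulrC divfK //.
  by rewrite tofrac_eq0.
apply/eqP; rewrite eqn_leq; apply/andP; split; last first.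
  by apply: dvdn_leq.
have := dvdp_leq _ pdvd; rewrite size_minPoly size_XnsubC // ltnS; apply.
by rewrite -size_poly_eq0 size_XnsubC.
Qed.

Lemma kummer_dim : \dim {:F} = N.
Proof. by rewrite -y_gen dim_Fadjoin dimv1 muln1 kummer_adjoin_degree. Qed.

Lemma kummer_size_root (p : {poly K}) :
  (size p <= N)%N -> (map_poly (in_alg F) p).[y] = 0 -> p = 0.
Proof.
move=> sp py; apply: contraTeq sp => p0; rewrite -ltnNge.
rewrite -[size p](size_map_poly (in_alg F)).
have : minPoly 1 y %| map_poly (in_alg F) p.
  apply: minPoly_dvdp; last exact/eqP.
  by apply/polyOverP => i; rewrite coef_map rpredZ // mem1v.
move/dvdp_leq; rewrite size_minPoly kummer_adjoin_degree; apply.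
by rewrite map_poly_eq0.
Qed.

Lemma kummer_free (g : 'I_N -> K) : \sum_i g i *: y ^+ i = 0 -> forall i, g i = 0.
Proof.
move=> h; pose p := \sum_(i < N) (g i)%:P * 'X^i : {poly K}.
have cp (i : 'I_N) : p`_i = g i.
  rewrite coef_sum (bigD1 i) //= coefCM coefXn eqxx mulr1 big1 ?addr0 // => j ji.
  by rewrite coefCM coefXn eq_sym (inj_eq val_inj) (negPf ji) mulr0.
move=> i; rewrite -cp (@kummer_size_root p) ?coef0 //.
  apply: (leq_trans (size_sum _ _ _)); apply/bigmax_leqP => j _.
  rewrite mul_polyC (leq_trans (size_scale_leq _ _)) // size_polyXn.
  exact: ltn_ord.
rewrite rmorph_sum horner_sum -[RHS]h; apply: eq_bigr => j _.
by rewrite rmorphM /= map_polyXn map_polyC hornerM hornerC hornerXn mulr_algl.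
Qed.

Lemma kummer_generated z : exists (a : {poly {poly k}}) (d : {poly k}),
  d != 0 /\ of_poly d * z = (map_poly of_poly a).[y].
Proof.
have /Fadjoin_polyP[p p1 ->] : z \in <<1; y>>%VS by rewrite y_gen memvf.
have /choice[g hg] (i : 'I_(size p)) : exists g : K, p`_i = g%:A.
  by apply/vlineP; apply: (polyOverP p1).
have [d d0 [h hd]] := common_denominator g.
exists (\poly_(i < size p) (if insub i is Some j then h j else 0)), d; split=> //.
rewrite horner_coef (@horner_coef_wide _ (size p)); last first.
  by rewrite (leq_trans (size_poly _ _)) // size_poly.
rewrite mulr_sumr; apply: eq_bigr => i _.
rewrite coef_map coef_poly ltn_ord valK /= mulrA; congr (_ * _).
by rewrite hg of_poly_scale scalerA hd.
Qed.

End KummerDegree.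

(** * Rational places above the points where R_1 + R_2 vanishes and R_2 does not *)

Section KummerPoints.
Variables (k : finFieldType) (F : fieldExtType {fraction {poly k}}).
Notation cst := (@constant k F).
Notation of_poly := (@of_poly k F).
Notation K := {fraction {poly k}}.
Notation N := #|k|.-1.
Variables (R1 R2 : {poly k}) (y : F).
Hypotheses (R1_neq0 : R1 != 0) (R2_neq0 : R2 != 0).
Hypothesis y_def : y ^+ N = (- (tofrac R1 / tofrac R2))%:A.
Hypothesis y_gen : <<1; y>>%VS = fullv.
Hypothesis ramified : forall d (a b : {poly k}), b != 0 ->
  a ^+ N * R2 ^+ d = (- R1) ^+ d * b ^+ N -> (N %| d)%N.

Section OnePoint.
Variables c zeta : k.
Hypotheses (zeta_neq0 : zeta != 0) (R2c : R2.[c] != 0) (R12c : R1.[c] + R2.[c] = 0).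

Definition eval_F (a : {poly {poly k}}) : F := (map_poly of_poly a).[y].
Definition eval_k (a : {poly {poly k}}) : k := a.[zeta%:P].[c].

Lemma eval_FD a b : eval_F (a + b) = eval_F a + eval_F b.
Proof. by rewrite /eval_F rmorphD hornerD. Qed.
Lemma eval_FM a b : eval_F (a * b) = eval_F a * eval_F b.
Proof. by rewrite /eval_F rmorphM hornerM. Qed.
Lemma eval_FC h : eval_F h%:P = of_poly h.
Proof. by rewrite /eval_F map_polyC hornerC. Qed.
Lemma eval_FX : eval_F 'X = y.
Proof. by rewrite /eval_F map_polyX hornerX. Qed.
Lemma eval_kD a b : eval_k (a + b) = eval_k a + eval_k b.
Proof. by rewrite /eval_k !hornerD. Qed.
Lemma eval_kM a b : eval_k (a * b) = eval_k a * eval_k b.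
Proof. by rewrite /eval_k !hornerM. Qed.
Lemma eval_kC h : eval_k h%:P = h.[c].
Proof. by rewrite /eval_k hornerC. Qed.

(* Pseudo-division by the minimal equation R2 Y ^ N + R1, which vanishes at
   both points. *)
Lemma eval_compat a : eval_F a = 0 -> eval_k a = 0.
Proof.
move=> a0; have N0 := card_pred_gt0 k.
pose Q : {poly {poly k}} := R2%:P * 'X^N + R1%:P.
have QF : eval_F Q = 0.
  rewrite /Q eval_FD eval_FM !eval_FC /eval_F map_polyXn hornerXn.
  by rewrite (kummer_eq R2_neq0 y_def) addNr.
have Qk : eval_k Q = 0.
  rewrite /Q eval_kD eval_kM !eval_kC /eval_k hornerXn -rmorphXn expf_card_pred //.
  by rewrite hornerC mulr1 addrC.
have szQ0 : (size R1%:P < size (R2%:P * 'X^N)%R)%N.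
  rewrite mul_polyC size_scale // size_polyXn; apply: leq_ltn_trans (size_polyC_leq1 _) _.
  by rewrite ltnS.
have szQ : size Q = N.+1.
  by rewrite /Q size_polyDl // mul_polyC size_scale // size_polyXn.
have lcQ : lead_coef Q = R2.
  by rewrite /Q lead_coefDl // mul_polyC lead_coefZ lead_coefXn mulr1.
have Q0 : Q != 0 by rewrite -size_poly_eq0 szQ.
have := Pdiv.Idomain.divp_eq a Q; rewrite lcQ.
set s := scalp _ _; set q := _ %/ _; set r := _ %% _ => e.
have r0 : r = 0.
  have rF : eval_F r = 0.
    have : eval_F (R2 ^+ s *: a) = 0 by rewrite -mul_polyC eval_FM a0 mulr0.
    by rewrite e eval_FD eval_FM QF mulr0 add0r.
  suff /(map_inj_poly) : map_poly (@tofrac _) r = map_poly (@tofrac _) 0 .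
    by apply=> [u v /eqP|]; rewrite ?rmorph0 // tofrac_eq => /eqP.
  rewrite rmorph0; apply: (kummer_size_root R1_neq0 R2_neq0 y_def ramified).
    by rewrite (leq_trans (size_poly _ _)) // -ltnS -szQ Pdiv.Idomain.ltn_modp.
  by rewrite -map_poly_comp.
have : eval_k (R2 ^+ s *: a) = 0 by rewrite e r0 addr0 eval_kM Qk mulr0.
rewrite -mul_polyC eval_kM eval_kC horner_exp => /eqP.
by rewrite mulf_eq0 expf_eq0 (negPf R2c) andbF /= => /eqP.
Qed.

(** The local ring at (c, zeta) of the affine curve R2 Y ^ N + R1 = 0. *)
Definition point_ring : set F :=
  [set z | exists a b, eval_k b != 0 /\ z * eval_F b = eval_F a].

Lemma eval_F_neq0 b : eval_k b != 0 -> eval_F b != 0.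
Proof. by apply: contraNneq => /eval_compat->. Qed.

Lemma point_ring_eval a : point_ring (eval_F a).
Proof.
exists a, 1%:P; rewrite eval_kC hornerC oner_neq0; split=> //.
by rewrite eval_FC rmorph1 mulr1.
Qed.

Lemma point_ring_subalgebra : subalgebra point_ring.
Proof.
split=> [h|z w [a [b [b0 e]]] [a' [b' [b'0 e']]]|z w [a [b [b0 e]]] [a' [b' [b'0 e']]]].
- by rewrite -of_polyC -eval_FC; apply: point_ring_eval.
- exists (a * b' + a' * b), (b * b'); rewrite eval_kM mulf_neq0 //; split=> //.
  by rewrite eval_FD !eval_FM -e -e'; ring.
- exists (a * a'), (b * b'); rewrite eval_kM mulf_neq0 //; split=> //.
  by rewrite !eval_FM -e -e'; ring.
Qed.

Let t := of_poly ('X - c%:P).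

Lemma point_t_neq0 : t != 0.
Proof. by rewrite of_poly_eq0 polyXsubC_eq0. Qed.

Lemma point_ring_inv a : eval_k a != 0 -> point_ring (eval_F a)^-1.
Proof.
move=> a0; exists 1%:P, a; split=> //.
by rewrite mulVf ?eval_F_neq0 // eval_FC rmorph1.
Qed.

Lemma point_ring_tV : ~ point_ring t^-1.
Proof.
move=> [a [b [b0 e]]]; move/eqP: b0; apply.
have : eval_F (b - ('X - c%:P)%:P * a) = 0.
  by rewrite -mulNr eval_FD eval_FM -rmorphN eval_FC rmorphN -/t -e mulNr
    mulVKf ?point_t_neq0 // subrr.
by move/eval_compat; rewrite -mulNr eval_kD eval_kM -rmorphN eval_kC
  !hornerE subrr oppr0 mul0r addr0.
Qed.

Lemma natr_card_finField : (#|k|%:R : k) = 0.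
Proof.
have : \sum_(a : k) a = \sum_(a : k) (a + 1).
  by rewrite [LHS](reindex_inj (addIr 1)).
rewrite big_split /= sumr_const -{1}[\sum_a a]addr0 => /addrI.
by move/esym.
Qed.

(* (y - zeta) U = y ^ N - zeta ^ N = - (R1 + R2) / R2, and U takes the value
   N zeta ^ (N - 1) <> 0 at the point. *)
Lemma point_ring_y : point_ring ((y - cst zeta) / t).
Proof.
have /factor_theorem[R' R'E] : root (R1 + R2) c by rewrite /root hornerD R12c.
have N0 := card_pred_gt0 k.
pose U : {poly {poly k}} := \sum_(i < N) 'X^(N.-1 - i) * (zeta%:P%:P) ^+ i.
exists (- R'%:P), (U * R2%:P); split.
  rewrite eval_kM eval_kC mulf_neq0 // /eval_k /U !horner_sum.
  have -> : \sum_(i < N) ('X^(N.-1 - i) * zeta%:P%:P ^+ i).[zeta%:P].[c] =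
      \sum_(i < N) zeta ^+ N.-1.
    apply: eq_bigr => i _; rewrite hornerM hornerXn horner_exp hornerC -exprD.
    by rewrite subnK ?horner_exp ?hornerC // -ltnS prednK.
  rewrite sumr_const card_ord -mulr_natr mulf_neq0 ?expf_neq0 //.
  have : (N%:R + 1 : k) = 0.
    by rewrite natr1 prednK ?natr_card_finField // (ltn_trans _ (finNzRing_gt1 k)).
  by move/eqP; rewrite addr_eq0 => /eqP->; rewrite oppr_eq0 oner_neq0.
have UE : (y - cst zeta) * eval_F U = y ^+ N - 1.
  rewrite -[1](rmorph1 cst) -(expf_card_pred zeta_neq0) rmorphXn subrXX; congr (_ * _).
  rewrite /eval_F /U rmorph_sum horner_sum; apply: eq_bigr => i _.
  by rewrite rmorphM !rmorphXn /= map_polyX map_polyC hornerM !horner_exp hornerX hornerC.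
have eN : eval_F (- R'%:P) = - of_poly R' by rewrite -rmorphN eval_FC rmorphN.
rewrite eN eval_FM eval_FC.
have -> : (y - cst zeta) / t * (eval_F U * of_poly R2) =
    (y - cst zeta) * eval_F U * of_poly R2 / t by rewrite mulrAC !mulrA.
rewrite UE; apply: (mulIf point_t_neq0); rewrite divfK ?point_t_neq0 //.
rewrite mulrBl mul1r mulrC (kummer_eq R2_neq0 y_def) mulNr -rmorphM -R'E.
by rewrite rmorphD opprD.
Qed.

(** The ideal of the point is generated by Y - zeta and x - c, and [point_ring_y] makes t = x - c
    divide the former. *)
Lemma point_ring_vanish a : eval_k a = 0 -> point_ring (eval_F a / t).
Proof.
move=> a0.
have [q ->] : exists q, a = q * ('X - zeta%:P%:P) + a.[zeta%:P]%:P.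
  have /factor_theorem[q e] : root (a - a.[zeta%:P]%:P) zeta%:P.
    by rewrite /root hornerD hornerN hornerC subrr.
  by exists q; rewrite -e subrK.
have /factor_theorem[h ->] : root a.[zeta%:P] c by rewrite /root -/(eval_k a) a0.
rewrite eval_FD eval_FM mulrDl; have hO := point_ring_subalgebra.
apply: (subalgD hO); last first.
  by rewrite eval_FC rmorphM /= mulfK ?point_t_neq0 // -eval_FC; apply: point_ring_eval.
rewrite -mulrA; apply: (subalgM hO); first exact: point_ring_eval.
have -> : eval_F ('X - zeta%:P%:P) = y - cst zeta; last exact: point_ring_y.
by rewrite eval_FD eval_FX -polyCN eval_FC rmorphN.
Qed.

Lemma point_ring_unit u : u != 0 -> point_ring u -> ~ point_ring (u / t) ->
  point_ring u^-1.
Proof.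
move=> u0 [a [b [b0 e]]] nO; have bF := eval_F_neq0 b0.
have [a0|a0] := eqVneq (eval_k a) 0.
  case: nO; have -> : u / t = (eval_F a / t) * (eval_F b)^-1.
    by rewrite -e mulrAC mulfK.
  apply: (subalgM point_ring_subalgebra); first exact: point_ring_vanish.
  exact: point_ring_inv.
exists b, a; split=> //; rewrite -e mulrA mulVf // mul1r //.
Qed.

(** Some multiple of a is a nonzero polynomial d in x. The multiplicity of c in d bounds the powers
    of t dividing a, and at the largest such power the quotient is a unit. *)
Lemma point_ring_power_eval a : eval_F a != 0 -> exists j : nat,
  point_ring (eval_F a / t ^+ j) /\ point_ring (eval_F a / t ^+ j)^-1.
Proof.
move=> a0; have hO := point_ring_subalgebra.
have [a' [d [d0 da]]] := kummer_generated y_gen (eval_F a)^-1.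
have {da}ad : eval_F a * eval_F a' = of_poly d by rewrite /eval_F -da mulrCA divff // mulr1.
have [m [d' hd' dE]] := multiplicity_XsubC d c; rewrite d0 /= in hd'.
have d'O : point_ring (of_poly d')^-1.
  by rewrite -eval_FC; apply: point_ring_inv; rewrite eval_kC.
have bound j : point_ring (eval_F a / t ^+ j) -> (j <= m)%N.
  move=> Oj; rewrite leqNgt; apply/negP => mj; apply: point_ring_tV.
  have tj0 i : t ^+ i != 0 by rewrite expf_neq0 // point_t_neq0.
  have t0 := point_t_neq0.
  have a'0 : eval_F a' != 0.
    by apply: contraNneq d0 => a'0; rewrite -(of_poly_eq0 F) -ad a'0 mulr0.
  have -> : t^-1 = (eval_F a / t ^+ j) * eval_F a' * t ^+ (j - m).-1 * (of_poly d')^-1.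
    have -> : of_poly d' = eval_F a * eval_F a' / t ^+ m.
      by rewrite ad dE rmorphM rmorphXn /= -/t mulfK ?tj0.
    have -> : t ^+ j = t ^+ (j - m).-1 * t * t ^+ m.
      by rewrite -exprSr -exprD; congr (_ ^+ _); lia.
    move: a0 a'0 (tj0 m) (tj0 (j - m).-1) t0.
    move: (eval_F a) (eval_F a') (t ^+ m) (t ^+ (j - m).-1) (t) => A A' T2 T1 T.
    by move=> A0 A'0 T20 T10 T0; field; rewrite A0 A'0 T20 T10 T0.
  apply: (subalgM hO) => //; apply: (subalgM hO).
    by apply: (subalgM hO) => //; apply: point_ring_eval.
  by apply: (subalgX hO); rewrite /t -eval_FC; apply: point_ring_eval.
pose Q j := `[< point_ring (eval_F a / t ^+ j) >].
have Q0 : exists j, Q j.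
  by exists 0%N; apply/asboolP; rewrite expr0 divr1; apply: point_ring_eval.
have QB j : Q j -> (j <= m)%N by move=> /asboolP; apply: bound.
have [j /asboolP Oj jmax] := ex_maxnP Q0 QB.
exists j; split=> //; apply: point_ring_unit => //.
  by rewrite mulf_neq0 // invr_eq0 expf_neq0 // point_t_neq0.
move=> h; suff /jmax : Q j.+1 by rewrite ltnn.
by apply/asboolP; rewrite exprSr invfM mulrA.
Qed.

Lemma point_ring_power z : z != 0 -> exists j : int,
  point_ring (z / t ^ j) /\ point_ring (z / t ^ j)^-1.
Proof.
move=> z0; have hO := point_ring_subalgebra.
have [a [d [d0 da]]] := kummer_generated y_gen z.
have dF0 : eval_F d%:P != 0 by rewrite eval_FC of_poly_eq0.
have az : eval_F a = eval_F d%:P * z by rewrite eval_FC da.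
have a0 : eval_F a != 0 by rewrite az mulf_neq0.
have [i [i1 i2]] := point_ring_power_eval a0.
have [j [j1 j2]] := point_ring_power_eval dF0.
have t0 := point_t_neq0.
exists (i%:Z - j%:Z).
have -> : z / t ^ (i%:Z - j%:Z) = (eval_F a / t ^+ i) * (eval_F d%:P / t ^+ j)^-1.
  rewrite az expfzDr // -exprnN -exprnP.
  have tj0 l : t ^+ l != 0 by rewrite expf_neq0.
  move: dF0 (tj0 i) (tj0 j); move: (eval_F d%:P) (t ^+ i) (t ^+ j) => A T1 T2.
  by move=> A0 T10 T20; field; rewrite A0 T10 T20.
split; first exact: (subalgM hO).
by rewrite [X in point_ring X]invfM invrK; apply: (subalgM hO).
Qed.

Theorem kummer_point : exists P : place F,
  [/\ degree P = 1%N, vge P 1 (of_poly 'X - cst c) & vge P 1 (y - cst zeta)].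
Proof.
have t0 := point_t_neq0; have hO := point_ring_subalgebra.
have Ot : point_ring t by rewrite /t -eval_FC; apply: point_ring_eval.
have [P [Pt hP]] := place_of_uniformizer hO t0 Ot point_ring_tV point_ring_power.
have max z : point_ring (z / t) -> vge P 1 z.
  by move/hP; rewrite -(vge_mulr _ _ t0 Pt) divfK.
exists P; split.
- apply: (dim_quoE (local_ring_subspace P) (maximal_ideal_subspace P)).
  apply: (independent_spanning_has_dim (e := fun=> 1) (maximal_ideal_subspace P)).
  + by move=> _; rewrite local_ringE /= vge1.
  + move=> g; rewrite big_ord_recl big_ord0 addr0 mulr1 maximal_idealE /=.
    by move=> /vge1_cst g0 i; rewrite ord1.
  + move=> z; rewrite local_ringE maximal_idealE /= => /hP[a [b [b0 e]]].
    exists (fun=> eval_k a / eval_k b).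
    rewrite big_ord_recl big_ord0 addr0 mulr1.
    set v := _ / _; have -> : z - cst v = eval_F (a - v%:P%:P * b) * (eval_F b)^-1.
      rewrite -mulNr eval_FD eval_FM -!polyCN eval_FC of_polyC rmorphN -e mulNr.
      by rewrite mulrBl !mulfK // eval_F_neq0.
    apply: max; rewrite mulrAC; apply: (subalgM hO); last exact: point_ring_inv.
    apply: point_ring_vanish; rewrite -mulNr eval_kD eval_kM -!polyCN eval_kC hornerC.
    by rewrite mulNr divfK // subrr.
- by apply: max; rewrite -of_polyC -rmorphB divff //; apply: subalg1.
- exact/max/point_ring_y.
Qed.

End OnePoint.

(** Distinct pairs (c, zeta) give distinct places, because c and zeta are the residues of x and
    y. *)
Theorem kummer_points_card :
  (#|[set c : k | (R2.[c] != 0)%R && (R1.[c] + R2.[c] == 0)%R]%SET| * N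
     <= num_rational_points F)%N.
Proof.
set A := finset _; pose B := finset.setX A [set~ (0 : k)]%SET.
have cardB : #|B| = (#|A| * N)%N by rewrite cardsX cardsC1.
rewrite -cardB; have [->|[x0 Bx0]] := finset.set_0Vmem B; first by rewrite cards0.
have pt (x : k * k) : x \in B -> exists P : place F, [/\ degree P = 1%N,
    vge P 1 (of_poly 'X - cst x.1) & vge P 1 (y - cst x.2)].
  rewrite !inE => /andP[/andP[R2c /eqP R12c] z0].
  exact: kummer_point.
have [P0 _] := pt x0 Bx0.
have /choice[g hg] (x : k * k) : exists P : place F, x \in B -> [/\ degree P = 1%N,
    vge P 1 (of_poly 'X - cst x.1) & vge P 1 (y - cst x.2)].
  by have [/pt[P hP]|nB] := boolP (x \in B); [exists P | exists P0].
have sub (P : place F) a a' z : vge P 1 (z - cst a) -> vge P 1 (z - cst a') -> a = a'.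
  move=> h h'; apply/eqP; rewrite -subr_eq0; apply/eqP; apply: (@vge1_cst _ _ P).
  rewrite rmorphB; have -> : cst a - cst a' = (z - cst a') - (z - cst a).
    by rewrite opprB [RHS]addrC addrA subrK.
  exact: vgeB.
rewrite /num_rational_points cardE -(size_map g); apply: uniq_leq_size.
  rewrite map_inj_in_uniq ?enum_uniq // => x x'; rewrite !mem_enum.
  move=> /hg[_ h1 h2] /hg[_ h1' h2'] e; rewrite -e in h1' h2'.
  case: x x' h1 h2 h1' h2' {e} => a b [a' b'] /= h1 h2 h1' h2'.
  by congr (_, _); [apply: sub h1 h1' | apply: sub h2 h2'].
move=> P /mapP[x]; rewrite mem_enum => /hg[Prat _ _] ->.
by rewrite in_fset_set; [rewrite inE | apply: finite_rational_points].
Qed.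

End KummerPoints.

(** (a + n - 1) %/ n is a / n rounded up. Two roundings add less than 2, so the integer sum stays
    below M + 2. *)
Lemma divn_ceil_add (n a b M : nat) : (0 < n)%N -> (a + b <= n * M)%N ->
  ((a + n.-1) %/ n + (b + n.-1) %/ n <= M.+1)%N.
Proof.
move=> n0 h; rewrite -ltnS -(ltn_pmul2l n0) mulnDr.
have := leq_trunc_div (a + n.-1) n; have := leq_trunc_div (b + n.-1) n.
by rewrite ![(_ %/ _ * _)%N]mulnC !mulnS; lia.
Qed.

Lemma modn_add_le (n a b : nat) : (0 < n)%N -> (n %| a + b)%N ->
  (a %% n + b %% n <= n)%N.
Proof.
move=> n0 dv; have : (n %| a %% n + b %% n)%N by rewrite /dvdn modnDm.
move=> /dvdnP[j e]; have := ltn_pmod a n0; have := ltn_pmod b n0.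
by case: j e => [|[|j]]; lia.
Qed.

(** Adding the sum to its reversal pairs i with n - i; each of the n - 1 pairs gives at most M + 1,
    and the term 0 vanishes. *)
Lemma sum_ceil_le (n : nat) (alpha : nat -> nat) (M : nat) : (0 < n)%N ->
  alpha 0%N = 0%N ->
  (forall i, (0 < i < n)%N -> (alpha i + alpha (n - i)%N <= n * M)%N) ->
  (2 * \sum_(i < n) (alpha i + n.-1) %/ n <= n.-1 * M.+1)%N.
Proof.
case: n => // n _ a0 h /=.
rewrite big_ord_recl a0 add0n divn_small // add0n mul2n -addnn.
rewrite {2}(reindex_inj rev_ord_inj) -big_split /=.
rewrite -[n in (n * _)%N]card_ord -sum_nat_const; apply: leq_sum => i _ /=.
rewrite /bump !add1n; apply: (@divn_ceil_add n.+1) => //.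
have -> : (n - i.+1).+1 = (n.+1 - i.+1)%N by have := ltn_ord i; lia.
by apply: h; have := ltn_ord i; lia.
Qed.

(** * Integral elements of the Kummer extension and the genus bound *)

Section KummerGenus.
Variables (k : finFieldType) (F : fieldExtType {fraction {poly k}}).
Notation cst := (@constant k F).
Notation of_poly := (@of_poly k F).
Notation K := {fraction {poly k}}.
Notation N := #|k|.-1.
Variables (U V W : {poly k}) (e : nat) (y : F).
Hypotheses (U0 : U != 0) (V0 : V != 0) (W0 : W != 0) (e_gt0 : (0 < e)%N).
Let R1 := (U * W) ^+ e.
Let R2 := V * W.
Hypothesis y_def : y ^+ N = (- (tofrac R1 / tofrac R2))%:A.
Hypothesis y_gen : <<1; y>>%VS = fullv.
Hypothesis ramified : forall d (a b : {poly k}), b != 0 ->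
  a ^+ N * R2 ^+ d = (- R1) ^+ d * b ^+ N -> (N %| d)%N.

(** Since y ^ N = - U ^ e W ^ (e - 1) / V, the exponents of U, W, V in y ^ i are i e / N, i (e - 1)
    / N and - i / N. The integer parts of the first two are divided out, and for i > 0 one factor V
    removes the pole. *)
Definition kummer_coef (i : nat) : K :=
  tofrac (V ^+ (0 < i)%N) / tofrac (U ^+ (i * e %/ N) * W ^+ (i * e.-1 %/ N)).

Definition kummer_elt (i : 'I_N) : F := (kummer_coef i)%:A * y ^+ i.

Let R10 : R1 != 0. Proof. by rewrite expf_neq0 // mulf_neq0. Qed.
Let R20 : R2 != 0. Proof. by rewrite mulf_neq0. Qed.

Lemma kummer_coef_neq0 i : kummer_coef i != 0.
Proof.
by rewrite mulf_neq0 ?invr_eq0 ?tofrac_eq0 ?mulf_neq0 ?expf_neq0.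
Qed.

Lemma kummer_elt_neq0 i : kummer_elt i != 0.
Proof.
rewrite mulf_neq0 ?expf_neq0 ?(kummer_neq0 R10 R20 y_def) //.
by rewrite scaler_eq0 oner_eq0 orbF kummer_coef_neq0.
Qed.

(* z_i ^ N is, up to sign, the monomial in U, V, W with the smallest
   nonnegative exponents in the classes of those of y ^ (N i). *)
Lemma place_kummer_elt (P : place F) (i : 'I_N) : P (kummer_elt i) *+ N =
  P (of_poly V) *+ (N * (0 < i)%N - i) + P (of_poly U) *+ (i * e %% N)
  + P (of_poly W) *+ (i * e.-1 %% N).
Proof.
have u0 : of_poly U != 0 by rewrite of_poly_eq0.
have v0 : of_poly V != 0 by rewrite of_poly_eq0.
have w0 : of_poly W != 0 by rewrite of_poly_eq0.
have y0 := kummer_neq0 R10 R20 y_def.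
have Py : P y *+ N = P (of_poly U) *+ e + P (of_poly W) *+ e.-1 - P (of_poly V).
  have := kummer_eq R20 y_def => /(congr1 P).
  rewrite placeM ?of_poly_eq0 ?expf_neq0 // placeN placeX /R1 /R2 rmorphXn !rmorphM /=.
  rewrite placeX !placeM // mulrnDl -[in P (of_poly W) *+ e](prednK e_gt0) mulrS.
  move: (P y *+ N) (P (of_poly U) *+ e) (P (of_poly W) *+ e.-1) => A B C.
  by move: (P (of_poly V)) (P (of_poly W)) => v w; lia.
have Pel : P (kummer_elt i) = P (of_poly V) *+ (0 < i)%N
    - (P (of_poly U) *+ (i * e %/ N) + P (of_poly W) *+ (i * e.-1 %/ N)) + P y *+ i.
  pose h := U ^+ (i * e %/ N) * W ^+ (i * e.-1 %/ N).
  have h0 : h != 0 by rewrite mulf_neq0 ?expf_neq0.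
  have : of_poly h * kummer_elt i = of_poly (V ^+ (0 < i)%N) * y ^+ i.
    rewrite of_poly_scale /kummer_elt mulr_algl scalerA /kummer_coef -/h.
    by rewrite mulrC divfK ?tofrac_eq0 // -of_poly_scale.
  move/(congr1 P).
  rewrite (placeM _ (z := of_poly h)) ?of_poly_eq0 ?kummer_elt_neq0 //.
  rewrite (placeM _ (z := of_poly (_ ^+ _))) ?of_poly_eq0 ?expf_neq0 //.
  rewrite /h rmorphM !rmorphXn /= placeM ?expf_neq0 // !placeX => hP.
  by rewrite addrAC -hP [RHS]addrC addKr.
have Pyi : P y *+ i *+ N =
    P (of_poly U) *+ (i * e) + P (of_poly W) *+ (i * e.-1) - P (of_poly V) *+ i.
  by rewrite mulrnAC Py mulrnBl mulrnDl -!mulrnA ![(_ * i)%N]mulnC.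
rewrite Pel mulrnDl Pyi.
have hi : (N * (0 < i)%N = (N * (0 < i)%N - i) + i)%N.
  by rewrite subnK //; case: (nat_of_ord i) (ltn_ord i) => [|j] //= h; rewrite muln1 ltnW.
have {hi} : (P (of_poly V) *+ (0 < i)%N) *+ N =
    P (of_poly V) *+ (N * (0 < i)%N - i) + P (of_poly V) *+ i.
  by rewrite -mulrnA -mulrnDr -hi mulnC.
rewrite {2}(divn_eq (i * e) N) {2}(divn_eq (i * e.-1) N) !mulrnDr !mulrnA.
rewrite mulrnBl mulrnDl => ->.
move: (_ *+ (_ - i)%N) (_ *+ i) (_ *+ N) (_ *+ N) (_ *+ (_ %% N)%N) (_ *+ (_ %% N)%N).
by move=> a b' c d r1 r2; ring.
Qed.

Notation x := (of_poly 'X).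
Notation deg := (fun h : {poly k} => (size h).-1).

(** The degree in x of z_i ^ N; divided by N and rounded up it is the constant c_i of
    [Riemann_inequality]. *)
Definition kummer_exponent (i : nat) : nat :=
  deg V * (N * (0 < i)%N - i) + deg U * (i * e %% N) + deg W * (i * e.-1 %% N).

Lemma kummer_elt_finite (i : 'I_N) (P : place F) : vge P 0 x -> vge P 0 (kummer_elt i).
Proof.
move=> hx; rewrite vgeE ?kummer_elt_neq0 //.
have N0 := card_pred_gt0 k.
rewrite -(pmulrn_lge0 _ N0) place_kummer_elt.
have pos (h : {poly k}) : h != 0 -> 0 <= P (of_poly h).
  by move=> h0; rewrite -vgeE ?of_poly_eq0 //; apply: vge_of_poly.
by rewrite !addr_ge0 // mulrn_wge0 // pos.
Qed.

Lemma kummer_elt_infinite (i : 'I_N) (P : place F) : P x < 0 ->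
  vge P (((kummer_exponent i + N.-1) %/ N)%N%:Z * P x) (kummer_elt i).
Proof.
move=> Px; rewrite vgeE ?kummer_elt_neq0 //; have N0 := card_pred_gt0 k.
rewrite -(ler_pMn2r N0) place_kummer_elt.
rewrite (place_infinite Px V0) (place_infinite Px U0) (place_infinite Px W0).
rewrite -!mulrnA -!mulrnDr -/(kummer_exponent i) !mulrn_int.
rewrite [_ * P x]mulrC -mulrA ler_nM2l // -PoszM lez_nat.
have := divn_eq (kummer_exponent i + N.-1) N; have := ltn_pmod (kummer_exponent i + N.-1) N0.
by move: (_ %/ _)%N (_ %% _)%N => c r; lia.
Qed.

Lemma kummer_elt_free (g : 'I_N -> {poly k}) :
  \sum_i of_poly (g i) * kummer_elt i = 0 -> forall i, g i = 0.
Proof.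
move=> h i; have := @kummer_free _ _ _ _ _ R10 R20 y_def ramified
  (fun i => tofrac (g i) * kummer_coef i).
have -> : \sum_(i < N) (tofrac (g i) * kummer_coef i) *: y ^+ i =
    \sum_i of_poly (g i) * kummer_elt i.
  apply: eq_bigr => j _; rewrite of_poly_scale /kummer_elt mulr_algl scalerA //.
move=> /(_ h i)/eqP; rewrite mulf_eq0 (negPf (kummer_coef_neq0 i)) orbF tofrac_eq0.
by move/eqP.
Qed.

(** Put M = deg U + deg V + deg W. The exponents at i and N - i add up to at most N M, since
    residues of two numbers with sum divisible by N add up to at most N. Hence 2 (1 - N + sum of the
    c_i) <= (N - 1) (M + 1 - 2). *)
Theorem kummer_Riemann_inequality (P0 : place F) (D : divisor F) :
  2 * (divisor_degree D - (ell D)%:Z + 1) <=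
  N.-1%:Z * ((deg U + deg V + deg W)%N%:Z - 1).
Proof.
have N0 := card_pred_gt0 k.
have := @Riemann_inequality _ _ P0 'I_N kummer_elt
  (fun i => (kummer_exponent i + N.-1) %/ N)%N.
rewrite card_ord (kummer_dim R10 R20 y_def y_gen ramified) => /(_ erefl).
move=> /(_ (fun i P => @kummer_elt_finite i P) (fun i P => @kummer_elt_infinite i P)).
move=> /(_ kummer_elt_free D).
have := @sum_ceil_le N kummer_exponent (deg U + deg V + deg W) N0.
have -> : kummer_exponent 0 = 0%N.
  by rewrite /kummer_exponent ltnn !mul0n !mod0n !muln0 ?sub0n ?muln0.
move=> /(_ erefl) h; have {h} : (2 * \sum_(i < N) (kummer_exponent i + N.-1) %/ N
    <= N.-1 * (deg U + deg V + deg W).+1)%N.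
  apply: h => i /andP[i0 iN]; rewrite /kummer_exponent i0 subn_gt0 iN !muln1 subKn ?(ltnW iN) //.
  have dvd m : (N %| i * m + (N - i) * m)%N.
    by rewrite -mulnDl subnKC ?dvdn_mulr // ltnW.
  have := modn_add_le N0 (dvd e); have := modn_add_le N0 (dvd e.-1).
  move: (deg U) (deg V) (deg W) (_ * e %% N)%N (_ * e %% N)%N (_ * e.-1 %% N)%N (_ * e.-1 %% N)%N.
  move=> u v w a a' b b' h1 h2.
  have := leq_mul (leqnn u) h2; have := leq_mul (leqnn w) h1.
  have := leq_mul (leqnn v) (leqnn N).
  rewrite -{1 2}(subnK (ltnW iN)); nia.
have -> : N%:Z = N.-1%:Z + 1 by rewrite -{1}(prednK N0) -addn1 PoszD.
move: (\sum_(i < _) _)%N (divisor_degree D - _ + 1) (deg U + deg V + deg W)%N.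
move=> S d M; move: N.-1 => n1; rewrite mulnS -lez_nat PoszM PoszD PoszM => h1 h2.
by rewrite mulrBr mulr1; move: (n1%:Z * M%:Z) h1 => nM h1; lia.
Qed.

End KummerGenus.

(** * p-polynomials *)

Section PPolynomials.
Variables (p : nat).

Lemma p_polynomial_recr (k : fieldType) (a : nat -> k) l n : (l <= n)%N ->
  p_polynomial p a l n = \sum_(l <= i < n) a i *: 'X^(p ^ i) + a n *: 'X^(p ^ n).
Proof. by move=> ln; rewrite /p_polynomial big_nat_recr. Qed.

Lemma size_p_polynomial (k : fieldType) (a : nat -> k) l n : (1 < p)%N ->
  (l <= n)%N -> a n != 0 -> size (p_polynomial p a l n) = (p ^ n).+1.
Proof.
move=> p1 ln an; rewrite p_polynomial_recr // addrC size_polyDl size_scale // size_polyXn //.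
rewrite ltnS; apply: (leq_trans (size_sum _ _ _)); rewrite big_nat.
apply/bigmax_leqP_seq => i _ /andP[_ i_n].
by rewrite (leq_trans (size_scale_leq _ _)) // size_polyXn ltn_exp2l.
Qed.

Variables (k : finFieldType) (pcharkp : p \in [pchar k]).

Lemma deriv_p_polynomial (a : nat -> k) n : (p_polynomial p a 0 n)^`() = (a 0%N)%:P.
Proof.
rewrite /p_polynomial big_nat_recl // derivD linear_sum big1 /= => [|i _].
  by rewrite addr0 derivZ expn0 derivX alg_polyC.
by rewrite derivZ derivXn expnS mulnC mulrnA -mulr_natr -polyC_natr
  (pcharf0 pcharkp) mulr0 scaler0.
Qed.

(** The p ^ m-th power is the identity on k, so a p ^ s-th root of b_i is its power with exponent p
    ^ ((m - 1) s). *)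
Lemma p_polynomial_power (m : nat) (b : nat -> k) s r : #|k| = (p ^ m)%N -> (0 < m)%N ->
  (s <= r)%N -> exists2 beta : nat -> k, forall j, beta j ^+ (p ^ s) = b (j + s)%N &
    p_polynomial p b s r = p_polynomial p beta 0 (r - s) ^+ (p ^ s).
Proof.
move=> card_k m0 sr; have p_pr := pcharf_prime pcharkp.
have frob (x : k) i : x ^+ (p ^ (m * i)) = x.
  elim: i => [|i IH]; first by rewrite muln0.
  by rewrite mulnS expnD exprM -card_k expf_card.
pose beta j := b (j + s)%N ^+ (p ^ (m.-1 * s)).
have root_p j : beta j ^+ (p ^ s) = b (j + s)%N.
  have e : (m.-1 * s + s = m * s)%N by rewrite -{2}(prednK m0) mulSn addnC.
  by rewrite /beta -exprM -expnD e frob.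
exists beta => //.
have pnat : [pchar {poly k}].-nat (p ^ s)%N.
  by rewrite pnatX pnatE // pchar_poly pcharkp.
rewrite /p_polynomial big_mkord -(subSn sr) -{1}[s]add0n big_addn big_mkord.
elim/big_rec2: _ => [|i x1 x2 _ ->]; first by rewrite expr0n gtn_eqF // expn_gt0 prime_gt0.
rewrite (exprDn_pchar _ _ pnat) exprZn root_p -exprM; congr (_ *: _ + _).
by rewrite expnD.
Qed.

End PPolynomials.

Lemma mupX (K : fieldType) (z : K) (q : {poly K}) n : q != 0 ->
  mup z (q ^+ n) = (n * mup z q)%N.
Proof.
move=> q0; elim: n => [|n IH]; first by rewrite expr0 mupNroot // rootC oner_neq0.
by rewrite exprS mupM ?expf_neq0 // IH mulSn.
Qed.

(** A multiple root would be a root of the derivative. *)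
Lemma mup_separable (K : fieldType) (z : K) (q : {poly K}) c :
  q^`() = c%:P -> c != 0 -> root q z -> mup z q = 1%N.
Proof.
move=> dq c0 qz; have q0 : q != 0.
  by apply: contra_neq c0 => q0; apply/eqP; rewrite -polyC_eq0 -dq q0 deriv0.
apply/eqP; rewrite eqn_leq; apply/andP; split; last first.
  by rewrite -XsubC_dvd // dvdp_XsubCl.
rewrite -ltnS mup_ltn //; apply/negP => /dvdpP[g qE].
case/eqP: c0; rewrite -[c](hornerC c z) -dq qE expr2 !derivM derivXsubC.
by rewrite !(hornerXsubC, hornerD, hornerM) subrr !(mulr0, mul0r, addr0).
Qed.

Lemma card_zeros_prod_XsubC (k : finFieldType) (P : pred k) (R : {poly k}) :
  R = \prod_(c : k | P c) ('X - c%:P) -> size R = #|P|.+1 /\ forall c, root R c = P c.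
Proof.
move=> ->; rewrite -big_filter size_prod_XsubC; split=> [|c].
  by rewrite size_filter -sum1_count -sum1_card.
by rewrite root_prod_XsubC mem_filter mem_index_enum andbT.
Qed.

Lemma size_predM (R : idomainType) (f g : {poly R}) : f != 0 -> g != 0 ->
  (size (f * g)).-1 = ((size f).-1 + (size g).-1)%N.
Proof.
move=> f0 g0; rewrite size_mul //.
by move: f0 g0; rewrite -!size_poly_gt0; lia.
Qed.

(** * Factorization of R_1 and R_2, and the order of - R_1 / R_2 modulo n-th powers *)

Section Factorization.
Variables (k : finFieldType) (p m r s t : nat).
Hypotheses (pcharkp : p \in [pchar k]) (card_k : #|k| = (p ^ m)%N).
Variables (b c : nat -> k).
Hypothesis s_lt_r : (s < r)%N.
Hypotheses (br0 : b r != 0) (bs0 : b s != 0) (c00 : c 0%N != 0) (ct0 : c t != 0).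
Notation R1 := (p_polynomial p b s r).
Notation R2 := (p_polynomial p c 0 t).

Lemma pchar_gt1 : (1 < p)%N.
Proof. exact: prime_gt1 (pcharf_prime pcharkp). Qed.

Lemma card_exponent_gt0 : (0 < m)%N.
Proof. by rewrite lt0n; apply: contraTneq (finNzRing_gt1 k) => m0; rewrite card_k m0. Qed.

Lemma p_polynomial_factorization : exists S U V W : {poly k},
  [/\ R1 = S ^+ (p ^ s), S = U * W, R2 = V * W,
      (size S).-1 = (p ^ (r - s))%N & [/\ S != 0, exists2 d, d != 0 & S^`() = d%:P &
   forall x, root W x = root R1 x && root R2 x]].
Proof.
have [beta hbeta ->] := p_polynomial_power pcharkp b card_k card_exponent_gt0 (ltnW s_lt_r).
set S := p_polynomial p beta 0 (r - s).
have ps0 : (0 < p ^ s)%N by rewrite expn_gt0 (ltnW pchar_gt1).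
have beta0 i : b (i + s)%N != 0 -> beta i != 0.
  by rewrite -hbeta; apply: contraNneq => ->; rewrite expr0n gtn_eqF.
have szS : size S = (p ^ (r - s)).+1.
  by apply: size_p_polynomial => //; [apply: pchar_gt1 | apply: beta0; rewrite subnK // ltnW].
pose W := gcdp S R2.
exists S, (S %/ W), (R2 %/ W), W; split=> //.
- by rewrite divpK // dvdp_gcdl.
- by rewrite divpK // dvdp_gcdr.
- by rewrite szS.
split.
- by rewrite -size_poly_eq0 szS.
- by exists (beta 0%N); [apply: beta0 | apply: deriv_p_polynomial].
- by move=> x; rewrite root_gcd !rootE horner_exp expf_eq0 ps0.
Qed.

Variables (K : closedFieldType) (iota : {rmorphism k -> K}).
Hypothesis L1_neq_L2 : zero_set iota R1 <> zero_set iota R2.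

Lemma p_polynomial_neq0 : R2 != 0.
Proof. by rewrite -size_poly_eq0 (size_p_polynomial pchar_gt1 _ ct0). Qed.

Lemma coprime_card_pred : coprime #|k|.-1 (p ^ s).
Proof.
rewrite card_k; apply: coprimeXr.
have := @coprimePn (p ^ m); rewrite expn_gt0 (ltnW pchar_gt1) => /(_ isT).
by rewrite coprime_pexpr // card_exponent_gt0.
Qed.

(** As L_1 <> L_2, some z in the algebraic closure is a root of exactly one of S and R_2, and a
    simple one. Comparing multiplicities at z gives that q - 1 divides d p ^ s or d; and p ^ s is
    prime to q - 1. *)
Lemma kummer_ramified d (a g : {poly k}) : g != 0 ->
  a ^+ #|k|.-1 * R2 ^+ d = (- R1) ^+ d * g ^+ #|k|.-1 -> (#|k|.-1 %| d)%N.
Proof.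
move=> g0; have [S [U [V [W [R1E _ _ _ [S0 [e e0 dS] _]]]]]] := p_polynomial_factorization.
have ps0 : (0 < p ^ s)%N by rewrite expn_gt0 (ltnW pchar_gt1).
have N0 := card_pred_gt0 k.
pose f := map_poly iota.
have f0 (h : {poly k}) : h != 0 -> f h != 0 by rewrite /f map_poly_eq0.
have R10 : R1 != 0 by rewrite R1E expf_neq0.
have dR2 : (f R2)^`() = (iota (c 0%N))%:P.
  by rewrite /f deriv_map (deriv_p_polynomial pcharkp) map_polyC.
have dfS : (f S)^`() = (iota e)%:P by rewrite /f deriv_map dS map_polyC.
move=> rel; have a0 : a != 0.
  apply: contraTneq isT => a0; move/eqP: rel.
  rewrite a0 expr0n gtn_eqF // mul0r eq_sym mulf_eq0 !expf_eq0 oppr_eq0.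
  by rewrite (negPf R10) (negPf g0) !andbF.
have {}rel z : (#|k|.-1 * mup z (f a) + d * mup z (f R2) =
    d * (p ^ s * mup z (f S)) + #|k|.-1 * mup z (f g))%N.
  have := congr1 (fun h => mup z (f h)) rel.
  rewrite R1E /f !rmorphM !rmorphXn /= rmorphN /= rmorphXn /= -/f.
  rewrite !mupM ?expf_neq0 ?oppr_eq0 ?expf_neq0 ?f0 ?p_polynomial_neq0 //.
  rewrite !mupX ?oppr_eq0 ?expf_neq0 ?f0 ?p_polynomial_neq0 // => ->.
  have -> : mup z (- f S ^+ (p ^ s)) = (p ^ s * mup z (f S))%N.
    rewrite -mupX ?f0 // -mulN1r mupMr // -polyCN rootC oppr_eq0 oner_neq0 //.
  by [].
have zS z : zero_set iota R1 z = root (f S) z.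
  by rewrite /zero_set /= R1E rmorphXn /= rootE horner_exp expf_eq0 ps0.
have [z hz] : exists z, root (f S) z != root (f R2) z.
  apply: contrapT => nex; apply: L1_neq_L2; apply/seteqP.
  have eqz z : root (f S) z = root (f R2) z.
    have [//|h] := eqVneq (root (f S) z) (root (f R2) z).
    by case: nex; exists z.
  by split=> z; rewrite zS eqz.
have := rel z; have [Sz|nSz] := boolP (root (f S) z).
  have nR2z : ~~ root (f R2) z by move: hz; rewrite Sz; case: (root _ _).
  rewrite (mupNroot nR2z) (mup_separable dfS) ?fmorph_eq0 // muln1 muln0 addn0 => E.
  have : (#|k|.-1 %| d * p ^ s)%N.
    by rewrite -(dvdn_addl _ (dvdn_mulr (mup z (f g)) (dvdnn _))) -E dvdn_mulr.
  by rewrite Gauss_dvdl // coprime_card_pred.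
have R2z : root (f R2) z by move: hz; rewrite (negPf nSz); case: (root _ _).
rewrite (mupNroot nSz) (mup_separable dR2) ?fmorph_eq0 // muln1 muln0 muln0 add0n => E.
by rewrite -(dvdn_addr _ (dvdn_mulr (mup z (f a)) (dvdnn _))) E dvdn_mulr.
Qed.

End Factorization.

(** * Numerical bounds *)

Local Close Scope classical_set_scope.

(** As a = u + v - d, the inequality d (Q - (u + v)) >= 0 gives Q (a - 1) <= (Q - d) (u + v). The
    factor N - 1 of the genus against N of the point count makes the result strict. *)
Lemma genus_points_arith (Q u v d N pts g a : nat) :
  (u + v <= Q)%N -> (d < Q)%N -> (0 < u)%N -> (0 < N)%N -> (a + d = u + v)%N ->
  ((Q - d) * N <= pts)%N -> 2 * g%:Z <= N.-1%:Z * (a%:Z - 1) ->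
  (2 * Q * g < pts * (u + v))%N.
Proof.
move=> uvQ dQ u0 N0 ad hpts hg.
have h1 : ((Q - d) * N * (u + v) <= pts * (u + v))%N by rewrite leq_mul2r hpts orbT.
apply: leq_trans h1; rewrite -ltz_nat.
have hg' : Q%:Z * (2 * g%:Z) <= Q%:Z * (N.-1%:Z * (a%:Z - 1)) by rewrite ler_wpM2l.
have key : Q%:Z * (a%:Z - 1) <= (Q - d)%N%:Z * (u + v)%N%:Z.
  have : 0 <= d%:Z * (Q%:Z - (u + v)%N%:Z) by rewrite mulr_ge0 // subr_ge0 lez_nat.
  have -> : a%:Z = (u + v)%N%:Z - d%:Z by rewrite -ad PoszD addrK.
  rewrite -subzn ?(ltnW dQ) //; move: (u + v)%N => w; nia.
have key2 : N.-1%:Z * (Q%:Z * (a%:Z - 1)) <= N.-1%:Z * ((Q - d)%N%:Z * (u + v)%N%:Z).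
  by rewrite ler_wpM2l.
have pos : 0 < (Q - d)%N%:Z * (u + v)%N%:Z.
  by rewrite mulr_gt0 // ltz_nat ?subn_gt0 // addn_gt0 u0.
have -> : (2 * Q * g)%N%:Z = Q%:Z * (2 * g%:Z) by rewrite !PoszM; ring.
have -> : ((Q - d) * N * (u + v))%N%:Z =
    N.-1%:Z * ((Q - d)%N%:Z * (u + v)%N%:Z) + (Q - d)%N%:Z * (u + v)%N%:Z.
  by rewrite -{1}(prednK N0) !PoszM -addn1 PoszD; ring.
apply: (le_lt_trans hg'); rewrite mulrCA; apply: (le_lt_trans key2).
by rewrite ltrDl.
Qed.

Lemma expn_bounds (p r s t : nat) : (1 < p)%N -> (1 < r)%N -> (0 < s)%N ->
  (s < r)%N -> (t <= s)%N ->
  [/\ (p ^ t + p ^ t <= p ^ r)%N, (p ^ (r - s) + p ^ t <= p ^ r)%N & (4 <= p ^ r)%N].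
Proof.
move=> p1 r1 s0 sr ts.
have le i : (i < r)%N -> (p ^ i <= p ^ r.-1)%N by move=> ir; rewrite leq_exp2l //; lia.
have le2 x y : (x <= p ^ r.-1)%N -> (y <= p ^ r.-1)%N -> (x + y <= p ^ r)%N.
  move=> hx hy; apply: (leq_trans (leq_add hx hy)); rewrite addnn -mul2n.
  by rewrite -{2}(prednK (ltnW r1)) expnS leq_mul2r p1 orbT.
split; [apply: le2; apply: le; lia | apply: le2; apply: le; lia |].
by apply: (@leq_trans (p ^ 2)%N); [rewrite -[4%N]/(2 ^ 2)%N leq_exp2r | rewrite leq_exp2l].
Qed.

(** Q - d is at least Q / 2 >= 2, and 2 n >= n + 3 because n >= 3. *)
Lemma many_points (Q d n : nat) : (4 <= Q)%N -> (d + d <= Q)%N -> (Q <= n.+1)%N ->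
  (n.+1 + 2 <= (Q - d) * n)%N.
Proof.
move=> Q4 dQ Qn; apply: (@leq_trans (2 * n)%N); first by lia.
by rewrite leq_mul2r; lia.
Qed.

Section RatioBound.
Variables (A : rcfType) (p : nat).
Hypothesis p_gt1 : (1 < p)%N.

(** After division by p ^ a this is x + y <= x y + 1 for x, y >= 1: spreading two exponents of fixed
    sum increases the sum of the powers. *)
Lemma expn_balanced (a b c : nat) : (a <= b)%N -> (a <= c)%N ->
  (p ^ b + p ^ c <= p ^ (b + c - a) + p ^ a)%N.
Proof.
move=> ab ac; rewrite -(subnK ab) -(subnK ac).
have -> : (b - a + a + (c - a + a) - a = (b - a) + (c - a) + a)%N by lia.
rewrite !expnD; have := expn_gt0 p (b - a); have := expn_gt0 p (c - a).
rewrite (ltnW p_gt1) /=; move: (p ^ (b - a))%N (p ^ (c - a))%N (p ^ a)%N => x y z.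
by case: x y => [|x] [|y] // _ _; nia.
Qed.

(** The exponents r - u and u of the denominator have fixed sum r; the smaller of them is the [a] of
    [expn_balanced]. *)
Lemma ratio_bound_optimal r u : (0 < u < r)%N ->
  ratio_bound A p r u u <= ratio_bound A p r r./2 r./2.
Proof.
move=> /andP[u0 ur]; have p0 : (0 < p)%N := ltnW p_gt1.
have den0 i j : 0 < (p ^ i + p ^ j)%:R :> A by rewrite ltr0n addn_gt0 expn_gt0 p0.
rewrite /ratio_bound ler_wpM2l // lef_pV2 ?posrE ?den0 // ler_nat.
have := odd_double_half r; rewrite -addnn => er.
have [uh|hu] := leqP u r./2.
  have h : (u <= r - r./2)%N by lia.
  have := expn_balanced h uh; rewrite subnK; last by lia.
  by [].
have h : (r - u <= r - r./2)%N by lia.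
have h' : (r - u <= r./2)%N by lia.
have := expn_balanced h h'; rewrite subnK; last by lia.
by rewrite subKn ?(ltnW ur) // addnC [X in (_ <= X)%N]addnC addnC.
Qed.

Lemma ratio_bound_half r : ratio_bound A p r r./2 r./2 =
  if odd r then 2 * Num.sqrt (p ^ r.+1)%:R / (p%:R + 1) else Num.sqrt (p ^ r)%:R.
Proof.
have p0 : (0 < p)%N := ltnW p_gt1.
have pA0 : (p%:R : A) != 0 by rewrite pnatr_eq0 -lt0n.
have sqrtE i : Num.sqrt (p ^ (i + i))%:R = p%:R ^+ i :> A.
  by rewrite addnn -muln2 natrX exprM sqrtr_sqr ger0_norm // exprn_ge0 // ler0n.
have := odd_double_half r; rewrite /ratio_bound -addnn.
case: (odd r); move: r./2 => h <- {r}.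
  have p1 : (p%:R : A) + 1 != 0 by rewrite natr1 pnatr_eq0.
  have ph0 : (p%:R : A) ^+ h != 0 by rewrite expf_neq0.
  have -> : (true + (h + h) - h = h.+1)%N by lia.
  have -> : (true + (h + h)).+1 = (h.+1 + h.+1)%N by lia.
  rewrite sqrtE add1n natrM natrD !natrX !exprS exprD.
  move: (p%:R ^+ h) ph0 => H H0; move: (p%:R : A) p1 => P P1.
  have D0 : P * H + H != 0 by rewrite -[X in _ + X]mul1r -mulrDl mulf_neq0.
  by field; rewrite P1 D0.
have ph0 : (p%:R : A) ^+ h != 0 by rewrite expf_neq0.
rewrite add0n addnK sqrtE natrM natrD !natrX exprD.
by move: (p%:R ^+ h) ph0 => H H0; field; rewrite ?H0 // -mulr2n mulrn_eq0 H0.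
Qed.

End RatioBound.

(** * The two estimates combined *)

Theorem mainTheorem2 (A : rcfType) (p m r s t : nat) (k : finFieldType)
    (pcharkp : p \in [pchar k]) (card_k : #|k| = (p ^ m)%N)
    (r_ge2 : (2 <= r)%N)
    (L : {vspace pPrimeCharType pcharkp}) (dimL : \dim L = r)
    (b c : nat -> k)
    (s_gt0 : (0 < s)%N) (s_lt_r : (s < r)%N) (t_le_s : (t <= s)%N)
    (bs_br : b s * b r != 0) (c0_ct : c 0%N * c t != 0)
    (R_split : subspace_poly L = p_polynomial p b s r + p_polynomial p c 0 t)
    (kbar : closedFieldType) (iota : {rmorphism k -> kbar})
    (kbar_alg : integralRange iota)
    (L1_neq_L2 : zero_set iota (p_polynomial p b s r)
                 <> zero_set iota (p_polynomial p c 0 t))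
    (F : fieldExtType {fraction {poly k}})
    (F_def : kummer_function_field F (p ^ m).-1
               (- (tofrac (p_polynomial p b s r) / tofrac (p_polynomial p c 0 t)))) :
  let ratio : A := (num_rational_points F)%:R / (genus F)%:R in
  [/\ ratio > ratio_bound A p r s t,
      forall u : nat, (0 < u < r)%N ->
        ratio_bound A p r u u <= ratio_bound A p r r./2 r./2
    & s = r./2 -> t = r./2 ->
        ratio > if odd r then 2 * Num.sqrt (p ^ r.+1)%:R / (p%:R + 1)
                else Num.sqrt (p ^ r)%:R].
Proof.
move=> ratio; have p1 := pchar_gt1 pcharkp; have p0 : (0 < p)%N := ltnW p1.
suff bound : ratio > ratio_bound A p r s t.
  split=> // [u|es et]; first exact: ratio_bound_optimal.
  by rewrite -ratio_bound_half // -{1}es -et.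
move: bs_br c0_ct; rewrite !mulf_eq0 !negb_or => /andP[bs0 br0] /andP[c00 ct0].
have [y y_def y_gen] := F_def; rewrite -card_k in y_def.
have N0 := card_pred_gt0 k.
have [S [U [V [W [R1E SE R2E szS [S0 _ rootW]]]]]] :=
  p_polynomial_factorization t pcharkp card_k c s_lt_r br0 bs0.
have [U0 W0] : U != 0 /\ W != 0 by move: S0; rewrite SE mulf_eq0 negb_or => /andP.
have R20 := p_polynomial_neq0 pcharkp ct0.
have V0 : V != 0 by move: R20; rewrite R2E mulf_eq0 negb_or => /andP[].
have e0 : (0 < p ^ s)%N by rewrite expn_gt0 p0.
have ram := kummer_ramified pcharkp card_k s_lt_r br0 bs0 c00 ct0 L1_neq_L2.
have szR1 := size_p_polynomial p1 (ltnW s_lt_r) br0.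
have szR2 := size_p_polynomial p1 (leq0n t) ct0.
have R10 : p_polynomial p b s r != 0 by rewrite -size_poly_eq0 szR1.
have [szR rootR] := card_zeros_prod_XsubC (erefl (subspace_poly L)).
have cardL : #|[pred x : k | (x : pPrimeCharType pcharkp) \in L]| = (p ^ r)%N.
  apply/eqP; rewrite -eqSS -szR R_split size_polyDl szR1 // szR2 ltnS.
  by rewrite ltn_exp2l // (leq_ltn_trans t_le_s).
have pr_le_q : (p ^ r <= #|k|.-1.+1)%N.
  by rewrite -cardL prednK ?max_card // (ltn_trans _ (finNzRing_gt1 k)).
have [ptr puv pr4] := expn_bounds p1 r_ge2 s_gt0 s_lt_r t_le_s.
have degUW : ((size U).-1 + (size W).-1 = p ^ (r - s))%N by rewrite -szS SE size_predM.
have degVW : ((size V).-1 + (size W).-1 = p ^ t)%N by rewrite -size_predM // -R2E szR2.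
pose B := [set x : k | ((p_polynomial p c 0 t).[x] != 0)%R &
  ((p_polynomial p b s r).[x] + (p_polynomial p c 0 t).[x] == 0)%R]%SET.
(* L is covered by B and the roots of W: an x in L with R_2(x) = 0 also has R_1(x) = 0. There are at
   most deg W such roots. *)
have cardB : (p ^ r - (size W).-1 <= #|B|)%N.
  rewrite leq_subLR -cardL; pose Z := [set x | root W x]%SET.
  have cardZ : (#|Z| <= (size W).-1)%N.
    rewrite cardE -ltnS prednK ?size_poly_gt0 //; apply: max_poly_roots => //.
      by apply/allP => x; rewrite mem_enum inE.
    exact: enum_uniq.
  apply: leq_trans (leq_add cardZ (leqnn _)).
  apply: leq_trans (leq_card_setU Z B).1.
  apply: subset_leq_card; apply/fintype.subsetP => x; rewrite !inE => xL.
  have : root (subspace_poly L) x by rewrite rootR.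
  rewrite R_split rootE hornerD => /[dup] /eqP h ->; rewrite andbT.
  rewrite rootW !rootE.
  case: (eqVneq (p_polynomial p c 0 t).[x] 0) => [h2|]; rewrite ?orbT //.
  by rewrite h2 addr0 in h; rewrite h eqxx.
have hpts : (#|B| * #|k|.-1 <= num_rational_points F)%N.
  exact: kummer_points_card R10 R20 y_def y_gen ram.
have hpts' : ((p ^ r - (size W).-1) * #|k|.-1 <= num_rational_points F)%N.
  by apply: leq_trans hpts; rewrite leq_mul2r cardB orbT.
have dv : ((size W).-1 <= p ^ t)%N by rewrite -degVW leq_addl.
(* This serves twice: it supplies the rational place P0 needed for the genus, and it excludes genus
   0. *)
have many : (#|k| + 2 <= num_rational_points F)%N.
  apply: leq_trans hpts'.
  have kE : #|k| = #|k|.-1.+1 by rewrite prednK // (ltn_trans _ (finNzRing_gt1 k)).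
  rewrite {1}kE; apply: many_points => //.
  exact: leq_trans (leq_add dv dv) ptr.
have [P0 P0rat] : exists P0 : place F, degree P0 = 1%N.
  have /fset0Pn[P0] : fset_set (@rational_points k F) != fset0.
    by rewrite -cardfs_gt0; apply: leq_trans many; rewrite addn2.
  by rewrite in_fset_set ?inE; [exists P0 | apply: finite_rational_points].
rewrite R1E SE R2E in y_def ram.
have RI := kummer_Riemann_inequality U0 V0 W0 e0 y_def y_gen ram P0.
set X := _ * _ in RI.
(* Any upper bound makes the genus an attained maximum; the factor 2 is recovered in [gX] from the
   divisor that attains it. *)
have [hg _] : is_genus F (genus F) /\ (genus F)%:Z <= `|X|.
  have le_norm (v X' : int) : 2 * v <= X' -> v <= `|X'| by clear; lia.
  by apply: (genus_le P0rat) => D; apply: le_norm; apply: RI.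
have g0 := genus_gt0 hg many.
have gX : 2 * (genus F)%:Z <= X by have [_ [D <-]] := hg; apply: RI.
have key : (2 * p ^ r * genus F < num_rational_points F * (p ^ (r - s) + p ^ t))%N.
  apply: genus_points_arith puv _ _ N0 _ hpts' gX.
  - by apply: leq_ltn_trans dv _; rewrite ltn_exp2l // (leq_ltn_trans t_le_s).
  - by rewrite expn_gt0 p0.
  - by rewrite -degUW -degVW /=; clear; lia.
rewrite /ratio /ratio_bound ltr_pdivrMr ?ltr0n ?addn_gt0 ?expn_gt0 ?p0 //.
by rewrite mulrAC ltr_pdivlMr ?ltr0n // -!natrM ltr_nat.
Qed.
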